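(* Let $V=\mathbb{C}^3$, $\phi\in S^6V$. Let $\phi_{3,3}:S^3V^*\to S^3V$ be the symmetric flattening and let $\phi_{42,42}:S_{(4,2)}V\to S_{(6,4,2)}V\cong S_{(4,2)}V$ be multiplication by $\phi$ followed by projection onto the Pieri component (this map has rank $3$ when $\phi$ is a sixth power). Then: (1) $\sigma_7(v_6(\mathbb{P}^2))$ is an irreducible component of the variety defined by the size $8$ minors of $\phi_{3,3}$ and the size $22$ minors of $\phi_{42,42}$; (2) $\sigma_8(v_6(\mathbb{P}^2))$ is an irreducible component of the variety defined by the size $9$ minors of $\phi_{3,3}$ and the size $25$ minors of $\phi_{42,42}$; (3) $\sigma_9(v_6(\mathbb{P}^2))$ is the hypersurface of degree $10$ defined by $\det(\phi_{3,3})$.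
   Context: $S_\lambda V$ is the Schur module; with a volume form on $\mathbb{C}^3$, $S_{(\lambda_1,\lambda_2,\lambda_3)}V\cong S_{(\lambda_1-\lambda_3,\lambda_2-\lambda_3)}V$. $v_6(\mathbb{P}^2)$ is the Veronese variety of sixth powers and $\sigma_k$ its $k$-th secant variety. *)

(* Defs.v *)
From HB Require Import structures.
From mathcomp Require Import all_boot all_order all_algebra all_fingroup.
From mathcomp Require Import reals complex mpoly.
Set Implicit Arguments. Unset Strict Implicit. Unset Printing Implicit Defensive.
Import Order.TTheory GRing.Theory Num.Theory.
Local Open Scope ring_scope.

Section Defs.
Variable R : realType.
Local Notation C := (R[i]).

(* ---------- coordinates on S^d V, V = C^3 ----------
   A monomial x0^a x1^b x2^(d-a-b) of degree d is encoded by (a,b) with a+b<=d.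
   A point of S^d V is given by its coordinates a : mon d -> C, i.e. the
   symmetric tensor whose entry at a word w is a (content of w). *)
Definition mon (d : nat) := {m : 'I_d.+1 * 'I_d.+1 | (m.1 + m.2 <= d)%N}.
Definition mon_zero d : mon d := @Sub _ _ (mon d) (ord0, ord0) (leq0n d).
Definition mk_mon d (a b : nat) : mon d := insubd (mon_zero d) (inord a, inord b).

Definition word (d : nat) := {ffun 'I_d -> 'I_3}.
Definition tens (d : nat) := word d -> C.

Definition cont d (w : word d) : mon d :=
  mk_mon d #|[set i | w i == ord0]| #|[set i | w i == inord 1]|.

Definition S6 := mon 6 -> C.
Definition ten6 (a : S6) : tens 6 := fun w => a (cont w).

Definition pow6 (l : 'I_3 -> C) : S6 :=
  fun m => l ord0 ^+ (val m).1 * l (inord 1) ^+ (val m).2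
           * l (inord 2) ^+ (6 - (val m).1 - (val m).2).

Definition madd (u v : mon 3) : mon 6 :=
  mk_mon 6 ((val u).1 + (val v).1) ((val u).2 + (val v).2).
Definition cat33 (a : S6) : 'M[C]_#|{: mon 3}| :=
  \matrix_(i, j) a (madd (enum_val i) (enum_val j)).

Definition pact d (s : 'S_d) (t : tens d) : tens d := fun w => t [ffun i => w (s i)].

(* A tableau of shape lam with d boxes: a bijection f from positions 'I_d to the
   cells (row, column) of the Young diagram of lam. *)
Definition is_tableau (lam : seq nat) d (f : 'I_d -> nat * nat) : Prop :=
  [/\ d = sumn lam, injective f & forall i, ((f i).2 < nth 0%N lam (f i).1)%N].

Definition rowgrp d (f : 'I_d -> nat * nat) : {set 'S_d} :=
  [set s : 'S_d | [forall i, (f (s i)).1 == (f i).1]].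
Definition colgrp d (f : 'I_d -> nat * nat) : {set 'S_d} :=
  [set s : 'S_d | [forall i, (f (s i)).2 == (f i).2]].

Definition young d (f : 'I_d -> nat * nat) (t : tens d) : tens d :=
  fun w => \sum_(q in colgrp f) (-1) ^+ (odd_perm q)
             * \sum_(p in rowgrp f) pact p t [ffun i => w (q i)].

Definition ebasis d (w : word d) : tens d := fun w' => (w' == w)%:R.

Definition tprod d1 d2 (t1 : tens d1) (t2 : tens d2) : tens (d1 + d2) :=
  fun w => t1 [ffun i => w (lshift d2 i)] * t2 [ffun j => w (rshift d1 j)].

Definition frank (I : finType) d (F : I -> tens d) : nat :=
  \rank (\matrix_(i < #|{: I}|, j < #|{: word d}|) F (enum_val i) (enum_val j)).

(* rank(phi_{42,42}) <= r.  S_{(4,2)}V = c_{T0}(V^{(x)6}); the Pieri projection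
   S^6V (x) S_{(4,2)}V -> S_{(6,4,2)}V is realized through Young symmetrizers c_T,
   T of shape (6,4,2): each c_T restricted there is either 0 or the Pieri
   projection followed by an isomorphism, and some T is nonzero. *)
Definition pieri_rank_le (a : S6) (r : nat) : Prop :=
  forall (T0 : 'I_6 -> nat * nat) (T : 'I_12 -> nat * nat),
    is_tableau [:: 4; 2]%N T0 -> is_tableau [:: 6; 4; 2]%N T ->
    (frank (fun w : word 6 =>
       young T (tprod (ten6 a) (young T0 (ebasis w)))) <= r)%N.

Definition N6 := #|{: mon 6}|.
Definition coords (a : S6) : 'I_N6 -> C := fun i => a (enum_val i).
Definition vanish (P : {mpoly C[N6]}) (S : S6 -> Prop) : Prop :=
  forall a, S a -> P.@[coords a] = 0.
Definition zclosure (S : S6 -> Prop) : S6 -> Prop :=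
  fun a => forall P, vanish P S -> P.@[coords a] = 0.
Definition zclosed (S : S6 -> Prop) : Prop :=
  exists F : {mpoly C[N6]} -> Prop,
    forall a, S a <-> (forall P, F P -> P.@[coords a] = 0).
Definition subS (A B : S6 -> Prop) : Prop := forall a, A a -> B a.
Definition zirreducible (S : S6 -> Prop) : Prop :=
  (exists a, S a) /\
  forall A B, zclosed A -> zclosed B -> subS S (fun a => A a \/ B a) ->
    subS S A \/ subS S B.
Definition irr_component (Y X : S6 -> Prop) : Prop :=
  [/\ zclosed Y, zirreducible Y, subS Y X &
      forall Z, zirreducible Z -> subS Y Z -> subS Z X -> subS Z Y].

(* affine cone over sigma_k(v_6(P^2)) *)
Definition secant (k : nat) : S6 -> Prop :=
  zclosure (fun a => exists l : 'I_k -> 'I_3 -> C,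
                       a = (fun m => \sum_(i < k) pow6 (l i) m)).

Definition catdet : {mpoly C[N6]} :=
  \det (\matrix_(i, j) 'X_(enum_rank (madd (enum_val i) (enum_val j)))
        : 'M[{mpoly C[N6]}]_#|{: mon 3}|).

End Defs.

(* Main.v *)
Require Import Defs.
From Stdlib Require Import ZArith.
From HB Require Import structures.
From mathcomp Require Import all_boot all_order all_algebra all_fingroup.
From mathcomp Require Import boolp reals complex mpoly.
From mathcomp Require Import ssrZ zify ring.
Set Implicit Arguments. Unset Strict Implicit. Unset Printing Implicit Defensive.
Import GRing.Theory Num.Theory.
Local Open Scope ring_scope.

(** Let X be the variety of the given minors. Both matrices are linear in phi and have
    rank at most 1 and 3 on sixth powers, so sigma_k lies in X.

    At an explicit point p = sum l_i^6, let T be the span of the l_i^5 V and suppose that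
    polynomials g_j vanishing on X have independent differentials at p with common kernel T.
    The leading form at p of a polynomial P of I(sigma_k) vanishes on T, so P can be
    corrected by the g_j one order at a time and lies in (g) + m_p^n for all n; by Krull's
    intersection theorem s P lies in (g) for some s with s(p) <> 0. Then s P vanishes on any
    irreducible Z between sigma_k and X, hence so does P, and Z = sigma_k.

    Bordering a maximal invertible block of a linear matrix M(p) by kernel vectors u, v gives
    a minor with differential u M(.) v at p. For phi_{3,3} these are the products of two
    cubics through the l_i; they span 6 of the 7 conormal directions for k = 7 and 3 of the 4
    for k = 8. The missing one comes from phi_{42,42}: on the elements b^2 (b x d)^2 it
    becomes a matrix whose entries at l^6 are [l b d]^2 [l b' d']^2 [l b b']^2.

    For k = 9 a single minor suffices, so that s P is a multiple of det phi_{3,3}. Ordering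
    the cubic monomials suitably, each leading minor is y D + N with y a variable absent from
    the preceding minor D and from N; hence det phi_{3,3} is prime and divides P. *)

(** * Noetherian rings *)

(** S^6V has dimension 28 and the cone over sigma_k should have dimension 3k, which leaves 7, 4 and
    1 conormal directions for k = 7, 8, 9. Cubics through k general points form a space of dimension
    10 - k = 3, 2, 1, with 6, 3, 1 products of two: only for k = 9 is the flattening enough by
    itself. Comparing tangent spaces in the usual way would need the dimension theory of varieties;
    here s P in (g) is produced directly, and the tangent space enters only through explicit arcs on
    the secant cone. What remains to be verified at p is the rank of integer matrices, certified by
    an inverse modulo 101. The Pieri map on tensors is a matrix of size 3^6 by 3^12, too large for
    this; contracting it with decomposable tensors turns Young symmetrizers into products of column
    determinants, and a compression of size 3k + 1 already exhibits the missing direction.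
    Noetherian rings are defined by sequences because Krull's theorem applies the property to one
    sequence of forms. *)

Definition noetherian (A : comNzRingType) : Prop :=
  forall f : nat -> A, exists n (c : nat -> A), f n = \sum_(i < n) c i * f i.

Section Span.
Variable A : comNzRingType.

Definition spans (s : seq A) (x : A) : Prop :=
  exists c : nat -> A, x = \sum_(i < size s) c i * s`_i.

Lemma spansD s x y : spans s x -> spans s y -> spans s (x + y).
Proof.
move=> [c ->] [d ->]; exists (fun i => c i + d i).
by rewrite -big_split; apply: eq_bigr => i _; rewrite mulrDl.
Qed.

Lemma spansM s a x : spans s x -> spans s (a * x).
Proof.
move=> [c ->]; exists (fun i => a * c i).
by rewrite mulr_sumr; apply: eq_bigr => i _; rewrite mulrA.
Qed.

Lemma spans0 s : spans s 0.
Proof. by exists (fun=> 0); rewrite big1 // => i _; rewrite mul0r. Qed.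

Lemma spans_nth s i : spans s s`_i.
Proof.
have [lt_is | le_si] := ltnP i (size s); last by rewrite nth_default //; apply: spans0.
exists (fun j => (j == i)%:R); rewrite (bigD1 (Ordinal lt_is)) //= eqxx mul1r.
by rewrite big1 ?addr0 // => j /eqP nj; case: eqP => [e|_]; [case: nj; apply: val_inj | rewrite mul0r].
Qed.

Lemma spans_sum s n (F : 'I_n -> A) : (forall i, spans s (F i)) -> spans s (\sum_i F i).
Proof. by move=> H; elim/big_ind: _ => //; [apply: spans0 | apply: spansD]. Qed.

Lemma spans_trans s t x : (forall i, (i < size s)%N -> spans t s`_i) -> spans s x -> spans t x.
Proof. by move=> H [c ->]; apply: spans_sum => i; apply/spansM/H. Qed.

Lemma spans_mkseq (f : nat -> A) n x :
  spans (mkseq f n) x <-> exists c : nat -> A, x = \sum_(i < n) c i * f i.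
Proof.
rewrite /spans size_mkseq; split=> -[c ->]; exists c; apply: eq_bigr => i _.
  by rewrite nth_mkseq.
by rewrite nth_mkseq.
Qed.

End Span.

(** Course-of-values recursion: in Hilbert's basis theorem each generator is chosen outside the
    ideal of all the earlier ones. *)
Lemma recursive_sequence T (step : seq T -> T) :
  exists f : nat -> T, forall n, f n = step (mkseq f n).
Proof.
pose s n := iter n (fun s => rcons s (step s)) [::].
exists (fun n => step (s n)) => n; congr step.
by elim: n => //= n IHn; rewrite {1}IHn -[in RHS]addn1 /mkseq iotaD map_cat cats1.
Qed.

Lemma noetherian_surj (A B : comNzRingType) (phi : {rmorphism A -> B}) :
  (forall b, exists a, phi a = b) -> noetherian A -> noetherian B.
Proof.
move=> /choice [g gK] noethA f.
have [n [c e]] := noethA (g \o f); exists n, (phi \o c).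
rewrite -[LHS]gK [g _]e rmorph_sum; apply: eq_bigr => i _.
by rewrite rmorphM /= gK.
Qed.

Lemma noetherian_field (K : fieldType) : noetherian K.
Proof.
move=> f; have [f0|nf0] := eqVneq (f 0%N) 0.
  by exists 0%N, f; rewrite big_ord0.
by exists 1%N, (fun=> f 1%N / f 0%N); rewrite big_ord1 divfK.
Qed.

(** Hilbert's argument on a bad sequence: greedily pick [G n] of least size in the ideal [J] of the
    sequence, outside the ideal of the earlier picks. Some leading coefficient is a combination of
    the earlier ones, and cancelling it gives an admissible element of smaller size. *)
Theorem noetherian_poly (A : comNzRingType) : noetherian A -> noetherian {poly A}.
Proof.
move=> noethA F; apply: contrapT => bad.
have {bad} badF n : ~ spans (mkseq F n) (F n).
  by move=> /spans_mkseq [c e]; apply: bad; exists n, c.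
pose J x := exists n, spans (mkseq F n) x.
have le_spans m n x : (m <= n)%N -> spans (mkseq F m) x -> spans (mkseq F n) x.
  move=> le_mn; apply: spans_trans => i; rewrite size_mkseq => lt_im.
  rewrite nth_mkseq // -(nth_mkseq 0 F (leq_trans lt_im le_mn)).
  exact: spans_nth.
have JD x y : J x -> J y -> J (x + y).
  move=> [m Hx] [n Hy]; exists (maxn m n).
  by apply: spansD; [apply: le_spans Hx | apply: le_spans Hy]; rewrite ?leq_maxl ?leq_maxr.
have JM a x : J x -> J (a * x) by move=> [n Hn]; exists n; apply: spansM.
pose Q s x := [/\ J x, ~ spans s x &
  forall y, J y -> ~ spans s y -> (size x <= size y)%N].
(* [step] has to be total on lists, so membership of the list in [J] becomes a premise of its
   specification. It gives an N such that the first N terms of [F] generate the list, and [F N] then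
   lies outside its span. *)
have /choice [step stepP] : forall s : seq {poly A}, exists x,
    (forall i, (i < size s)%N -> J s`_i) -> Q s x.
  move=> s.
  have [Js|] := pselect (forall i, (i < size s)%N -> J s`_i); last by exists 0.
  have [x [Jx nx]] : exists x, J x /\ ~ spans s x.
    have [N HN] : exists N, forall i, (i < size s)%N -> spans (mkseq F N) s`_i.
      elim: (size s) Js => [|k IH] Js; first by exists 0%N.
      have [N HN] := IH (fun i lt_ik => Js i (ltnW lt_ik)).
      have [M HM] := Js k (leqnn _); exists (maxn N M) => i.
      rewrite ltnS leq_eqVlt => /orP [/eqP ->|/HN H].
        exact: le_spans (leq_maxr N M) HM.
      exact: le_spans (leq_maxl N M) H.
    exists (F N); split; last by move=> /(spans_trans HN) /badF.
    exists N.+1; have <- : (mkseq F N.+1)`_N = F N by rewrite nth_mkseq.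
    exact: spans_nth.
  pose P n := `[< exists y, [/\ J y, ~ spans s y & size y = n] >].
  have exP : exists n, P n by exists (size x); apply/asboolP; exists x.
  case: (ex_minnP exP) => n /asboolP [y [Jy ny <-]] min_y.
  exists y => _; split=> // z Jz nz; apply: min_y; apply/asboolP; by exists z.
have [G GE] := recursive_sequence step.
have GP n : Q (mkseq G n) (G n).
  rewrite GE; apply: (stepP (mkseq G n)) => i; rewrite size_mkseq.
  elim: n {-2}n (leqnn n) i => [|m IH] n le_nm i lt_in.
    by move: (leq_trans lt_in le_nm).
  rewrite nth_mkseq // GE; case: (stepP (mkseq G i)) => // j.
  by rewrite size_mkseq => lt_ji; apply: IH => //; rewrite -ltnS; apply: leq_trans lt_in le_nm.
have Gsize i n : (i <= n)%N -> (size (G i) <= size (G n))%N.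
  move=> le_in; have [_ _] := GP i; apply; first by case: (GP n).
  have [_ nG _] := GP n; move=> H; apply: nG; apply: spans_trans H => j.
  rewrite size_mkseq => lt_ji; rewrite nth_mkseq //.
  by rewrite -(nth_mkseq 0 G (leq_trans lt_ji le_in)); apply: spans_nth.
have [n [c e]] := noethA (fun n => lead_coef (G n)).
have [JGn nGn minGn] := GP n.
have nz : G n != 0 by apply/eqP => z; apply: nGn; rewrite z; apply: spans0.
(* [S] has the leading term of [G n]: sizes increase along [G], so each [G i] can be shifted up to
   the degree of [G n]. *)
pose S : {poly A} := \sum_(i < n) (c i *: 'X^(size (G n) - size (G i))) * G i.
have spS : spans (mkseq G n) S.
  by apply/spans_mkseq; exists (fun i => c i *: 'X^(size (G n) - size (G i))).
have: (size (G n) <= size (G n - S)%R)%N.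
  apply: minGn; last first.
    by move=> H; apply: nGn; rewrite -[G n](subrK S); apply: spansD.
  apply: (JD) => //; rewrite -mulN1r; apply: (JM); rewrite /S; apply: (big_ind J); [ | exact: JD | ].
  - by exists 0%N; apply: spans0.
  - by move=> i _; apply: (JM); case: (GP i).
apply/negP; rewrite -ltnNge.
have szn : (0 < size (G n))%N by rewrite size_poly_gt0.
rewrite -(prednK szn) ltnS; apply/leq_sizeP => j le_j.
rewrite coefB coef_sum; have [ltj|] := ltnP (size (G n)).-1 j.
  rewrite nth_default; last by rewrite -(prednK szn).
  rewrite big1 ?subr0 // => i _; rewrite -scalerAl coefZ coefXnM.
  case: ltnP => _; rewrite ?mulr0 // nth_default ?mulr0 //.
  have le_i := Gsize i n (ltnW (ltn_ord i)).
  have le_nj : (size (G n) <= j)%N by rewrite -(prednK szn).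
  by rewrite leq_subRL ?subnK //; apply: leq_trans le_nj; rewrite leq_subr.
move=> le_j'; have -> : j = (size (G n)).-1 by apply/eqP; rewrite eqn_leq le_j le_j'.
rewrite -[X in X - _]/(lead_coef (G n)) e -sumrB big1 // => i _.
rewrite -scalerAl coefZ coefXnM.
have le_i := Gsize i n (ltnW (ltn_ord i)).
have [z|nzi] := eqVneq (G i) 0; first by rewrite z lead_coef0 coef0 if_same subrr.
have szi : (0 < size (G i))%N by rewrite size_poly_gt0.
rewrite ifF; last by apply/negbTE; rewrite -leqNgt -subn1 leq_sub2l.
rewrite -subn1 subnAC subKn // subn1 -/(lead_coef _) subrr //.
Qed.

Section NoetherianMpoly.
Variable A : comNzRingType.

Definition mpoly_of_poly n : {poly {mpoly A[n]}} -> {mpoly A[n.+1]} :=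
  horner_eval ('X_ord_max) \o map_poly (@mwiden n A).

HB.instance Definition _ n := GRing.RMorphism.on (@mpoly_of_poly n).

Lemma mpoly_of_poly_surj n (b : {mpoly A[n.+1]}) : exists a, @mpoly_of_poly n a = b.
Proof.
have imM x y : (exists a, @mpoly_of_poly n a = x) -> (exists a, @mpoly_of_poly n a = y) ->
    exists a, @mpoly_of_poly n a = x * y.
  by move=> [a <-] [a' <-]; exists (a * a'); rewrite rmorphM.
have imX i : exists a, @mpoly_of_poly n a = 'X_i.
  case: (unliftP ord_max i) => [j ->|->].
    exists ('X_j)%:P; rewrite /mpoly_of_poly /= map_polyC /= /horner_eval hornerC.
    rewrite mwidenX mnmwiden1; congr ('X_ _); apply: val_inj => /=.
    by rewrite /bump leqNgt ltn_ord.
  by exists 'X; rewrite /mpoly_of_poly /= map_polyX /horner_eval hornerX.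
elim/mpolyind: b => [|c m p _ _ [a <-]]; first by exists 0; rewrite rmorph0.
suff [b e] : exists b, @mpoly_of_poly n b = c *: 'X_[m].
  by exists (b + a); rewrite -e; apply: rmorphD.
rewrite -mul_mpolyC; apply: (imM).
  by exists (c%:MP)%:P; rewrite /mpoly_of_poly /= map_polyC /= /horner_eval hornerC mwidenC.
rewrite mpolyXE_id.
apply: (big_ind (fun x => exists a, @mpoly_of_poly n a = x)); [|exact: imM|move=> i _].
  by exists 1; rewrite rmorph1.
elim: (m i) => [|k IH]; first by exists 1; rewrite rmorph1 expr0.
by rewrite exprS; apply: imM.
Qed.

Lemma noetherian_mpoly n : noetherian A -> noetherian {mpoly A[n]}.
Proof.
move=> noethA; elim: n => [|n IHn].
  apply: (@noetherian_surj _ _ (@mpolyC 0 A)); last exact: noethA.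
  by move=> b; exists b@_0%MM; exact/esym/nvar0_mpolyC.
apply: (@noetherian_surj {poly {mpoly A[n]}} {mpoly A[n.+1]} (@mpoly_of_poly n)); last first.
  exact: noetherian_poly.
exact: mpoly_of_poly_surj.
Qed.

End NoetherianMpoly.

Lemma mpoly_rmorph_ext (A B : comNzRingType) n (phi psi : {rmorphism {mpoly A[n]} -> B}) :
  (forall c, phi c%:MP = psi c%:MP) -> (forall i, phi 'X_i = psi 'X_i) -> phi =1 psi.
Proof.
move=> eqC eqX p; rewrite (mpolyE p) !rmorph_sum; apply: eq_bigr => m _.
rewrite -mul_mpolyC !rmorphM eqC mpolyXE_id !rmorph_prod; congr (_ * _).
by apply: eq_bigr => i _; rewrite !rmorphXn eqX.
Qed.

Lemma meval_mpoly_of_poly (A : comNzRingType) n (x : 'I_n.+1 -> A) (q : {poly {mpoly A[n]}}) :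
  (mpoly_of_poly q).@[x] = (map_poly (meval (x \o widen_ord (leqnSn n))) q).[x ord_max].
Proof.
rewrite /mpoly_of_poly /= /horner_eval -[x ord_max](mevalXU x).
rewrite -horner_map /= -map_poly_comp /=; congr (_.[_]); apply: eq_map_poly => p.
apply: (@mpoly_rmorph_ext _ _ _ (meval x \o @mwiden n A) (meval (x \o widen_ord (leqnSn n)))) => [c|i] /=.
  by rewrite mwidenC !mevalC.
by rewrite mwidenX mnmwiden1 !mevalXU.
Qed.

Lemma poly_eq0_horner (K : numFieldType) (p : {poly K}) : (forall x, p.[x] = 0) -> p = 0.
Proof.
move=> p0; apply/eqP; apply/negPn/negP => nz.
have := max_poly_roots nz (rs := [seq i%:R | i <- iota 0 (size p)]).
rewrite size_map size_iota ltnn => H; suff: false by []; apply: H.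
  by apply/allP => x _; apply/rootP/p0.
by rewrite map_inj_uniq ?iota_uniq // => i j /eqP; rewrite eqr_nat => /eqP.
Qed.

Lemma mpoly_eq0_meval (K : numFieldType) n (P : {mpoly K[n]}) : (forall x, P.@[x] = 0) -> P = 0.
Proof.
elim: n P => [|n IHn] P P0.
  have := P0 (fun=> 0); rewrite [P in P.@[_]]nvar0_mpolyC mevalC => z.
  by rewrite [P]nvar0_mpolyC z mpolyC0.
have [q qP] := mpoly_of_poly_surj P; rewrite -qP; suff -> : q = 0 by rewrite rmorph0.
apply/polyP => i; rewrite coef0; apply: IHn => x.
have : map_poly (meval x) q = 0.
  apply: poly_eq0_horner => t.
  pose y (j : 'I_n.+1) := oapp x t (unlift ord_max j).
  have ymax : y ord_max = t by rewrite /y unlift_none.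
  rewrite -[RHS](P0 y) -qP meval_mpoly_of_poly ymax; congr (_.[_]); apply: eq_map_poly => p.
  apply: meval_eq => j /=; rewrite /y.
  have -> : widen_ord (leqnSn n) j = lift ord_max j by apply: val_inj; rewrite /= /bump leqNgt ltn_ord.
  by rewrite liftK.
by move/polyP/(_ i); rewrite coef_map coef0.
Qed.

(** * Local equations at a smooth point *)

Lemma meval_sum (A : comNzRingType) n (x : 'I_n -> A) I (s : seq I) (S : pred I)
    (F : I -> {mpoly A[n]}) :
  (\sum_(i <- s | S i) F i).@[x] = \sum_(i <- s | S i) (F i).@[x].
Proof. exact: raddf_sum. Qed.

Lemma mmap1D (A : comNzRingType) n (x : 'I_n -> A) m1 m2 :
  mmap1 x (m1 + m2) = mmap1 x m1 * mmap1 x m2.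
Proof. by rewrite /mmap1 -big_split; apply: eq_bigr => i _; rewrite mnmDE exprD. Qed.

Lemma pihomogM (A : comNzRingType) r (d e : nat) (p q : {mpoly A[r]}) : (e <= d)%N ->
  q \is e.-homog -> pihomog mdeg d (p * q) = pihomog mdeg (d - e) p * q.
Proof.
move=> le_ed hq; rewrite [p]mpolyE mulr_suml !raddf_sum mulr_suml; apply: eq_bigr => m _ /=.
rewrite -scalerAl !linearZ /= -scalerAl; congr (_ *: _).
have hX : 'X_[m] * q \is (mdeg m + e).-homog by apply: dhomogM => //; rewrite dhomogX.
rewrite pihomogX; have [eq_m|ne_m] := eqVneq (mdeg m) (d - e)%N.
  by apply: pihomog_dE; rewrite -(subnK le_ed) -eq_m.
rewrite mul0r (pihomog_ne0 _ hX) //; apply: contraNneq ne_m => <-; by rewrite addnK.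
Qed.

(** [G] is an ideal, and for every n, b agrees modulo [G] with a form H_n of degree n in x.
    Noetherianity writes some H_n as a combination of the H_i with i < n; in degree n its
    coefficients become forms Q_i of degree n - i > 0. Evaluating at x gives b = Q(x) b modulo [G],
    where Q = sum Q_i has no constant term. *)
Lemma krull_intersection (A : comNzRingType) r (G : A -> Prop) (x : 'I_r -> A) (b : A) :
    noetherian {mpoly A[r]} -> G 0 -> (forall u v, G u -> G v -> G (u + v)) ->
    (forall u v, G v -> G (u * v)) ->
    (forall n, exists H : {mpoly A[r]}, H \is n.-homog /\ G (b - H.@[x])) ->
  exists Q : {mpoly A[r]}, Q@_0%MM = 0 /\ G (b - b * Q.@[x]).
Proof.
move=> noethA G0 GD GM /choice [H HP].
have GN u : G u -> G (- u) by rewrite -mulN1r; apply: (GM).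
have [n [c e]] := noethA H; pose Q (i : 'I_n) := pihomog mdeg (n - i) (c i).
exists (\sum_i Q i); split.
  rewrite raddf_sum big1 // => i _; apply: (dhomog_nemf_coeff (pihomogP _ _ _)).
  by rewrite /= mdeg0 eq_sym -lt0n subn_gt0.
have eH : H n = \sum_i Q i * H i.
  rewrite -[LHS](pihomog_dE (proj1 (HP n))) e raddf_sum; apply: eq_bigr => i _.
  by apply: pihomogM; [apply: ltnW | case: (HP i)].
have eQ : \sum_i (Q i).@[x] * (b - (H i).@[x]) = (\sum_i Q i).@[x] * b - (H n).@[x].
  rewrite eH !meval_sum mulr_suml -sumrB; apply: eq_bigr => i _.
  by rewrite mulrBr mevalM.
have -> : b - b * (\sum_i Q i).@[x] =
    (b - (H n).@[x]) + - (\sum_i (Q i).@[x] * (b - (H i).@[x])).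
  by rewrite eQ; ring.
apply: (GD); first by case: (HP n).
apply: (GN); apply: (big_ind G); [exact: G0 | exact: GD | move=> i _].
by apply: (GM); case: (HP i).
Qed.

Section SmoothPoint.
Variables (K : numFieldType) (n : nat) (p : 'I_n -> K).
Local Notation A := {mpoly K[n]}.
(** Restriction of a polynomial to the arc p + X z(X); orders of vanishing at p become powers of
    X. *)
Local Notation curve z := (mmap (@polyC K) (fun i => (p i)%:P + 'X * z i)).

Definition centered (i : 'I_n) : A := 'X_i - (p i)%:MP.

(* [vanishes k P] means that P lies in the k-th power of the maximal ideal of p. *)
Definition vanishes (k : nat) (P : A) : Prop :=
  exists H : {mpoly A[n]}, H \is k.-homog /\ P = H.@[centered].

Lemma vanishesD k P Q : vanishes k P -> vanishes k Q -> vanishes k (P + Q).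
Proof.
by move=> [F [hF ->]] [H [hH ->]]; exists (F + H); rewrite rpredD //= mevalD.
Qed.

Lemma vanishes0 k : vanishes k 0.
Proof. by exists 0; rewrite rpred0 /= meval0. Qed.

Lemma vanishesM k l P Q : vanishes k P -> vanishes l Q -> vanishes (k + l) (P * Q).
Proof.
by move=> [F [hF ->]] [H [hH ->]]; exists (F * H); rewrite dhomogM // mevalM.
Qed.

Lemma vanishes_mul k P Q : vanishes k Q -> vanishes k (P * Q).
Proof.
move=> vQ; rewrite -[k]add0n; apply: vanishesM => //.
by exists P%:MP; rewrite -[P%:MP]mulr1 mul_mpolyC rpredZ ?dhomog1 // mevalZ meval1 mulr1.
Qed.

Lemma vanishesN k P : vanishes k P -> vanishes k (- P).
Proof. by rewrite -mulN1r; apply: vanishes_mul. Qed.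

Lemma vanishes_sum k (I : Type) (s : seq I) (S : pred I) (F : I -> A) :
  (forall i, S i -> vanishes k (F i)) -> vanishes k (\sum_(i <- s | S i) F i).
Proof. by move=> H; apply: big_ind => //; [apply: vanishes0 | apply: vanishesD]. Qed.

Lemma vanishes_centered i : vanishes 1 (centered i).
Proof. by exists 'X_i; rewrite mevalXU dhomogX /= mdeg1. Qed.

Lemma vanishes_monomial m : vanishes (mdeg m) (mmap1 centered m).
Proof. by exists 'X_[m]; rewrite dhomogX eqxx mevalX. Qed.

Lemma vanishes1P P : vanishes 1 (P - (P.@[p])%:MP).
Proof.
elim/mpolyind: P => [|c m P _ _ IH].
  by rewrite meval0 mpolyC0 subrr; apply: vanishes0.
rewrite mevalD mpolyCD opprD addrACA; apply: vanishesD => //.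
have VM P1 P2 : vanishes 1 (P1 - (P1.@[p])%:MP) -> vanishes 1 (P2 - (P2.@[p])%:MP) ->
    vanishes 1 (P1 * P2 - ((P1 * P2).@[p])%:MP).
  move=> V1 V2; rewrite mevalM mpolyCM.
  have -> : P1 * P2 - P1.@[p]%:MP * P2.@[p]%:MP =
    P1 * (P2 - P2.@[p]%:MP) + P2.@[p]%:MP * (P1 - P1.@[p]%:MP) by ring.
  by apply: vanishesD; apply: vanishes_mul.
rewrite -mul_mpolyC; apply: (VM).
  by rewrite mevalC subrr; apply: vanishes0.
rewrite mpolyXE_id; apply: (big_ind (fun P => vanishes 1 (P - (P.@[p])%:MP))); last 1 first.
- move=> i _; elim: (m i) => [|k IHk].
    by rewrite expr0 meval1 mpolyC1 subrr; apply: vanishes0.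
  rewrite exprS; apply: VM => //; rewrite mevalXU; exact: vanishes_centered.
- by rewrite meval1 mpolyC1 subrr; apply: vanishes0.
- exact: VM.
Qed.

Lemma curve_horner0 (z : 'I_n -> {poly K}) (P : A) : (curve z P).[0] = P.@[p].
Proof.
apply: (@mpoly_rmorph_ext _ _ _ (horner_eval 0 \o mmap (@polyC K) _) (meval p)) => [c|i] /=.
  by rewrite mmapC mevalC /horner_eval hornerC.
by rewrite mmapX mmap1U mevalXU /horner_eval hornerD hornerC hornerM hornerX mul0r addr0.
Qed.

(** Freezing the coefficients of H at p gives a form over [K], and by [vanishes1P] the error gains
    one order. The last clause reads F off the arcs through p, where only the initial velocity
    matters. *)
Lemma leading_form k P : vanishes k P -> exists F : A, [/\ F \is k.-homog,
  vanishes k.+1 (P - mmap (@mpolyC n K) centered F) &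
  forall z : 'I_n -> {poly K}, exists y, curve z P = 'X^k * y /\ y.[0] = F.@[fun i => (z i).[0]]].
Proof.
move=> [H [hH ->]]; exists (\sum_(m <- msupp H) (H@_m).@[p] *: 'X_[m]); split.
- rewrite big_seq; apply: rpred_sum => m mH; apply: rpredZ.
  by rewrite dhomogX; apply/eqP; move/dhomogP: hH => /(_ m mH).
- rewrite mevalE [mmap _ _ (\sum_(_ <- _) _)]rmorph_sum -sumrB big_seq; apply: vanishes_sum => m mH /=.
  rewrite mmapZ mmapX -mulrBl -[k.+1]add1n; apply: vanishesM; first exact: vanishes1P.
  by move/dhomogP: hH => /(_ m mH) /= <-; apply: vanishes_monomial.
- move=> z; exists (\sum_(m <- msupp H) curve z H@_m * mmap1 z m); split.
    rewrite mevalE rmorph_sum mulr_sumr !big_seq; apply: eq_bigr => m mH /=.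
    rewrite rmorphM mulrCA; congr (_ * _); rewrite rmorph_prod.
    move/dhomogP: hH => /(_ m mH) /= <-; rewrite mdegE -prodrXr /mmap1 -big_split /=.
    apply: eq_bigr => i _; rewrite rmorphXn /= raddfB /= mmapX mmap1U mmapC.
    by rewrite addrAC subrr add0r exprMn.
  rewrite horner_sum meval_sum; apply: eq_bigr => m _ /=.
  rewrite hornerM curve_horner0 mevalZ mevalX; congr (_ * _).
  by rewrite /mmap1 horner_prod; apply: eq_bigr => i _; rewrite horner_exp.
Qed.

Section Equations.
(** [l j] is the differential of [g j] at p, tested on straight lines, and the right inverse [W]
    expresses independence. [J] plays the ideal of the variety; [tangent] realises each common
    kernel vector as the velocity of an arc on which [J] vanishes. *)
Variables (r : nat) (g : 'I_r -> A) (l : 'I_r -> 'I_n -> K) (W : 'I_n -> 'I_r -> K).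
Variable J : A -> Prop.
Hypothesis lW : forall j j', \sum_i l j i * W i j' = (j == j')%:R.
Hypothesis dg : forall j v, exists y,
  curve (fun i => (v i)%:P) (g j) = 'X * y /\ y.[0] = \sum_i l j i * v i.
Hypothesis Jg : forall j, J (g j).
Hypothesis J0 : J 0.
Hypothesis JD : forall P Q, J P -> J Q -> J (P + Q).
Hypothesis JM : forall P Q, J Q -> J (P * Q).
Hypothesis tangent : forall v, (forall j, \sum_i l j i * v i = 0) ->
  exists z : 'I_n -> {poly K}, (forall i, (z i).[0] = v i) /\ forall P, J P -> curve z P = 0.

Let lam j : A := \sum_i l j i *: centered i.
(** The coordinates at p projected along [W] onto the common kernel of the differentials; see
    [l_proj]. *)
Let proj i : A := centered i - \sum_j W i j *: lam j.

Lemma meval_centered x i : (centered i).@[x] = x i - p i.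
Proof. by rewrite mevalB mevalXU mevalC. Qed.

Lemma J_vanishes1 P : J P -> vanishes 1 P.
Proof.
(* The zero vector is tangent, and its arc passes through p. *)
move=> JP; have [j|z [_ Hz]] := @tangent (fun=> 0); first by rewrite big1 // => i _; rewrite mulr0.
have P0 : P.@[p] = 0 by rewrite -(curve_horner0 z) Hz // horner0.
by have := vanishes1P P; rewrite P0 mpolyC0 subr0.
Qed.

Lemma vanishes2_lam j : vanishes 2 (g j - lam j).
Proof.
have [F [hF vF zF]] := leading_form (J_vanishes1 (Jg j)).
suff -> : lam j = mmap (@mpolyC n K) centered F by [].
suff -> : F = \sum_i l j i *: 'X_i.
  by rewrite raddf_sum; apply: eq_bigr => i _ /=; rewrite mmapZ mmapX mmap1U mul_mpolyC.
apply/eqP; rewrite -subr_eq0; apply/eqP/mpoly_eq0_meval => v.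
have [y [e y0]] := dg j v; have [y' [e' y0']] := zF (fun i => (v i)%:P).
have yy' : y = y'.
  by apply: (@mulfI _ ('X : {poly K})); rewrite ?polyX_eq0 // -e e' expr1.
rewrite mevalB meval_sum; apply/eqP; rewrite subr_eq0; apply/eqP.
transitivity (y'.[0]); first by rewrite y0'; apply: meval_eq => i; rewrite hornerC.
by rewrite -yy' y0; apply: eq_bigr => i _; rewrite mevalZ mevalXU.
Qed.

Lemma meval_lam j x : (lam j).@[x] = \sum_i l j i * (x i - p i).
Proof. by rewrite meval_sum; apply: eq_bigr => i _; rewrite mevalZ meval_centered. Qed.

Lemma vanishes_lam j : vanishes 1 (lam j).
Proof.
apply: vanishes_sum => i _; rewrite -mul_mpolyC; apply: vanishes_mul.
exact: vanishes_centered.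
Qed.

Lemma vanishes_proj i : vanishes 1 (proj i).
Proof.
apply: vanishesD; first exact: vanishes_centered.
apply: vanishesN; apply: vanishes_sum => j _; rewrite -mul_mpolyC.
by apply: vanishes_mul; apply: vanishes_lam.
Qed.

Lemma l_proj x j : \sum_i l j i * (proj i).@[x] = 0.
Proof.
under eq_bigr => i _ do rewrite mevalB meval_centered meval_sum mulrBr mulr_sumr.
rewrite sumrB -meval_lam exchange_big /=.
under eq_bigr => j' _.
  under eq_bigr => i _ do rewrite mevalZ mulrA.
  rewrite -mulr_suml lW; over.
rewrite (bigD1 j) //= eqxx mul1r big1 ?addr0 ?subrr // => j' /negPf.
by rewrite eq_sym => ->; rewrite mul0r.
Qed.

(** [centered i - proj i] is a combination of the [lam j], so exchanging the factors of the monomial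
    one at a time changes it by multiples of the [lam j]. *)
Lemma monomial_proj m k : mdeg m = k.+1 -> exists h : 'I_r -> A,
  (forall j, vanishes k (h j)) /\
  mmap1 centered m - mmap1 proj m = \sum_j lam j * h j.
Proof.
have splitm m' i h : (forall k, vanishes k 0) ->
    mmap1 centered m' - mmap1 proj m' = \sum_j lam j * h j ->
    mmap1 centered (U_(i) + m') - mmap1 proj (U_(i) + m') =
    \sum_j lam j * ((W i j)%:MP * mmap1 centered m' + proj i * h j).
  move=> _ e; rewrite !mmap1D !mmap1U.
  have -> : centered i * mmap1 centered m' - proj i * mmap1 proj m' =
     (centered i - proj i) * mmap1 centered m' + proj i * (mmap1 centered m' - mmap1 proj m').
    by ring.
  rewrite e /proj subKr mulr_suml mulr_sumr -big_split /=; apply: eq_bigr => j _.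
  by rewrite -mul_mpolyC; ring.
elim: k m => [|k IH] m dm.
  have /mdeg1P [i /eqP ->] : mdeg m == 1%N by rewrite dm.
  exists (fun j => (W i j)%:MP * mmap1 centered 0%MM + proj i * 0); split.
    move=> j; rewrite mulr0 addr0; apply: vanishes_mul.
    by have := vanishes_monomial 0%MM; rewrite mdeg0.
  have := splitm 0%MM i (fun=> 0) vanishes0; rewrite addm0; apply.
  by rewrite !mmap11 subrr big1 // => j _; rewrite mulr0.
have [i mi] : exists i, m i != 0%N.
  apply/existsP; rewrite -negb_forall; apply/negP => /forallP H.
  by move: dm; rewrite mdegE big1 // => i _; apply/eqP.
have e : (U_(i) + (m - U_(i)))%MM = m by rewrite addmC submK // lep1mP.
have dm' : mdeg (m - U_(i)) = k.+1.
  by have := mdegD U_(i) (m - U_(i)); rewrite e mdeg1 dm add1n => -[].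
have [h [vh eh]] := IH _ dm'.
exists (fun j => (W i j)%:MP * mmap1 centered (m - U_(i)) + proj i * h j); split.
  move=> j; apply: vanishesD.
    by apply: vanishes_mul; rewrite -dm'; apply: vanishes_monomial.
  by rewrite -[k.+1]add1n; apply: vanishesM => //; apply: vanishes_proj.
by rewrite -{1 2}e; apply: splitm => //; apply: vanishes0.
Qed.

(** The leading form F vanishes on the tangent space, since [P] vanishes along an arc in every
    tangent direction. So F(centered) = F(centered) - F(proj) is a combination of the [lam j] with
    coefficients of order k, and replacing [lam j] by [g j] leaves an error of order k + 2. *)
Lemma improve k P : J P -> vanishes k.+1 P -> exists h : 'I_r -> A,
  vanishes k.+2 (P - \sum_j h j * g j).
Proof.
move=> JP vP; have [F [hF vF zF]] := leading_form vP.
have Fproj : mmap (@mpolyC n K) proj F = 0.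
  apply: mpoly_eq0_meval => x.
  have -> : (mmap (@mpolyC n K) proj F).@[x] = F.@[fun i => (proj i).@[x]].
    apply: (@mpoly_rmorph_ext _ _ _ (meval x \o mmap (@mpolyC n K) proj)
      (meval (fun i => (proj i).@[x]))) => [c|i] /=.
      by rewrite mmapC !mevalC.
    by rewrite mmapX mmap1U mevalXU.
  have [z [z0 Hz]] := tangent (l_proj x).
  have [y [e y0]] := zF z.
  have y0' : y = 0.
    move/eqP: e; rewrite Hz // eq_sym mulf_eq0 expf_eq0 polyX_eq0 andbF /=.
    by move/eqP.
  rewrite -[RHS](horner0 (0 : K)) -y0' y0; apply: meval_eq => i; by rewrite z0.
have /choice [h hP] : forall m, exists h : 'I_r -> A, m \in msupp F ->
    (forall j, vanishes k (h j)) /\ mmap1 centered m - mmap1 proj m = \sum_j lam j * h j.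
  move=> m.
  have [mF|_] := boolP (m \in msupp F); last by exists (fun=> 0).
  have [h Hh] := @monomial_proj m k (dhomogP _ _ _ hF m mF); by exists h.
pose h' j := \sum_(m <- msupp F) (F@_m)%:MP * h m j; exists h'.
have vh' j : vanishes k (h' j).
  rewrite /h' big_seq; apply: vanishes_sum => m mF; apply: vanishes_mul.
  by case: (hP m mF).
have eF : mmap (@mpolyC n K) centered F = \sum_j lam j * h' j.
  transitivity (mmap (@mpolyC n K) centered F - mmap (@mpolyC n K) proj F).
    by rewrite Fproj subr0.
  rewrite /mmap -sumrB /h'.
  under [RHS]eq_bigr => j _ do rewrite mulr_sumr.
  rewrite exchange_big /= !big_seq; apply: eq_bigr => m mF.
  rewrite -mulrBr; case: (hP m mF) => _ ->; rewrite mulr_sumr.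
  by apply: eq_bigr => j _; rewrite mulrCA.
have -> : P - \sum_j h' j * g j =
    (P - mmap (@mpolyC n K) centered F) + - (\sum_j (g j - lam j) * h' j).
  rewrite eF -addrA; congr (_ + _); rewrite -opprD -big_split; congr (- _).
  by apply: eq_bigr => j _ /=; ring.
apply: vanishesD => //; apply: vanishesN; apply: vanishes_sum => j _.
by rewrite -[k.+2]add2n; apply: vanishesM => //; apply: vanishes2_lam.
Qed.

Theorem smooth_point P : J P -> exists (s : A) (h : 'I_r -> A),
  s.@[p] != 0 /\ s * P = \sum_j h j * g j.
Proof.
move=> JP; pose G Q := exists h : 'I_r -> A, Q = \sum_j h j * g j.
have GD u v : G u -> G v -> G (u + v).
  move=> [h ->] [h' ->]; exists (fun j => h j + h' j).
  by rewrite -big_split; apply: eq_bigr => j _; rewrite mulrDl.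
have GM u v : G v -> G (u * v).
  move=> [h ->]; exists (fun j => u * h j); rewrite mulr_sumr.
  by apply: eq_bigr => j _; rewrite mulrA.
have G0 : G 0 by exists (fun=> 0); rewrite big1 // => j _; rewrite mul0r.
have JG Q : G Q -> J Q.
  by move=> [h ->]; apply: (big_ind J); [exact: J0 | exact: JD | move=> j _; exact: JM].
have approx k : exists Q, G Q /\ vanishes k.+1 (P - Q).
  elim: k => [|k [Q [GQ vQ]]]; first by exists 0; rewrite subr0; split => //; apply: J_vanishes1.
  have JPQ : J (P - Q) by apply: (JD) => //; rewrite -mulN1r; apply/JM/JG.
  have [h vh] := improve JPQ vQ; exists (Q + \sum_j h j * g j); split.
    by apply: (GD) => //; exists h.
  by rewrite opprD addrA.
(* Krull's argument takes place in polynomials over [A], itself a polynomial ring. *)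
have noeth : noetherian {mpoly A[n]}.
  by do 2!apply: noetherian_mpoly; apply: noetherian_field.
have [|Q [Q0 GQ]] := krull_intersection (x := centered) (b := P) noeth G0 GD GM.
  case=> [|k].
    exists P%:MP; split; last by rewrite mevalC subrr.
    by rewrite -[P%:MP]mulr1 mul_mpolyC rpredZ ?dhomog1.
  have [Q [GQ [H [hH eH]]]] := approx k; exists H; split => //.
  by rewrite -eH opprB addrC subrK.
(* This s takes the value 1 at p because Q has no constant term. *)
have [h eh] := GQ; exists (1 - Q.@[centered]), h; split; last by rewrite -eh; ring.
rewrite mevalB meval1.
suff -> : Q.@[centered].@[p] = 0 by rewrite subr0 oner_eq0.
rewrite [Q.@[_]]mevalE meval_sum big_seq big1 // => m mQ; rewrite mevalM rmorph_prod /=.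
have [i mi] : exists i, m i != 0%N.
  apply/existsP; rewrite -negb_forall; apply/negP => /forallP H.
  move: mQ; rewrite mcoeff_msupp (_ : m = 0%MM) ?Q0 ?eqxx //.
  by apply/mnmP => i; rewrite mnm0E; apply/eqP/H.
rewrite (bigD1 i) //= rmorphXn /= meval_centered subrr expr0n (negPf mi) mul0r mulr0 //.
Qed.

End Equations.
End SmoothPoint.

(** * Minors of linear matrices and Zariski closures *)

(** Read off the rank normal form. Compressing by arbitrary [E] and [F] yields combinations of
    minors and avoids choosing rows and columns. *)
Lemma mxrank_full_minor (K : fieldType) m n r (A : 'M[K]_(m, n)) : (r <= \rank A)%N ->
  exists (E : 'M_(r, m)) (F : 'M_(n, r)), E *m A *m F = 1%:M.
Proof.
move=> le_r; exists (pid_mx r *m invmx (col_ebase A)), (invmx (row_ebase A) *m pid_mx r).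
rewrite -{2}[A]mulmx_ebase !mulmxA mulmxKV ?col_ebase_unit //.
rewrite -[X in X *m _ *m pid_mx r]mulmxA -!mulmxA (mulmxA (row_ebase A)).
rewrite mulmxV ?row_ebase_unit // mul1mx.
rewrite !mulmxA !mul_pid_mx.
have le_rm : (r <= m)%N := leq_trans le_r (rank_leq_row A).
have le_rn : (r <= n)%N := leq_trans le_r (rank_leq_col A).
rewrite (minn_idPl le_r) (minn_idPr le_rm) minnn (minn_idPr le_rn).
by rewrite pid_mx_1.
Qed.

Section Pencil.
Variables (K : numFieldType) (n a b : nat) (M : 'I_n -> 'M[K]_(a, b)).

Definition pencil (x : 'I_n -> K) : 'M[K]_(a, b) := \sum_i x i *: M i.

Definition pencil_mpoly : 'M[{mpoly K[n]}]_(a, b) :=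
  \sum_i 'X_i *: map_mx (@mpolyC n K) (M i).

Definition pencil_minor r (E : 'M[K]_(r, a)) (F : 'M[K]_(b, r)) : {mpoly K[n]} :=
  \det (map_mx (@mpolyC n K) E *m pencil_mpoly *m map_mx (@mpolyC n K) F).

Lemma mmap_pencil_minor (S : comNzRingType) (f : {rmorphism K -> S}) (c : 'I_n -> S) r
    (E : 'M[K]_(r, a)) (F : 'M[K]_(b, r)) :
  mmap f c (pencil_minor E F) =
  \det (map_mx f E *m (\sum_i c i *: map_mx f (M i)) *m map_mx f F).
Proof.
rewrite -[LHS](det_map_mx (mmap f c)) !map_mxM /= -!map_mx_comp.
have eC : mmap f c \o @mpolyC n K =1 f by move=> x /=; rewrite mmapC.
congr (\det (_ *m _ *m _)); try by apply: eq_map_mx.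
rewrite raddf_sum; apply: eq_bigr => i _ /=.
rewrite map_mxZ -map_mx_comp /= mmapX mmap1U; congr (_ *: _); exact: eq_map_mx.
Qed.

Lemma meval_pencil_minor x r (E : 'M[K]_(r, a)) (F : 'M[K]_(b, r)) :
  (pencil_minor E F).@[x] = \det (E *m pencil x *m F).
Proof.
have idE m m' (B : 'M[K]_(m, m')) : map_mx idfun B = B by apply/matrixP => i j; rewrite mxE.
rewrite /meval mmap_pencil_minor !idE; congr (\det (_ *m _ *m _)).
by apply: eq_bigr => i _; rewrite idE.
Qed.

Lemma pencil_minor_eq0 x r (E : 'M[K]_(r, a)) (F : 'M[K]_(b, r)) :
  (\rank (pencil x) < r)%N -> (pencil_minor E F).@[x] = 0.
Proof.
move=> lt_r; rewrite meval_pencil_minor; apply/eqP; apply: contraLR lt_r => nz.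
rewrite -leqNgt; have /mxrank_unit <- : E *m pencil x *m F \in unitmx by rewrite unitmxE unitfE.
exact: leq_trans (mxrankM_maxl _ _) (mxrankM_maxr _ _).
Qed.

Lemma pencil_minor_neq0 x r : (r <= \rank (pencil x))%N ->
  exists (E : 'M[K]_(r, a)) (F : 'M[K]_(b, r)), (pencil_minor E F).@[x] != 0.
Proof.
move=> /mxrank_full_minor [E [F EF]]; exists E, F.
by rewrite meval_pencil_minor EF det1 oner_neq0.
Qed.

(* The minor bordering an invertible r x r block of [pencil p] by a left and a right
   kernel vector has differential [w |-> u (pencil w) v] at p. *)
Lemma pencil_minor_conormal p r (u : 'rV[K]_a) (v : 'cV[K]_b) :
  (r <= \rank (pencil p))%N -> u *m pencil p = 0 -> pencil p *m v = 0 ->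
  exists (E : 'M[K]_(r + 1, a)) (F : 'M[K]_(b, r + 1)), forall w, exists y : {poly K},
    mmap (@polyC K) (fun i => (p i)%:P + 'X * (w i)%:P) (pencil_minor E F) = 'X * y /\
    y.[0] = (u *m pencil w *m v) 0 0.
Proof.
move=> /mxrank_full_minor [E [F EF]] up pv.
exists (col_mx E u), (row_mx F v) => w.
pose C m m' := map_mx (@polyC K) : 'M_(m, m') -> 'M_(m, m').
have eM : \sum_i ((p i)%:P + 'X * (w i)%:P) *: map_mx (@polyC K) (M i) =
    C _ _ (pencil p) + 'X *: C _ _ (pencil w).
  rewrite /C /pencil !raddf_sum /= -big_split; apply: eq_bigr => i _ /=.
  by rewrite scalerDl !map_mxZ scalerA.
(* At p the bordered block is diag(1, 0), so along p + X w its last column is divisible by X. [N] is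
   the matrix after this division; at X = 0 it is block triangular with diagonal 1 and u (pencil w)
   v. *)
pose N := block_mx (1%:M + 'X *: C _ _ (E *m pencil w *m F)) (C _ _ (E *m pencil w *m v))
  ('X *: C _ _ (u *m pencil w *m F)) (C _ _ (u *m pencil w *m v)).
exists (\det N); split; last first.
  rewrite -[LHS]/(horner_eval 0 (\det N)) -det_map_mx map_block_mx.
  have evC m m' (B : 'M_(m, m')) : map_mx (horner_eval (0 : K)) (C _ _ B) = B.
    by apply/matrixP => i j; rewrite !mxE /horner_eval hornerC.
  rewrite !map_mxD !map_mxZ /= !evC map_mx1.
  have -> : horner_eval (0 : K) 'X = 0 by rewrite /horner_eval hornerX.
  rewrite !scale0r addr0.
  by rewrite det_ublock det1 mul1r det_mx11.
rewrite mmap_pencil_minor eM map_col_mx map_row_mx.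
have -> : col_mx (C _ _ E) (C _ _ u) *m (C _ _ (pencil p) + 'X *: C _ _ (pencil w))
   *m row_mx (C _ _ F) (C _ _ v) = N *m block_mx 1%:M 0 0 'X%:M.
  rewrite mul_col_mx mul_col_row /N mulmx_block !mulmx0 !mulmx1 !addr0 !add0r.
  rewrite !mulmxDr !mulmxDl -!scalemxAr -!scalemxAl -!map_mxM /= EF up.
  have -> : E *m pencil p *m v = 0 by rewrite -mulmxA pv mulmx0.
  by rewrite !mul0mx !map_mx0 map_mx1 !add0r !mul_mx_scalar.
by rewrite det_mulmx det_ublock det1 mul1r det_scalar1 mulrC.
Qed.

End Pencil.

Section Geometry.
Variable R : realType.
Local Notation C := (R[i]).

Lemma curve_coords (c : mon 6 -> {poly C}) (P : {mpoly C[N6]}) t :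
  (mmap (@polyC C) (fun i => c (enum_val i)) P).[t] = P.@[coords (fun m => (c m).[t])].
Proof.
apply: (@mpoly_rmorph_ext _ _ _ (horner_eval t \o mmap (@polyC C) _)
  (meval (coords (fun m => (c m).[t])))) => [x|i] /=.
  by rewrite mmapC mevalC /horner_eval hornerC.
by rewrite mmapX mmap1U mevalXU.
Qed.

Lemma zclosure_min (S A : S6 R -> Prop) : zclosed A -> subS S A -> subS (zclosure S) A.
Proof.
move=> [F AF] SA a Sa; apply/AF => P FP; apply: Sa => b Sb.
by move: P FP; apply/AF/SA.
Qed.

Lemma zclosed_zclosure (S : S6 R -> Prop) : zclosed (zclosure S).
Proof. by exists (fun P => vanish P S). Qed.

Lemma sub_zclosure (S : S6 R -> Prop) : subS S (zclosure S).
Proof. by move=> a Sa P; apply. Qed.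

Lemma vanish_zclosure (S : S6 R -> Prop) P : vanish P (zclosure S) <-> vanish P S.
Proof.
split=> [H a Sa|H a Sa]; first by apply: H; apply: sub_zclosure.
exact: Sa.
Qed.

Lemma zclosed_hypersurface (P : {mpoly C[N6]}) : zclosed (fun a => P.@[coords a] = 0).
Proof. by exists (eq P) => a; split=> [e Q <-|/(_ P)]; last apply. Qed.

(* Any two points are joined by a rational curve, along which a product of two
   polynomial functions vanishes only if one of the factors does. *)
Lemma zirreducible_rational (S : S6 R -> Prop) (a0 : S6 R) : S a0 ->
  (forall a b, S a -> S b -> exists c : mon 6 -> {poly C},
     [/\ forall m, (c m).[0] = a m, forall m, (c m).[1] = b m &
         forall t, S (fun m => (c m).[t])]) ->
  zirreducible (zclosure S).
Proof.
move=> Sa0 joinS; split; first by exists a0; apply: sub_zclosure.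
move=> A B clA clB SAB; have [FA hA] := clA; have [FB hB] := clB.
have [SA|nSA] := pselect (subS S A); first by left; apply: zclosure_min.
right; apply: zclosure_min => // b Sb; apply/hB => Q FQ.
have [a [Sa nAa]] : exists a, S a /\ ~ A a.
  apply: contrapT => H; apply: nSA => a Sa; apply: contrapT => nAa.
  by apply: H; exists a.
have [P [FP nP]] : exists P, FA P /\ P.@[coords a] <> 0.
  apply: contrapT => H; apply: nAa; apply/hA => P FP; apply: contrapT => nP.
  by apply: H; exists P.
have [c [c0 c1 cS]] := joinS a b Sa Sb.
pose f (P : {mpoly C[N6]}) := mmap (@polyC C) (fun i => c (enum_val i)) P.
have : f P * f Q = 0.
  apply: poly_eq0_horner => t; rewrite hornerM !curve_coords.
  have [At|Bt] := SAB _ (sub_zclosure (cS t)).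
    by rewrite (proj1 (hA _) At P FP) mul0r.
  by rewrite (proj1 (hB _) Bt Q FQ) mulr0.
move/eqP; rewrite mulf_eq0 => /orP [] /eqP f0.
  case: nP; have := curve_coords c P 0; rewrite -/(f P) f0 horner0 => /esym.
  by under eq_fun => m do rewrite c0.
have := curve_coords c Q 1; rewrite -/(f Q) f0 horner0 => /esym.
by under eq_fun => m do rewrite c1.
Qed.

Lemma irr_component_local (S X : S6 R -> Prop) p :
  zirreducible (zclosure S) -> subS (zclosure S) X -> zclosure S p ->
  (forall P, vanish P S -> exists s : {mpoly C[N6]}, s.@[coords p] != 0 /\ vanish (s * P) X) ->
  irr_component (zclosure S) X.
Proof.
move=> irrS SX Sp H; split=> //; first exact: zclosed_zclosure.
move=> Z [_ irrZ] YZ ZX a Za P vP.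
have [s [sp vsP]] := H P vP.
have cover : subS Z (fun a => s.@[coords a] = 0 \/ P.@[coords a] = 0).
  move=> b Zb; have /eqP := vsP b (ZX b Zb); rewrite mevalM mulf_eq0.
  by case/orP => /eqP; [left | right].
have [|/(_ a Za)//] := irrZ _ _ (zclosed_hypersurface s) (zclosed_hypersurface P) cover.
by move=> /(_ p (YZ p Sp)) /eqP; rewrite (negPf sp).
Qed.

End Geometry.

(** * Secant varieties *)

Section Monomials.

Lemma val_mk_mon d a b : (a + b <= d)%N ->
  ((val (mk_mon d a b)).1 = a :> nat) * ((val (mk_mon d a b)).2 = b :> nat).
Proof.
move=> le_d; have [la lb] : (a < d.+1)%N /\ (b < d.+1)%N by lia.
have ok : ((inord a, inord b) : 'I_d.+1 * 'I_d.+1) \in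
    [pred m : 'I_d.+1 * 'I_d.+1 | (m.1 + m.2 <= d)%N] by rewrite inE /= !inordK.
by rewrite /mk_mon (insubdK (mon_zero d) ok) /= !inordK.
Qed.

Lemma mk_mon_val d (m : mon d) : mk_mon d (val m).1 (val m).2 = m.
Proof.
have le_d := valP m; have [e1 e2] := val_mk_mon le_d.
apply: val_inj; rewrite [RHS]surjective_pairing [LHS]surjective_pairing.
by congr (_, _); apply: val_inj.
Qed.

(** A computable order on monomials in which integer coefficient lists are read; the enumeration of
    the finite type [mon d] stays abstract. *)
Definition monl d : seq (nat * nat) := [seq (a, b) | a <- iota 0 d.+1, b <- iota 0 (d.+1 - a)].
Definition mon_at d i : mon d := mk_mon d (nth (0, 0)%N (monl d) i).1 (nth (0, 0)%N (monl d) i).2.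

Lemma mem_monl d e : (e \in monl d) = (e.1 + e.2 <= d)%N.
Proof.
apply/allpairsPdep/idP => [[a [b [ha hb ->]]]|le_d].
  by move: ha hb; rewrite !mem_iota !add0n !leq0n ltn_subRL.
exists e.1, e.2; rewrite !mem_iota !add0n !leq0n -surjective_pairing ltn_subRL !ltnS le_d.
by split=> //; apply: leq_trans le_d; rewrite leq_addr.
Qed.

Lemma uniq_monl d : uniq (monl d).
Proof.
apply: allpairs_uniq_dep => [|a _|[a b] [a' b'] _ _ [-> ->] //]; by rewrite iota_uniq.
Qed.

Lemma mk_mon_inj d e f : e \in monl d -> f \in monl d ->
  mk_mon d e.1 e.2 = mk_mon d f.1 f.2 -> e = f.
Proof.
rewrite !mem_monl => h h' eq; have [e1 e2] := val_mk_mon h; have [e3 e4] := val_mk_mon h'.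
rewrite [LHS]surjective_pairing [RHS]surjective_pairing.
by congr (_, _); [rewrite -[LHS]e1 -[RHS]e3 eq | rewrite -[LHS]e2 -[RHS]e4 eq].
Qed.

Lemma sum_mon (V : nmodType) d (F : mon d -> V) :
  \sum_m F m = \sum_(i < size (monl d)) F (mon_at d i).
Proof.
pose s := [seq mk_mon d e.1 e.2 | e <- monl d].
have -> : \sum_(i < size (monl d)) F (mon_at d i) = \sum_(m <- s) F m.
  by rewrite big_map (big_nth (0, 0)%N) big_mkord.
apply: perm_big; apply: uniq_perm; first exact: index_enum_uniq.
  by rewrite map_inj_in_uniq ?uniq_monl // => e f; apply: mk_mon_inj.
move=> m; rewrite mem_index_enum; apply/esym/mapP.
exists ((val m).1 : nat, (val m).2 : nat); first by rewrite mem_monl; have := valP m.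
by apply/esym/mk_mon_val.
Qed.

Lemma sum_enum_mon (V : nmodType) d (F : mon d -> V) :
  \sum_(i < #|{: mon d}|) F (enum_val i) = \sum_m F m.
Proof.
rewrite [RHS](reindex (enum_val : 'I_#|{: mon d}| -> mon d)) //=.
exact: onW_bij (enum_val_bij _).
Qed.

End Monomials.

Section Secants.
Variable R : realType.
Local Notation C := (R[i]).

Definition powsum k (l : 'I_k -> 'I_3 -> C) : S6 R := fun m => \sum_(i < k) pow6 (l i) m.
Definition powsums k : S6 R -> Prop := fun a => exists l : 'I_k -> 'I_3 -> C, a = powsum l.

Definition ppow6 (S : comNzRingType) (l : 'I_3 -> S) (m : mon 6) : S :=
  l ord0 ^+ (val m).1 * l (inord 1) ^+ (val m).2 * l (inord 2) ^+ (6 - (val m).1 - (val m).2).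

Lemma horner_ppow6 (l : 'I_3 -> {poly C}) m t :
  (ppow6 l m).[t] = pow6 (fun j => (l j).[t]) m.
Proof. by rewrite !hornerM !horner_exp. Qed.

(** The parameters (l_i) form an affine space, whose segments supply the rational curves. *)
Lemma irreducible_secant k : zirreducible (secant (R := R) k).
Proof.
apply: (@zirreducible_rational R (@powsums k) (powsum (fun _ _ => 0))); first by exists (fun _ _ => 0).
move=> _ _ [l ->] [l' ->].
pose L i j : {poly C} := (l i j)%:P + 'X * (l' i j - l i j)%:P.
exists (fun m => \sum_(i < k) ppow6 (L i) m); split=> [m|m|t].
- rewrite horner_sum; apply: eq_bigr => i _; rewrite horner_ppow6; congr pow6.
  by apply/funext => j; rewrite hornerD hornerM !hornerC hornerX mul0r addr0.
- rewrite horner_sum; apply: eq_bigr => i _; rewrite horner_ppow6; congr pow6.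
  by apply/funext => j; rewrite hornerD hornerM !hornerC hornerX mul1r addrC subrK.
- exists (fun i j => (L i j).[t]); apply/funext => m.
  by rewrite horner_sum; apply: eq_bigr => i _; rewrite horner_ppow6.
Qed.

Lemma poly_taylor1 (c : {poly C}) : exists z, c = (c.[0])%:P + 'X * z /\ z.[0] = c^`().[0].
Proof.
elim/poly_ind: c => [|q a _]; first by exists 0; rewrite horner0 mulr0 addr0 deriv0 horner0.
exists q; rewrite hornerD hornerM hornerC hornerX mulr0 add0r addrC mulrC; split=> //.
by rewrite derivD derivC add0r derivM derivX mul1r hornerD hornerM hornerX mul0r addr0.
Qed.

(** Differential of [pow6] at l in direction t. The truncated predecessor of an exponent 0 is
    harmless, as it comes with the factor 0. *)
Definition dpow6 (l t : 'I_3 -> C) (m : mon 6) : C :=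
  let: (a, b) := val m in let c := (6 - a - b)%N in
  a%:R * (t ord0 * l ord0 ^+ a.-1) * l (inord 1) ^+ b * l (inord 2) ^+ c +
  b%:R * (t (inord 1) * l (inord 1) ^+ b.-1) * l ord0 ^+ a * l (inord 2) ^+ c +
  c%:R * (t (inord 2) * l (inord 2) ^+ c.-1) * l ord0 ^+ a * l (inord 1) ^+ b.

Lemma deriv_ppow6 (l t : 'I_3 -> C) m :
  ((ppow6 (fun j => (l j)%:P + 'X * (t j)%:P) m)^`()).[0] = dpow6 l t m.
Proof.
pose P j : {poly C} := (l j)%:P + 'X * (t j)%:P; rewrite -[fun j => _]/P.
have h0 j : (P j).[0] = l j by rewrite /P hornerD hornerM !hornerC hornerX mul0r addr0.
have h1 j : (P j)^`() = (t j)%:P.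
  by rewrite /P derivD derivM derivX !derivC mulr0 mul1r addr0 add0r.
move: P h0 h1 => P h0 h1.
rewrite /dpow6 /ppow6; case: (val m) => a b /=.
rewrite !derivM !deriv_exp !h1 !(hornerD, hornerM, hornerMn, horner_exp, hornerC) !h0.
set c := (6 - a - b)%N.
rewrite -(mulr_natl (t ord0 * _)) -(mulr_natl (t (inord 1) * _)) -(mulr_natl (t (inord 2) * _)).
move: (l ord0 ^+ a.-1) (l ord0 ^+ a) (l (inord 1) ^+ b.-1) (l (inord 1) ^+ b).
move: (l (inord 2) ^+ c.-1) (l (inord 2) ^+ c) (a%:R : C) (b%:R : C) (c%:R : C).
by move=> *; ring.
Qed.

Lemma sum_coords (a : S6 R) m : a m = \sum_i coords a i * (m == enum_val i)%:R.
Proof.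
rewrite (bigD1 (enum_rank m)) //= /coords enum_rankK eqxx mulr1 big1 ?addr0 // => i ni.
rewrite (_ : _ == _ = false) ?mulr0 //; apply/negbTE; apply: contraNneq ni => ->.
by rewrite enum_valK.
Qed.

(** [S6 R] is a bare function type, so linearity is stated by hand, for combinations with one term
    per coordinate: the shape of an expansion in the coordinate basis. *)
Definition s6linear (V : lmodType C) (f : S6 R -> V) : Prop :=
  forall (c : 'I_N6 -> C) (b : 'I_N6 -> S6 R),
    f (fun m => \sum_i c i * b i m) = \sum_i c i *: f (b i).

Definition pencil_of p q (M : S6 R -> 'M[C]_(p, q)) (i : 'I_N6) : 'M[C]_(p, q) :=
  M (fun m => (m == enum_val i)%:R).

Lemma pencil_ofE p q (M : S6 R -> 'M[C]_(p, q)) a : s6linear M ->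
  M a = pencil (pencil_of M) (coords a).
Proof.
by move=> linM; rewrite /pencil /pencil_of -linM; congr M; apply/funext => m; apply: sum_coords.
Qed.

Lemma rank_le_zclosure p q (M : S6 R -> 'M[C]_(p, q)) r (S : S6 R -> Prop) :
  s6linear M -> (forall a, S a -> (\rank (M a) <= r)%N) ->
  forall a, zclosure S a -> (\rank (M a) <= r)%N.
Proof.
move=> linM MS a Sa; rewrite leqNgt; apply/negP; rewrite (pencil_ofE _ linM).
move=> /pencil_minor_neq0 [E [F /eqP nz]]; apply: nz; apply: Sa => b Sb.
by apply: pencil_minor_eq0; rewrite -pencil_ofE // ltnS; apply: MS.
Qed.

Definition mono3 (l : 'I_3 -> C) (u : mon 3) : C :=
  l ord0 ^+ (val u).1 * l (inord 1) ^+ (val u).2 * l (inord 2) ^+ (3 - (val u).1 - (val u).2).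

Lemma pow6_madd l u v : pow6 l (madd u v) = mono3 l u * mono3 l v.
Proof.
have hu : ((val u).1 + (val u).2 <= 3)%N := valP u.
have hv : ((val v).1 + (val v).2 <= 3)%N := valP v.
rewrite /pow6 /madd /mono3.
have le6 : ((val u).1 + (val v).1 + ((val u).2 + (val v).2) <= 6)%N by lia.
rewrite !(val_mk_mon le6) !exprD.
have -> : (6 - ((val u).1 + (val v).1) - ((val u).2 + (val v).2) =
  (3 - (val u).1 - (val u).2) + (3 - (val v).1 - (val v).2))%N by lia.
by rewrite exprD; ring.
Qed.

Lemma s6linear_cat33 : s6linear (@cat33 R).
Proof.
move=> c b; apply/matrixP => i j; rewrite summxE !mxE; apply: eq_bigr => k _.
by rewrite !mxE.
Qed.

Lemma cat33_powsum k (l : 'I_k -> 'I_3 -> C) :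
  let B := \matrix_(i < k, j < #|{: mon 3}|) mono3 (l i) (enum_val j) in
  cat33 (powsum l) = B^T *m B.
Proof.
move=> B; apply/matrixP => i j; rewrite !mxE; apply: eq_bigr => t _.
by rewrite !mxE pow6_madd.
Qed.

Lemma rank_cat33_secant k (a : S6 R) : secant k a -> (\rank (cat33 a) <= k)%N.
Proof.
apply: rank_le_zclosure s6linear_cat33 _ a => _ [l ->].
rewrite cat33_powsum; apply: leq_trans (mxrankM_maxl _ _) _.
exact: rank_leq_col.
Qed.

(* The last hypothesis says that the common kernel of the differentials q_j is the
   tangent space at the power sum, the image of the differential of (l_i) |-> sum l_i^6. *)
Lemma secant_smooth_point k (l : 'I_k -> 'I_3 -> C) r (g : 'I_r -> {mpoly C[N6]})
    (q : 'I_r -> 'I_N6 -> C) (W : 'I_N6 -> 'I_r -> C) :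
  (forall j j', \sum_i q j i * W i j' = (j == j')%:R) ->
  (forall j w, exists y,
     mmap (@polyC C) (fun i => (coords (powsum l) i)%:P + 'X * (w i)%:P) (g j) = 'X * y /\
     y.[0] = \sum_i q j i * w i) ->
  (forall j, vanish (g j) (@powsums k)) ->
  (forall v, (forall j, \sum_i q j i * v i = 0) ->
     exists t : 'I_k -> 'I_3 -> C, forall i, v i = \sum_j dpow6 (l j) (t j) (enum_val i)) ->
  forall P, vanish P (@powsums k) -> exists s (h : 'I_r -> {mpoly C[N6]}),
    s.@[coords (powsum l)] != 0 /\ s * P = \sum_j h j * g j.
Proof.
move=> qW dg vg tg P0 vP0.
have H := @smooth_point _ _ (coords (powsum l)) r g q W (fun P => vanish P (@powsums k)) qW dg vg.
refine (H _ _ _ _ P0 vP0) => [|P Q vP vQ a Sa|P Q vQ a Sa|v /tg [t vt]].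
- by move=> a _; rewrite meval0.
- by rewrite mevalD vP // vQ // addr0.
- by rewrite mevalM vQ // mulr0.
(* Moving the points with velocities t gives the arc sum (l_j + X t_j)^6 on the cone; [z] below is
   its difference quotient at 0. *)
pose c (m : mon 6) : {poly C} := \sum_j ppow6 (fun i => (l j i)%:P + 'X * (t j i)%:P) m.
have /choice [z zP] : forall i : 'I_N6, exists z : {poly C},
    c (enum_val i) = ((c (enum_val i)).[0])%:P + 'X * z /\ z.[0] = (c (enum_val i))^`().[0].
  by move=> i; apply: poly_taylor1.
have c0 m : (c m).[0] = powsum l m.
  rewrite horner_sum; apply: eq_bigr => j _; rewrite horner_ppow6; congr pow6.
  by apply/funext => i; rewrite hornerD hornerM !hornerC hornerX mul0r addr0.
exists z; split=> [i|P vP].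
  rewrite (proj2 (zP i)) vt /c (raddf_sum (@deriv _)) horner_sum; apply: eq_bigr => j _.
  exact: deriv_ppow6.
apply: poly_eq0_horner => x; have -> : (fun i => (coords (powsum l) i)%:P + 'X * z i) =
   (fun i => c (enum_val i)).
  by apply/funext => i; rewrite [RHS](proj1 (zP i)) c0.
rewrite curve_coords; apply: vP.
exists (fun j i => ((l j i)%:P + 'X * (t j i)%:P).[x]); apply/funext => m.
by rewrite horner_sum; apply: eq_bigr => j _; rewrite horner_ppow6.
Qed.

End Secants.

(** * Integer certificates *)

Section IntegerImage.
Variable S : nzRingType.
(** Certificates are computed on binary integers and carried to any ring by this morphism. *)
Definition zr : Z -> S := intr \o int_of_Z.
HB.instance Definition _ := GRing.RMorphism.on zr.
End IntegerImage.
Arguments zr {S} _.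

Lemma zr_id (z : Z) : zr z = z :> Z.
Proof. by rewrite /zr /= -(rmorph_int Z_of_int) intz; exact: int_of_ZK. Qed.

Lemma zr_eq0 (K : numFieldType) (x : Z) : (zr x == 0 :> K) = (x == 0).
Proof.
rewrite /zr /= intr_eq0; apply/eqP/eqP => [|-> //].
by move/(can_inj int_of_ZK (x1 := x) (x2 := 0)).
Qed.

(** Sums evaluated by [vm_compute] are written as folds; [lsumE] turns them into big operators. *)
Definition lsum T (f : T -> Z) (s : seq T) : Z := foldr (fun x y => f x + y) 0 s.

Lemma lsumE T (f : T -> Z) (s : seq T) : lsum f s = \sum_(x <- s) f x.
Proof. by elim: s => [|x s IH]; rewrite ?big_nil // big_cons -IH. Qed.

Definition zent (A : seq (seq Z)) i j : Z := nth 0 (nth [::] A i) j.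

Definition zinverse_check (n : nat) (A B : seq (seq Z)) : bool :=
  all (fun i => all (fun j =>
    Z.eqb (Z.modulo (lsum (fun k => zent A i k * zent B k j) (iota 0 n) - (i == j)%:R) 101) 0)
    (iota 0 n)) (iota 0 n).

(* The output of the elimination is only a candidate inverse modulo 101, to be
   confirmed by [zinverse_check]. *)
Section Gauss.
Let md (x : Z) : Z := Z.modulo x 101.
(** Fermat's inverse: 101 is prime and 99 = 101 - 2. *)
Let inv (x : Z) : Z := md (Z.pow x 99).

Fixpoint pick_pivot (pre rows : seq (seq Z)) : seq Z * seq (seq Z) :=
  match rows with
  | [::] => ([::], pre)
  | r :: rows' => if Z.eqb (head 0 r) 0 then pick_pivot (r :: pre) rows' else (r, pre ++ rows')
  end.

(** Gauss-Jordan elimination that drops the leading column after each pivot: in the end [up] holds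
    the right half of the augmented matrix, in pivot order. *)
Fixpoint gauss (n : nat) (up rows : seq (seq Z)) : seq (seq Z) :=
  match n with
  | 0%N => up
  | n'.+1 =>
    let (p, rest) := pick_pivot [::] rows in
    let c := inv (head 0 p) in
    let p' := [seq md (c * x) | x <- behead p] in
    let elim r := let h := head 0 r in [seq md (x.1 - h * x.2) | x <- zip (behead r) p'] in
    gauss n' (rcons (map elim up) p') (map elim rest)
  end.

Definition zinverse (n : nat) (A : seq (seq Z)) : seq (seq Z) :=
  gauss n [::] (mkseq (fun i => map md (take n (nth [::] A i)) ++
    mkseq (fun j => ((i == j)%:R : Z)) n) n).
End Gauss.

Definition zunit_check n A := zinverse_check n A (zinverse n A).

Definition zmx (S : nzRingType) (m n : nat) (A : seq (seq Z)) : 'M[S]_(m, n) :=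
  \matrix_(i, j) zr (zent A i j).
Arguments zmx {S} m n A.

(** An inverse modulo 101 makes the integer determinant nonzero modulo 101, hence nonzero in
    characteristic 0. *)
Lemma zmx_unit (K : numFieldType) n A : zunit_check n A -> (zmx n n A : 'M[K]_n) \in unitmx.
Proof.
rewrite /zunit_check; move: (zinverse n A) => B chk.
have key (S : comNzRingType) : \det (zmx n n A : 'M[S]_n) = zr (\det (zmx n n A : 'M[Z]_n)).
  rewrite -det_map_mx; congr (\det _); apply/matrixP => i j; rewrite !mxE.
  by rewrite zr_id.
rewrite unitmxE unitfE key zr_eq0; apply/eqP => d0.
have : zmx n n A *m zmx n n B = 1%:M :> 'M['Z_101]_n.
  apply/matrixP => i j; rewrite !mxE.
  have /allP /(_ (i : nat)) := chk; rewrite mem_iota /= ltn_ord => /(_ isT).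
  move=> /allP /(_ (j : nat)); rewrite mem_iota /= ltn_ord => /(_ isT) /Z.eqb_spec.
  move=> /Z.mod_divide [] // q e.
  have -> : \sum_k (zmx n n A : 'M['Z_101]_n) i k * (zmx n n B : 'M['Z_101]_n) k j =
      zr (lsum (fun k => zent A i k * zent B k j) (iota 0 n)).
    rewrite lsumE rmorph_sum -/(index_iota 0 n) -[n in iota 0 n]subn0 big_mkord.
    by apply: eq_bigr => k _; rewrite !mxE rmorphM.
  have -> : lsum (fun k => zent A i k * zent B k j) (iota 0 n) = q * 101%:R + (i == j)%:R.
    by apply/eqP; rewrite -subr_eq; apply/eqP; exact: e.
  by rewrite rmorphD rmorphM !rmorph_nat pchar_Zp // mulr0 add0r.
move/(congr1 determinant); rewrite det_mulmx det1 key d0 rmorph0 mul0r => /eqP.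
by rewrite eq_sym oner_eq0.
Qed.

(** * Ternary forms as integer coefficient lists *)

Lemma mem_zip2 (S T : eqType) (s : seq S) (t : seq T) x : x \in zip s t -> x.2 \in t.
Proof.
elim: s t => [|a s IH] [|b t] //=; rewrite !inE => /orP [/eqP ->|/IH ->]; rewrite ?eqxx //.
by rewrite orbT.
Qed.

(* A form of degree d in three variables is the list of its integer coefficients,
   in the order of [monl d]; [dsum d p F] replaces the monomial of exponents e by F e. *)
Definition dsum (S : nzRingType) d (p : seq Z) (F : nat * nat -> S) : S :=
  \sum_(t <- zip p (monl d)) zr t.1 * F t.2.

Definition tmon (S : nzRingType) d (l : 'I_3 -> S) (e : nat * nat) : S :=
  l ord0 ^+ e.1 * l (inord 1) ^+ e.2 * l (inord 2) ^+ (d - e.1 - e.2).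

Definition zmon d (l : seq Z) (e : nat * nat) : Z :=
  nth 0 l 0 ^+ e.1 * nth 0 l 1 ^+ e.2 * nth 0 l 2 ^+ (d - e.1 - e.2).

Definition pvec (S : nzRingType) (l : seq Z) (j : 'I_3) : S := zr (nth 0 l j).

Definition zsum d (p : seq Z) (F : nat * nat -> Z) : Z :=
  lsum (fun t => t.1 * F t.2) (zip p (monl d)).

Definition eadd (e f : nat * nat) : nat * nat := (e.1 + f.1, e.2 + f.2)%N.

Definition zmul d d' (p q : seq Z) : seq Z :=
  [seq lsum (fun t => lsum (fun t' => if eadd t.2 t'.2 == f then t.1 * t'.1 else 0)
     (zip q (monl d'))) (zip p (monl d)) | f <- monl (d + d')].

(** Reversed because [monl 1] lists the variables as x2, x1, x0. *)
Definition zlin (v : seq Z) : seq Z := [:: nth 0 v 2; nth 0 v 1; nth 0 v 0].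

Lemma lift_ord3_1 : lift ord0 ord0 = inord 1 :> 'I_3.
Proof. by apply: val_inj; rewrite /= inordK. Qed.

Lemma lift_ord3_2 : lift ord0 (lift ord0 ord0) = inord 2 :> 'I_3.
Proof. by apply: val_inj; rewrite /= inordK. Qed.

Section Forms.
Variable S : comNzRingType.
Implicit Types (l : 'I_3 -> S) (F : nat * nat -> S).

Lemma zr_zmon d (l : seq Z) e : zr (zmon d l e) = tmon d (pvec S l) e.
Proof. by rewrite /zmon /tmon /pvec !rmorphM !rmorphXn /= !inordK. Qed.

Lemma zr_zsum d p (F : nat * nat -> Z) : zr (zsum d p F) = dsum d p (fun e => zr (F e) : S).
Proof. by rewrite /zsum lsumE rmorph_sum; apply: eq_bigr => t _; rewrite rmorphM. Qed.

Lemma eq_dsum d p F F' : {in monl d, F =1 F'} -> dsum d p F = dsum d p F'.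
Proof.
by move=> e; rewrite /dsum !big_seq; apply: eq_bigr => t /mem_zip2 /e ->.
Qed.

Lemma dsum_sum d p I (s : seq I) (F : I -> nat * nat -> S) :
  dsum d p (fun e => \sum_(i <- s) F i e) = \sum_(i <- s) dsum d p (F i).
Proof.
rewrite /dsum exchange_big; apply: eq_bigr => t _; exact: mulr_sumr.
Qed.

Lemma dsumZ d p F c : dsum d p (fun e => c * F e) = c * dsum d p F.
Proof. by rewrite /dsum mulr_sumr; apply: eq_bigr => t _; rewrite mulrCA. Qed.

Lemma dsum_nth d p F : size p = size (monl d) ->
  dsum d p F = \sum_(i < size (monl d)) zr (nth 0 p i) * F (nth (0, 0)%N (monl d) i).
Proof.
move=> e; rewrite /dsum (big_nth (0, (0, 0)%N)) big_mkord size_zip e minnn.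
by apply: eq_bigr => i _; rewrite nth_zip.
Qed.

Lemma size_zmul d d' p q : size (zmul d d' p q) = size (monl (d + d')).
Proof. by rewrite size_map. Qed.

(** For arbitrary [F], so that it covers both evaluation at a point and pairing with a sextic. *)
Lemma dsum_zmul d d' p q F :
  dsum (d + d') (zmul d d' p q) F = dsum d p (fun e => dsum d' q (fun e' => F (eadd e e'))).
Proof.
rewrite {1}/dsum (_ : zip _ _ = [seq (nth 0 (zmul d d' p q) (index f (monl (d + d'))), f) |
    f <- monl (d + d')]); last first.
  apply: (@eq_from_nth _ (0, (0, 0)%N)) => [|i]; first by rewrite size_zip size_zmul minnn size_map.
  rewrite size_zip size_zmul minnn => lti; rewrite nth_zip ?size_zmul //.
  by rewrite [RHS](nth_map (0, 0)%N) // index_uniq ?uniq_monl.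
rewrite big_map /= /dsum.
transitivity (\sum_(f <- monl (d + d')) \sum_(t <- zip p (monl d)) \sum_(t' <- zip q (monl d'))
    zr (if eadd t.2 t'.2 == f then t.1 * t'.1 else 0) * F f).
  rewrite !big_seq; apply: eq_bigr => f fM.
  have -> : nth 0 (zmul d d' p q) (index f (monl (d + d'))) =
    lsum (fun t => lsum (fun t' => if eadd t.2 t'.2 == f then t.1 * t'.1 else 0)
      (zip q (monl d'))) (zip p (monl d)).
    by rewrite (nth_map (0, 0)%N) ?index_mem // nth_index.
  rewrite lsumE rmorph_sum mulr_suml; apply: eq_bigr => t _.
  by rewrite lsumE rmorph_sum mulr_suml.
rewrite exchange_big !big_seq; apply: eq_bigr => t /mem_zip2 tM.
rewrite exchange_big mulr_sumr !big_seq; apply: eq_bigr => t' /mem_zip2 tM'.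
have fM : eadd t.2 t'.2 \in monl (d + d').
  by move: tM tM'; rewrite !mem_monl /= => h h'; rewrite addnACA leq_add.
rewrite (bigD1_seq (eadd t.2 t'.2)) ?uniq_monl //= eqxx rmorphM mulrA big1 ?addr0 // => f nf.
by rewrite eq_sym (negPf nf) rmorph0 mul0r.
Qed.

Lemma tmon_eadd d d' l e e' : e \in monl d -> e' \in monl d' ->
  tmon (d + d') l (eadd e e') = tmon d l e * tmon d' l e'.
Proof.
rewrite !mem_monl => h h'; rewrite /tmon /= !exprD.
have -> : (d + d' - (e.1 + e'.1) - (e.2 + e'.2) = (d - e.1 - e.2) + (d' - e'.1 - e'.2))%N.
  by move: h h'; case: e => a b; case: e' => a' b' /=; lia.
rewrite exprD; ring.
Qed.

Lemma eval_zmul d d' p q l :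
  dsum (d + d') (zmul d d' p q) (tmon (d + d') l) = dsum d p (tmon d l) * dsum d' q (tmon d' l).
Proof.
rewrite dsum_zmul mulrC -dsumZ; apply: eq_dsum => e eM; rewrite mulrC -dsumZ.
by apply: eq_dsum => e' eM'; rewrite tmon_eadd.
Qed.

Lemma eval_zlin v l : dsum 1 (zlin v) (tmon 1 l) = \sum_j pvec S v j * l j.
Proof.
rewrite /dsum /zlin (_ : monl 1 = [:: (0, 0); (0, 1); (1, 0)]%N) //= !big_cons big_nil.
rewrite !big_ord_recl big_ord0 /tmon /pvec /= !expr0 !expr1 !mul1r !mulr1 !addr0.
by rewrite lift_ord3_1 lift_ord3_2; ring.
Qed.

End Forms.

Section Pairing.
Variable R : realType.
Local Notation C := (R[i]).

Definition mk6 (e : nat * nat) : mon 6 := mk_mon 6 e.1 e.2.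
Definition mk3 (e : nat * nat) : mon 3 := mk_mon 3 e.1 e.2.

Lemma tmon_pow6 (l : 'I_3 -> C) e : e \in monl 6 -> pow6 l (mk6 e) = tmon 6 l e.
Proof. by rewrite mem_monl => h; rewrite /pow6 /mk6 !(val_mk_mon h). Qed.

Lemma tmon_mono3 (l : 'I_3 -> C) e : e \in monl 3 -> mono3 l (mk3 e) = tmon 3 l e.
Proof. by rewrite mem_monl => h; rewrite /mono3 /mk3 !(val_mk_mon h). Qed.

Lemma madd_mk3 e f : e \in monl 3 -> f \in monl 3 -> madd (mk3 e) (mk3 f) = mk6 (eadd e f).
Proof. by rewrite !mem_monl => h h'; rewrite /madd !(val_mk_mon h) !(val_mk_mon h'). Qed.

(** The apolar pairing, with p on the dual side. Points of S^6V are given by tensor entries, without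
    multinomial coefficients, so pairing with l^6 is evaluation at l. *)
Definition pairing (p : seq Z) (a : S6 R) : C := dsum 6 p (fun e => a (mk6 e)).

Lemma pairing_pow6 p (l : 'I_3 -> C) : pairing p (pow6 l) = dsum 6 p (tmon 6 l).
Proof. by apply: eq_dsum => e /tmon_pow6 ->. Qed.

Lemma pairing_zmul33 p q (a : S6 R) : pairing (zmul 3 3 p q) a =
  dsum 3 p (fun e => dsum 3 q (fun f => a (madd (mk3 e) (mk3 f)))).
Proof.
rewrite /pairing (dsum_zmul 3 3); apply: eq_dsum => e eM.
by apply: eq_dsum => f fM; rewrite madd_mk3.
Qed.

Definition coefv d (p : seq Z) (m : mon d) : C :=
  dsum d p (fun e => (m == mk_mon d e.1 e.2)%:R).

Lemma sum_coefv d p (F : mon d -> C) :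
  \sum_m coefv p m * F m = dsum d p (fun e => F (mk_mon d e.1 e.2)).
Proof.
rewrite /coefv /dsum; under eq_bigr => m _ do rewrite mulr_suml.
rewrite exchange_big; apply: eq_bigr => t _ /=.
rewrite (bigD1 (mk_mon d t.2.1 t.2.2)) //= eqxx mulr1 big1 ?addr0 // => m /negPf ->.
by rewrite mulr0 mul0r.
Qed.

Lemma s6linear_pairing p : s6linear (V := C^o) (pairing p).
Proof.
move=> c b; rewrite /pairing dsum_sum; apply: eq_bigr => i _; exact: dsumZ.
Qed.

(** Sixth powers span S^6V: the value of a linear form at l^6 is a polynomial in l whose
    coefficients are the values of the form on the coordinate basis. *)
Lemma s6linear_ext (f g : S6 R -> C) : s6linear (V := C^o) f -> s6linear (V := C^o) g ->
  (forall l, f (pow6 l) = g (pow6 l)) -> f =1 g.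
Proof.
move=> linf ling fg a.
pose delta (i : 'I_N6) : S6 R := fun m => (m == enum_val i)%:R.
have expand h (b : S6 R) : s6linear (V := C^o) h -> h b = \sum_i coords b i * h (delta i).
  by move=> linh; rewrite -linh; congr h; apply/funext => m; apply: sum_coords.
rewrite (expand f) // (expand g) //; apply: eq_bigr => i _; congr (_ * _).
pose X (m : mon 6) : 'X_{1..3} := [multinom (nth 0 [:: (val m).1 : nat; (val m).2 : nat;
   (6 - (val m).1 - (val m).2)%N] j)%N | j < 3].
have injX m m' : (X m == X m') = (m == m').
  apply/eqP/eqP => [|-> //] /mnmP e; apply: val_inj.
  have := e ord0; have := e (inord 1); rewrite !mnmE /= !inordK //= => e2 e1.
  rewrite [LHS]surjective_pairing [RHS]surjective_pairing.
  by congr (_, _); apply: val_inj.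
pose P : {mpoly C[3]} := \sum_i (f (delta i) - g (delta i)) *: 'X_[X (enum_val i)].
have P0 : P = 0.
  apply: mpoly_eq0_meval => l; rewrite meval_sum.
  transitivity (f (pow6 l) - g (pow6 l)); last by rewrite fg subrr.
  rewrite (expand f) // (expand g) // -sumrB; apply: eq_bigr => j _.
  rewrite mevalZ mevalX mulrC -mulrBr; congr (_ * _).
  by rewrite !big_ord_recl big_ord0 mulr1 !mnmE /= lift_ord3_1 lift_ord3_2 mulrA.
apply/eqP; rewrite -subr_eq0; apply/eqP.
have /(congr1 (mcoeff (X (enum_val i)))) := P0.
rewrite mcoeff0 raddf_sum (bigD1 i) //= mcoeffZ mcoeffX eqxx mulr1 big1 ?addr0 // => j nj.
by rewrite mcoeffZ mcoeffX injX (inj_eq enum_val_inj) (negPf nj) mulr0.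
Qed.

End Pairing.

(** With tangent vectors above and conormal forms below, one invertibility check certifies both
    hypotheses of [secant_smooth_point]: the lower rows are independent, and by a rank count their
    kernel is exactly the span of the upper rows. *)
Lemma unitmx_orthogonal_rows (K : fieldType) m r (S : 'M[K]_(m + r)) :
  S \in unitmx -> dsubmx S *m (usubmx S)^T = 0 ->
  (exists W : 'M_(m + r, r), dsubmx S *m W = 1%:M) /\
  (forall v : 'cV_(m + r), dsubmx S *m v = 0 -> exists t : 'rV_m, v^T = t *m usubmx S).
Proof.
move=> unitS ort; split.
  exists (rsubmx (invmx S)); have := mulmxV unitS.
  rewrite -{1}[S]vsubmxK -{1}[invmx S]hsubmxK mul_col_row (scalar_mx_block m r 1).
  by case/eq_block_mx.
have rankS : \rank (col_mx (usubmx S) (dsubmx S)) = (m + r)%N by rewrite vsubmxK mxrank_unit.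
have ru : \rank (usubmx S) = m.
  have [le_sum _] := mxrank_adds_leqif (usubmx S) (dsubmx S).
  rewrite addsmxE rankS in le_sum.
  apply/eqP; rewrite eqn_leq rank_leq_row -(leq_add2r r).
  by apply: leq_trans le_sum _; rewrite leq_add2l rank_leq_row.
have rd : \rank (dsubmx S) = r.
  have [le_sum _] := mxrank_adds_leqif (usubmx S) (dsubmx S).
  rewrite addsmxE rankS in le_sum.
  apply/eqP; rewrite eqn_leq rank_leq_row -(leq_add2l m).
  by apply: leq_trans le_sum _; rewrite leq_add2r rank_leq_row.
have sub : (usubmx S <= kermx (dsubmx S)^T)%MS.
  by apply/sub_kermxP; rewrite -[LHS]trmxK trmx_mul trmxK ort trmx0.
move=> v dv; apply/submxP; apply: submx_trans (_ : (kermx (dsubmx S)^T <= usubmx S)%MS).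
  by apply/sub_kermxP; rewrite -trmx_mul dv trmx0.
have [_ <-] := mxrank_leqif_sup sub.
by rewrite mxrank_ker mxrank_tr ru rd addnK.
Qed.

Definition zdpow (c : nat) (l : seq Z) (e : nat * nat) : Z :=
  let: (x, y, z) := (nth 0 l 0, nth 0 l 1, nth 0 l 2) in
  let d := (6 - e.1 - e.2)%N in
  match c with
  | 0%N => e.1%:R * x ^+ e.1.-1 * y ^+ e.2 * z ^+ d
  | 1%N => e.2%:R * y ^+ e.2.-1 * x ^+ e.1 * z ^+ d
  | _ => d%:R * z ^+ d.-1 * x ^+ e.1 * y ^+ e.2
  end.

(** One block of k rows per partial derivative, nested like the index k + (k + k). *)
Definition tangent_rows (ls : seq (seq Z)) : seq (seq Z) :=
  let rows c := [seq [seq zdpow c l e | e <- monl 6] | l <- ls] in rows 0%N ++ (rows 1%N ++ rows 2%N).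

Definition conormal_check (k r : nat) (ls Qs : seq (seq Z)) : bool :=
  [&& size ls == k, size Qs == r, all (fun q => size q == size (monl 6)) Qs,
      zunit_check (k + (k + k) + r) (tangent_rows ls ++ Qs) &
      all (fun a => all (fun q => lsum (fun i => nth 0 q i * nth 0 a i) (iota 0 (size (monl 6))) == 0)
        Qs) (tangent_rows ls)].

Lemma nth_tangent c (ls : seq (seq Z)) j s : (j < size ls)%N -> (s < size (monl 6))%N ->
  nth 0 (nth [::] [seq [seq zdpow c l e | e <- monl 6] | l <- ls] j) s =
  zdpow c (nth [::] ls j) (nth (0, 0)%N (monl 6) s).
Proof. by move=> hj hs; rewrite (nth_map [::] [::]) // (nth_map (0, 0)%N (0 : Z)). Qed.

Section Certificate.
Variable R : realType.
Local Notation C := (R[i]).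

Lemma dpow6_zdpow (l : seq Z) (t : 'I_3 -> C) e : e \in monl 6 ->
  dpow6 (pvec C l) t (mk6 e) = t ord0 * zr (zdpow 0 l e) + t (inord 1) * zr (zdpow 1 l e)
    + t (inord 2) * zr (zdpow 2 l e).
Proof.
rewrite mem_monl => h; have [e1 e2] := val_mk_mon h.
rewrite /dpow6 /mk6; move: e1 e2; case: (val _) => a b /= -> ->.
rewrite !rmorphM !rmorphXn !rmorph_nat /pvec !inordK //=.
move: (6 - _ - _)%N => c.
move: (_ ^+ e.1.-1) (_ ^+ e.1) (_ ^+ e.2.-1) (_ ^+ e.2) (_ ^+ c.-1) (_ ^+ c) => *.
by ring.
Qed.

Lemma mon_at_inj d i j : (i < size (monl d))%N -> (j < size (monl d))%N ->
  (mon_at d i == mon_at d j) = (i == j).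
Proof.
move=> hi hj; rewrite -(nth_uniq (0, 0)%N hi hj (uniq_monl d)) /mon_at.
by apply/eqP/eqP => [|-> //]; apply: mk_mon_inj; apply: mem_nth.
Qed.

Lemma mon_atP d (m : mon d) : exists2 i, (i < size (monl d))%N & m = mon_at d i.
Proof.
have mM : ((val m).1 : nat, (val m).2 : nat) \in monl d by rewrite mem_monl; have := valP m.
exists (index ((val m).1 : nat, (val m).2 : nat) (monl d)); first by rewrite index_mem.
by rewrite /mon_at nth_index //= mk_mon_val.
Qed.

Lemma pairing_nth n p (a : S6 R) : n = size (monl 6) -> size p = size (monl 6) ->
  pairing p a = \sum_(i < n) zr (nth 0 p i) * a (mon_at 6 i).
Proof. by move=> -> h; rewrite /pairing dsum_nth. Qed.

Lemma pairing_delta p (v : 'I_N6 -> C) :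
  \sum_i pairing p (fun m => (m == enum_val i)%:R) * v i = pairing p (fun m => v (enum_rank m)).
Proof.
rewrite (_ : (fun m => v (enum_rank m)) = fun m => \sum_i v i * (m == enum_val i)%:R).
  rewrite s6linear_pairing; apply: eq_bigr => i _; exact: mulrC.
apply/funext => m; rewrite [LHS](sum_coords (fun m => v (enum_rank m))).
by apply: eq_bigr => i _; rewrite /coords enum_valK.
Qed.

Lemma secant_conormal_certificate k r (ls Qs : seq (seq Z)) (g : 'I_r -> {mpoly C[N6]}) :
  let l (i : 'I_k) := pvec C (nth [::] ls i) in
  (k + (k + k) + r)%N = size (monl 6) -> conormal_check k r ls Qs ->
  (forall (j : 'I_r) (w : 'I_N6 -> C), exists y,
     mmap (@polyC C) (fun i => (coords (powsum l) i)%:P + 'X * (w i)%:P) (g j) = 'X * y /\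
     y.[0] = pairing (nth [::] Qs j) (fun m => w (enum_rank m))) ->
  (forall j, vanish (g j) (@powsums R k)) ->
  forall P, vanish P (@powsums R k) -> exists s (h : 'I_r -> {mpoly C[N6]}),
    s.@[coords (powsum l)] != 0 /\ s * P = \sum_j h j * g j.
Proof.
move=> l dim /and5P [/eqP sls /eqP sQs /allP sQ chkU chkO] dg vg.
have {}sQ (j : 'I_r) : size (nth [::] Qs j) = size (monl 6).
  by apply/eqP/sQ/mem_nth; rewrite sQs.
set n := (k + (k + k) + r)%N in dim chkU.
pose S : 'M[C]_n := zmx n n (tangent_rows ls ++ Qs).
have unitS : S \in unitmx by apply: zmx_unit.
have szT : size (tangent_rows ls) = (k + (k + k))%N by rewrite !size_cat !size_map sls.
have dS (j : 'I_r) (i : 'I_n) : (dsubmx S) j i = zr (nth 0 (nth [::] Qs j) i).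
  by rewrite !mxE /zent nth_cat szT ltnNge leq_addr /= addKn.
have uS (j : 'I_(k + (k + k))) (i : 'I_n) :
    (usubmx S) j i = zr (nth 0 (nth [::] (tangent_rows ls) j) i).
  by rewrite !mxE /zent nth_cat szT /= ltn_ord.
have ort : dsubmx S *m (usubmx S)^T = 0.
  apply/matrixP => j i; rewrite !mxE.
  have /allP /(_ (nth [::] (tangent_rows ls) i)) := chkO.
  rewrite mem_nth ?szT // => /(_ isT) /allP /(_ (nth [::] Qs j)).
  rewrite mem_nth ?sQs // => /(_ isT) /eqP e.
  transitivity (zr (lsum (fun s => nth 0 (nth [::] Qs j) s * nth 0 (nth [::] (tangent_rows ls) i) s)
    (iota 0 (size (monl 6)))) : C); last by rewrite e rmorph0.
  rewrite lsumE rmorph_sum -dim -/(index_iota 0 n) -[n in iota 0 n]subn0 big_mkord.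
  by apply: eq_bigr => s _; rewrite dS mxE uS rmorphM.
have [[W eW] tg] := unitmx_orthogonal_rows unitS ort.
pose q (j : 'I_r) (i : 'I_N6) := pairing (nth [::] Qs j) (fun m => (m == enum_val i)%:R) : C.
have qE j v : \sum_i q j i * v i = pairing (nth [::] Qs j) (fun m => v (enum_rank m)).
  exact: pairing_delta.
(* [W] is indexed in the order of [monl 6], the ambient coordinates in that of [enum_val]. *)
pose W' (i : 'I_N6) (j : 'I_r) : C := \sum_(t < n) W t j * (mon_at 6 t == enum_val i)%:R.
apply: (@secant_smooth_point R k l r g q W') => // [j j'|j w|v qv].
- rewrite qE (pairing_nth _ dim) //.
  have := congr1 (fun M : 'M_r => M j j') eW; rewrite !mxE => <-.
  apply: eq_bigr => s _; rewrite dS /W' enum_rankK; congr (_ * _).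
  rewrite (bigD1 s) //= eqxx mulr1 big1 ?addr0 // => t nt.
  rewrite mon_at_inj -?dim // (_ : (t == s :> nat) = false) ?mulr0 //; exact: negPf.
- by have [y [e y0]] := dg j w; exists y; rewrite qE.
- pose V : 'cV[C]_n := \col_s v (enum_rank (mon_at 6 s)).
  have [|t et] := tg V.
    apply/matrixP => j z; rewrite !mxE -[RHS](qv j) qE (pairing_nth _ dim) //.
    by apply: eq_bigr => s _; rewrite dS mxE.
  (* The coefficients of the rows in block c are the c-th coordinates of the velocities. *)
  pose T (j : 'I_k) (c : 'I_3) : C := nth 0 [:: t 0 (lshift (k + k) j);
    t 0 (rshift k (lshift k j)); t 0 (rshift k (rshift k j))] c.
  exists T => i; have [s lts eqs] := mon_atP (enum_val i).
  rewrite -dim in lts.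
  have := congr1 (fun M : 'rV_n => M 0 (Ordinal lts)) et; rewrite !mxE /= -eqs enum_valK => ->.
  have sM : nth (0, 0)%N (monl 6) s \in monl 6 by rewrite mem_nth // -dim.
  rewrite !big_split_ord /= -!big_split; apply: eq_bigr => j _.
  rewrite eqs dpow6_zdpow // /T !inordK //= -addrA; congr (_ + (_ + _)); congr (_ * _); rewrite uS.
  + rewrite (_ : nat_of_ord (lshift (k + k) j) = j) // nth_cat size_map sls ltn_ord.
    by rewrite nth_tangent ?sls -?dim.
  + rewrite (_ : nat_of_ord (rshift k (lshift k j)) = (k + j)%N) //.
    rewrite nth_cat size_map sls ltnNge leq_addr addKn nth_cat size_map sls ltn_ord.
    by rewrite nth_tangent ?sls -?dim.
  + rewrite (_ : nat_of_ord (rshift k (rshift k j)) = (k + (k + j))%N) //.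
    rewrite nth_cat size_map sls ltnNge leq_addr addKn.
    rewrite nth_cat size_map sls ltnNge leq_addr addKn.
    by rewrite nth_tangent ?sls -?dim.
Qed.

End Certificate.

(** * Young symmetrizers *)

Section Young.
Variable R : realType.
Local Notation C := (R[i]).

Definition wperm d (s : 'S_d) (w : word d) : word d := [ffun i => w (s i)].

Lemma wpermM d (s t : 'S_d) w : wperm s (wperm t w) = wperm (s * t)%g w.
Proof. by apply/ffunP => i; rewrite !ffunE permM. Qed.

Lemma youngE d (f : 'I_d -> nat * nat) (t : tens R d) w :
  young f t w = \sum_(q in colgrp f) (-1) ^+ (odd_perm q) *
    \sum_(p in rowgrp f) t (wperm (p * q)%g w).
Proof.
apply: eq_bigr => q _; congr (_ * _); apply: eq_bigr => p _.
by rewrite /pact; congr t; apply/ffunP => i; rewrite !ffunE permM.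
Qed.

Lemma eq_young d (f : 'I_d -> nat * nat) (t t' : tens R d) : t =1 t' -> young f t =1 young f t'.
Proof.
by move=> e w; rewrite !youngE; apply: eq_bigr => q _; congr (_ * _); apply: eq_bigr.
Qed.

Lemma young_sum d (f : 'I_d -> nat * nat) I (s : seq I) (c : I -> C) (t : I -> tens R d) w :
  young f (fun v => \sum_(k <- s) c k * t k v) w = \sum_(k <- s) c k * young f (t k) w.
Proof.
rewrite youngE; under eq_bigr => q _ do rewrite exchange_big mulr_sumr.
rewrite exchange_big; apply: eq_bigr => k _; rewrite youngE mulr_sumr; apply: eq_bigr => q _.
by rewrite -mulr_sumr mulrCA.
Qed.

Lemma mem_rowgrp d (f : 'I_d -> nat * nat) (s : 'S_d) :
  reflect (forall i, (f (s i)).1 = (f i).1) (s \in rowgrp f).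
Proof. by rewrite inE; apply: (iffP forallP) => H i; apply/eqP/H. Qed.

Lemma mem_colgrp d (f : 'I_d -> nat * nat) (s : 'S_d) :
  reflect (forall i, (f (s i)).2 = (f i).2) (s \in colgrp f).
Proof. by rewrite inE; apply: (iffP forallP) => H i; apply/eqP/H. Qed.

Lemma colgrpM d (f : 'I_d -> nat * nat) (s t : 'S_d) : t \in colgrp f ->
  ((s * t)%g \in colgrp f) = (s \in colgrp f).
Proof.
move=> /mem_colgrp ht; apply/mem_colgrp/mem_colgrp => h i.
  by rewrite -(h i) permM ht.
by rewrite permM ht.
Qed.

Lemma rowgrpM d (f : 'I_d -> nat * nat) (s t : 'S_d) : t \in rowgrp f ->
  ((s * t)%g \in rowgrp f) = (s \in rowgrp f).
Proof.
move=> /mem_rowgrp ht; apply/mem_rowgrp/mem_rowgrp => h i.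
  by rewrite -(h i) permM ht.
by rewrite permM ht.
Qed.

Lemma tperm_colgrp d (f : 'I_d -> nat * nat) i j : (f i).2 = (f j).2 -> tperm i j \in colgrp f.
Proof. by move=> e; apply/mem_colgrp => k; case: tpermP => [->|->|//]. Qed.

Lemma tperm_rowgrp d (f : 'I_d -> nat * nat) i j : (f i).1 = (f j).1 -> tperm i j \in rowgrp f.
Proof. by move=> e; apply/mem_rowgrp => k; case: tpermP => [->|->|//]. Qed.

Lemma colgrp_alternate d (f : 'I_d -> nat * nat) i j (F : 'S_d -> C) :
  i != j -> (f i).2 = (f j).2 -> (forall q, F (tperm i j * q)%g = F q) ->
  \sum_(q in colgrp f) (-1) ^+ (odd_perm q) * F q = 0.
Proof.
move=> nij fij FE; set S := \sum_(q in _) _.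
have hS : S = - S.
  rewrite {1}/S (reindex_inj (mulgI (tperm i j))) /= -sumrN; apply: eq_big => [q|q _].
    apply/mem_colgrp/mem_colgrp => h k; last by rewrite permM h; case: tpermP => [->|->|].
    have := h (tperm i j k); rewrite permM tpermK => ->; by case: tpermP => [->|->|].
  by rewrite FE odd_mul_tperm nij /= signrN mulNr.
by apply/eqP; rewrite -eqNr -hS.
Qed.

Lemma young_colgrp d (f : 'I_d -> nat * nat) (t : tens R d) s w : s \in colgrp f ->
  young f t (wperm s w) = (-1) ^+ (odd_perm s) * young f t w.
Proof.
move=> hs; rewrite !youngE mulr_sumr [RHS](reindex_inj (mulIg s)) /=.
apply: eq_big => [q|q _]; first by rewrite colgrpM.
rewrite odd_permM signr_addb [(-1) ^+ q * (-1) ^+ s]mulrC -mulrA signrMK; congr (_ * _).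
by apply: eq_bigr => p _; rewrite wpermM mulgA.
Qed.

(** Boxes alone in their columns are fixed by the column group, so their transposition commutes with
    it and is absorbed by the row group. *)
Lemma young_swap d (f : 'I_d -> nat * nat) (t : tens R d) i j w : (f i).1 = (f j).1 ->
  (forall k, (f k).2 = (f i).2 -> k = i) -> (forall k, (f k).2 = (f j).2 -> k = j) ->
  young f t (wperm (tperm i j) w) = young f t w.
Proof.
move=> fij fi fj; rewrite !youngE; apply: eq_bigr => q /mem_colgrp hq; congr (_ * _).
have qt : (q * tperm i j = tperm i j * q)%g.
  have qi : q i = i by apply: fi.
  have qj : q j = j by apply: fj.
  apply/permP => k; rewrite !permM; case: (tpermP i j k) => [->|->|ni nj].
  - by rewrite qi qj tpermL.
  - by rewrite qi qj tpermR.
  - by rewrite tpermD // eq_sym; apply/eqP => e; [apply: ni | apply: nj];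
      apply: (@perm_inj _ q); rewrite e ?qi ?qj.
rewrite [RHS](reindex_inj (mulIg (tperm i j))) /=; apply: eq_big => [p|p _].
  by rewrite rowgrpM // tperm_rowgrp.
by rewrite wpermM -!mulgA qt.
Qed.

Definition basist d (g : 'M[C]_3) (x : word d) : tens R d := fun w => \prod_i g (w i) (x i).
Definition act d (g : 'M[C]_3) (t : tens R d) : tens R d :=
  fun w => \sum_(v : word d) (\prod_i g (w i) (v i)) * t v.

Lemma act_wperm d g (t : tens R d) s x : act g t (wperm s x) = act g (fun v => t (wperm s v)) x.
Proof.
have bij : bijective (@wperm d s).
  by exists (wperm s^-1) => w; rewrite wpermM ?mulVg ?mulgV; apply/ffunP => i; rewrite ffunE perm1.
rewrite /act (reindex (@wperm d s)) /=; last exact: onW_bij.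
apply: eq_bigr => v _; congr (_ * _); rewrite [RHS](reindex_inj (@perm_inj _ s)) /=.
by apply: eq_bigr => i _; rewrite !ffunE.
Qed.

(** Tensor products of columns of g form a basis, in which the inverse action gives the
    coordinates. *)
Lemma basist_expand d g (t : tens R d) w : g \in unitmx ->
  t w = \sum_x act (invmx g) t x * basist g x w.
Proof.
move=> ug; under eq_bigr => x _ do rewrite mulr_suml.
rewrite exchange_big (bigD1 w) //= [X in _ + X]big1 ?addr0 => [|v nvw].
  under eq_bigr => x _ do rewrite mulrAC -big_split.
  rewrite -mulr_suml -(bigA_distr_bigA (fun i k => invmx g k (w i) * g (w i) k)).
  rewrite big1 ?mul1r // => i _; under eq_bigr => k _ do rewrite mulrC.
  have := congr1 (fun M : 'M_3 => M (w i) (w i)) (mulmxV ug); by rewrite !mxE eqxx.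
under eq_bigr => x _ do rewrite mulrAC -big_split.
rewrite -mulr_suml -(bigA_distr_bigA (fun i k => invmx g k (v i) * g (w i) k)).
have [i ni] : exists i, w i != v i.
  by apply/existsP; rewrite -negb_forall; apply: contra nvw => /forallP e; apply/eqP/ffunP => i;
    apply/esym/eqP.
rewrite (bigD1 i) //= [X in X * _ * _](_ : _ = 0) ?mul0r //.
under eq_bigr => k _ do rewrite mulrC.
have := congr1 (fun M : 'M_3 => M (w i) (v i)) (mulmxV ug); by rewrite !mxE (negPf ni).
Qed.

(* If a word repeats a letter more often than there are columns, two occurrences
   share a column. *)
Lemma young_basist_eq0 d (f : 'I_d -> nat * nat) g (x : word d) (c : nat) w :
  (forall i, ((f i).2 < c)%N) -> (c < #|[set i | x i == ord0]|)%N ->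
  young f (basist g x) w = 0.
Proof.
move=> fc lt_c; rewrite youngE; under eq_bigr => q _ do rewrite mulr_sumr.
rewrite exchange_big /= big1 // => p _.
pose y := wperm p^-1 x.
have [i [j [nij fij yij]]] : exists i j, [/\ i != j, (f i).2 = (f j).2 & y i = y j].
  pose A := [set i | y i == ord0].
  have cA : #|A| = #|[set i | x i == ord0]|.
    have -> : A = [set p i | i in [set i | x i == ord0]].
      apply/setP => i; apply/idP/imsetP => [|[k]].
        rewrite inE ffunE => h; exists ((p^-1)%g i); rewrite ?permKV //; by rewrite inE.
      by rewrite inE => xk ->; rewrite inE ffunE permK.
    by rewrite card_imset //; apply: perm_inj.
  (* Pigeonhole: more than c letters 0 in c columns. The index type is written as a successor so
     that [inord] applies. *)
  pose F i := inord (f i).2 : 'I_c.-1.+1.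
  have c0 : (0 < c)%N.
    by case: (c) fc lt_c => // fc; rewrite card_gt0 => /set0Pn [i _]; have := fc i.
  have /injectivePn : ~~ injectiveb (fun i : {i | i \in A} => F (val i)).
    apply/negP => /injectiveP inj; have := leq_card _ inj.
    by rewrite card_sig card_ord prednK // leqNgt (@eq_card _ _ (mem A)) // cA lt_c.
  case=> -[i iA] [[j jA] nij] /= /(congr1 val) /=.
  rewrite !inordK ?prednK // => fij; exists i, j; split=> //.
  by have := iA; have := jA; rewrite !inE => /eqP -> /eqP ->.
have BE q : basist g x (wperm (p * q) w) = \prod_k g (w (q k)) (y k).
  rewrite /basist (reindex_inj (@perm_inj _ p^-1)); apply: eq_bigr => k _ /=.
  by rewrite !ffunE permM permKV.
under eq_bigr => q _ do rewrite BE.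
apply: (colgrp_alternate nij fij) => q; rewrite (reindex_inj (@perm_inj _ (tperm i j))).
apply: eq_bigr => k _; rewrite permM tpermK; congr (g _ _).
by case: tpermP => [->|->|].
Qed.

Lemma ten6_pow6 (l : 'I_3 -> C) (w : word 6) : ten6 (pow6 l) w = \prod_i l (w i).
Proof.
have prodE : \prod_(i < 6) l (w i) = \prod_j l j ^+ #|[set i | w i == j]|.
  rewrite (partition_big w predT) //=; apply: eq_bigr => j _.
  rewrite (eq_bigr (fun=> l j)) => [|i /eqP -> //].
  by rewrite prodr_const; congr (_ ^+ _); apply: eq_card => i; rewrite !inE.
have sum6 : (#|[set i | w i == ord0]| + #|[set i | w i == inord 1]| +
    #|[set i | w i == inord 2]| = 6)%N.
  rewrite -[RHS](card_ord 6) -[RHS]sum1_card [RHS](partition_big w predT) //= !big_ord_recl big_ord0.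
  rewrite addn0 addnA lift_ord3_1 lift_ord3_2.
  by rewrite !sum1_card; congr (_ + _ + _)%N; apply: eq_card => i; rewrite !inE.
rewrite prodE !big_ord_recl big_ord0 mulr1 lift_ord3_1 lift_ord3_2 mulrA.
rewrite /ten6 /pow6 /cont; set a := #|_|; set b := #|[set i | w i == inord 1]|.
have ab : (a + b <= 6)%N by rewrite -sum6 leq_addr.
rewrite !(val_mk_mon ab); congr (_ * _ ^+ _).
by rewrite -subnDA -{1}sum6 addKn.
Qed.

End Young.

(** * The Pieri map has rank at most 3 on sixth powers *)

(** Completion to a basis, taken from the rank normal form of the column l. *)
Lemma exists_first_column (K : fieldType) n (l : 'I_n.+1 -> K) : (exists i, l i != 0) ->
  exists g : 'M[K]_n.+1, g \in unitmx /\ forall i, g i ord0 = l i.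
Proof.
move=> [i0 ni0]; pose v : 'cV[K]_n.+1 := \col_i l i.
have rv : \rank v = 1%N.
  apply/eqP; rewrite eqn_leq rank_leq_col lt0n mxrank_eq0; apply/eqP => /matrixP /(_ i0 0).
  by rewrite !mxE => /eqP; rewrite (negPf ni0).
pose c := row_ebase v 0 0.
have c0 : c != 0.
  have := row_ebase_unit v; rewrite unitmxE unitfE; rewrite [row_ebase v]mx11_scalar det_scalar1.
  by [].
exists (c *: col_ebase v); split.
  by rewrite unitmxZ ?col_ebase_unit // unitfE.
move=> i; have := mulmx_ebase v; rewrite rv => /matrixP /(_ i 0); rewrite [RHS]mxE => <-.
rewrite mxE [row_ebase v]mx11_scalar -/c mul_mx_scalar !mxE; congr (_ * _).
rewrite (bigD1 ord0) //= big1 => [|[[|j] hj] //= _]; last by rewrite mxE /= mulr0.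
by rewrite mxE /= mulr1 addr0.
Qed.

Section PieriRank.
Variable R : realType.
Local Notation C := (R[i]).

Definition pieri_mx T0 T (a : S6 R) : 'M[C]_(#|{: word 6}|, #|{: word 12}|) :=
  \matrix_(i, j) young T (tprod (ten6 a) (young T0 (ebasis R (enum_val i)))) (enum_val j).

Lemma s6linear_pieri T0 T : s6linear (@pieri_mx T0 T).
Proof.
move=> c b; apply/matrixP => i j; rewrite summxE !mxE.
under eq_bigr => k _ do rewrite !mxE.
rewrite -young_sum; apply: eq_young => w; rewrite /tprod /ten6 mulr_suml.
by apply: eq_bigr => k _; rewrite mulrA.
Qed.

(** An injection into the diagram is onto because the diagram has d cells. *)
Lemma tableau_surj lam d (f : 'I_d -> nat * nat) x : is_tableau lam f ->
  (x.2 < nth 0%N lam x.1)%N -> exists i, f i = x.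
Proof.
move=> [dE injf fin] hx.
pose cells := [seq (r, c) | r <- iota 0 (size lam), c <- iota 0 (nth 0%N lam r)].
have memc y : (y.2 < nth 0%N lam y.1)%N -> y \in cells.
  move=> hy; apply/allpairsPdep; exists y.1, y.2; rewrite !mem_iota -surjective_pairing /= !add0n.
  split=> //; rewrite ltnNge; apply/negP => h; by rewrite nth_default in hy.
have szc : size cells = d.
  rewrite size_allpairs_dep dE; congr sumn.
  under eq_map => r do rewrite size_iota.
  by apply: (@eq_from_nth _ 0%N) => [|i]; rewrite size_map size_iota // => hi;
    rewrite (nth_map 0%N) ?size_iota // nth_iota.
have sub : {subset codom f <= cells} by move=> y /codomP [i ->]; apply: memc.
have uf : uniq (codom f) by apply/injectiveP.
have [|_ e] := uniq_min_size uf sub; first by rewrite size_codom card_ord szc.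
have := memc x hx; rewrite -e => /codomP [i ->]; by exists i.
Qed.

Section Tableaux.
Variables (T0 : 'I_6 -> nat * nat) (T : 'I_12 -> nat * nat).
Hypotheses (hT0 : is_tableau [:: 4; 2]%N T0) (hT : is_tableau [:: 6; 4; 2]%N T).

(* Words without the letter 0 standing for the semistandard fillings of the letters 1, 2:
   the first two columns are (1, 2), the two single boxes contain k letters 2. *)
Definition rep_word (k : 'I_3) : word 6 := [ffun i =>
  if (T0 i).1 == 1%N then inord 2 else
  if (T0 i).2 == 2%N then (if (0 < k)%N then inord 2 else inord 1) else
  if (T0 i).2 == 3%N then (if (1 < k)%N then inord 2 else inord 1) else inord 1].

(** Two symmetries of tensors in the image of the Young symmetrizer that survive a change of basis
    of V. *)
Definition alternating (c : word 6 -> C) : Prop :=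
  (forall s x, s \in colgrp T0 -> c (wperm s x) = (-1) ^+ (odd_perm s) * c x) /\
  (forall i j x, (T0 i).1 = (T0 j).1 ->
    (forall k, (T0 k).2 = (T0 i).2 -> k = i) -> (forall k, (T0 k).2 = (T0 j).2 -> k = j) ->
    c (wperm (tperm i j) x) = c x).

(** The source of the rank 3: for a plane U, S_{(4,2)}U has dimension 3. With two letters, a column
    of length 2 is (1, 2) up to sign or gives 0, and the two single boxes are interchangeable. *)
Lemma alternating_rep (x : word 6) : (forall i, x i != ord0) ->
  exists (k : 'I_3) (e : C), forall c, alternating c -> c x = e * c (rep_word k).
Proof.
have cell r q : (q < nth 0 [:: 4; 2] r)%N -> exists i, T0 i = (r, q).
  by move=> h; apply: tableau_surj hT0 _.
have [a0 Ta0] := cell 0%N 0%N isT; have [a1 Ta1] := cell 1%N 0%N isT.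
have [b0 Tb0] := cell 0%N 1%N isT; have [b1 Tb1] := cell 1%N 1%N isT.
have [s2 Ts2] := cell 0%N 2%N isT; have [s3 Ts3] := cell 0%N 3%N isT.
have [_ injT inT] := hT0.
have pos i : [\/ i = a0, i = a1, i = b0 | i = b1] \/ i = s2 \/ i = s3.
  have eqT j y : T0 j = y -> T0 i = y -> i = j by move=> <- /injT.
  have := inT i; case e : (T0 i) => [[|[|r]] q] /=; last by rewrite nth_nil.
    case: q e => [|[|[|[|q]]]] // e _.
    - by left; apply: Or41; apply: eqT Ta0 e.
    - by left; apply: Or43; apply: eqT Tb0 e.
    - by right; left; apply: eqT Ts2 e.
    - by right; right; apply: eqT Ts3 e.
  case: q e => [|[|q]] // e _.
  - by left; apply: Or42; apply: eqT Ta1 e.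
  - by left; apply: Or44; apply: eqT Tb1 e.
have letter (y : 'I_3) : y != ord0 -> y = inord 1 \/ y = inord 2.
  by case: y => [[|[|[|y]]] hy] // _; [left | right]; apply: val_inj; rewrite /= inordK.
pose P y := exists (k : 'I_3) (e : C), forall c, alternating c -> c y = e * c (rep_word k).
have wK i j (y : word 6) : wperm (tperm i j) (wperm (tperm i j) y) = y.
  by apply/ffunP => k; rewrite !ffunE tpermK.
have colstep i j (y : word 6) : (T0 i).2 = (T0 j).2 -> P (wperm (tperm i j) y) -> P y.
  move=> eij [k [e H]]; exists k, ((-1) ^+ (odd_perm (tperm i j)) * e) => c altc.
  by rewrite -{1}(wK i j y) (proj1 altc) ?tperm_colgrp // H // mulrA.
have swapstep y : P (wperm (tperm s2 s3) y) -> P y.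
  move=> [k [e H]]; exists k, e => c altc; rewrite -H // (proj2 altc) ?Ts2 ?Ts3 // => i /= e2.
    by case: (pos i) e2 => [[]|[]] ->; rewrite ?Ta0 ?Ta1 ?Tb0 ?Tb1 ?Ts2 ?Ts3.
  by case: (pos i) e2 => [[]|[]] ->; rewrite ?Ta0 ?Ta1 ?Tb0 ?Tb1 ?Ts2 ?Ts3.
(* A letter repeated in a column makes the value its own opposite; coefficient 0 fits any
   representative. *)
have zerostep i j (y : word 6) : i != j -> (T0 i).2 = (T0 j).2 -> y i = y j -> P y.
  move=> nij eij yij; exists ord0, 0 => c altc; rewrite mul0r; apply/eqP; rewrite -eqNr.
  have := proj1 altc (tperm i j) y (tperm_colgrp eij); rewrite odd_tperm nij mulN1r => <-.
  by apply/eqP; congr c; apply/ffunP => k; rewrite ffunE; case: tpermP => [->|->|].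
have neqT i j : T0 i != T0 j -> i != j by apply: contraNneq => ->.
have a01 : a0 != a1 by apply: neqT; rewrite Ta0 Ta1.
have b01 : b0 != b1 by apply: neqT; rewrite Tb0 Tb1.
have nz1 : inord 1 != ord0 :> 'I_3 by rewrite -val_eqE /= inordK.
have nz2 : inord 2 != ord0 :> 'I_3 by rewrite -val_eqE /= inordK.
have final (y : word 6) : y a0 = inord 1 -> y a1 = inord 2 -> y b0 = inord 1 -> y b1 = inord 2 ->
    (forall i, y i != ord0) -> P y.
  move=> ya0 ya1 yb0 yb1 nz.
  have rep k (z : word 6) : z a0 = inord 1 -> z a1 = inord 2 -> z b0 = inord 1 -> z b1 = inord 2 ->
      z s2 = rep_word k s2 -> z s3 = rep_word k s3 -> P z.
    move=> z1 z2 z3 z4 z5 z6; exists k, 1 => c _; rewrite mul1r; congr c; apply/ffunP => i.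
    by case: (pos i) => [[]|[]] -> //; rewrite ffunE ?Ta0 ?Ta1 ?Tb0 ?Tb1.
  have [e2|e2] := letter _ (nz s2); have [e3|e3] := letter _ (nz s3).
  - by apply: (rep ord0) => //; rewrite ffunE ?Ts2 ?Ts3.
  - apply: swapstep; apply: (rep (inord 1)); rewrite ?ffunE.
    + by rewrite tpermD // neqT // ?Ts2 ?Ts3 Ta0.
    + by rewrite tpermD // neqT // ?Ts2 ?Ts3 Ta1.
    + by rewrite tpermD // neqT // ?Ts2 ?Ts3 Tb0.
    + by rewrite tpermD // neqT // ?Ts2 ?Ts3 Tb1.
    + by rewrite tpermL Ts2 /= inordK.
    + by rewrite tpermR Ts3 /= inordK.
  - by apply: (rep (inord 1)) => //; rewrite ffunE ?Ts2 ?Ts3 /= inordK.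
  - by apply: (rep (inord 2)) => //; rewrite ffunE ?Ts2 ?Ts3 /= inordK.
have tD i j k (y : word 6) : T0 k != T0 i -> T0 k != T0 j -> wperm (tperm i j) y k = y k.
  by move=> h h'; rewrite ffunE tpermD // neqT // eq_sym.
have nzperm i j (y : word 6) : (forall k, y k != ord0) -> forall k, wperm (tperm i j) y k != ord0.
  by move=> nz k; rewrite ffunE.
have bstep (y : word 6) : y a0 = inord 1 -> y a1 = inord 2 -> (forall i, y i != ord0) -> P y.
  move=> ya0 ya1 nz.
  have [e0|e0] := letter _ (nz b0); have [e1|e1] := letter _ (nz b1).
  - by apply: (zerostep b0 b1); rewrite ?e0 ?Tb0 ?Tb1.
  - exact: final.
  - apply: (colstep b0 b1); rewrite ?Tb0 ?Tb1 //; apply: final.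
    + by rewrite tD ?Ta0 ?Tb0 ?Tb1.
    + by rewrite tD ?Ta1 ?Tb0 ?Tb1.
    + by rewrite ffunE tpermL.
    + by rewrite ffunE tpermR.
    + exact: nzperm.
  - by apply: (zerostep b0 b1); rewrite ?e0 ?Tb0 ?Tb1.
move=> nz; rewrite -/(P x).
have [e0|e0] := letter _ (nz a0); have [e1|e1] := letter _ (nz a1).
- by apply: (zerostep a0 a1); rewrite ?e0 ?Ta0 ?Ta1.
- exact: bstep.
- apply: (colstep a0 a1); rewrite ?Ta0 ?Ta1 //; apply: bstep.
  + by rewrite ffunE tpermL.
  + by rewrite ffunE tpermR.
  + exact: nzperm.
- by apply: (zerostep a0 a1); rewrite ?e0 ?Ta0 ?Ta1.
Qed.

Lemma alternating_act g (t : tens R 6) : alternating (act g (young T0 t)).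
Proof.
split=> [s x hs|i j x h1 h2 h3]; rewrite act_wperm /act.
  rewrite mulr_sumr; apply: eq_bigr => v _; rewrite young_colgrp //; exact: mulrCA.
by apply: eq_bigr => v _; rewrite young_swap.
Qed.

Definition zcat (x : word 6) : word 12 :=
  [ffun i : 'I_(6 + 6) => match split i with inl _ => ord0 | inr j => x j end].

Lemma tprod_basist (g : 'M[C]_3) (l : 'I_3 -> C) (x : word 6) : (forall i, g i ord0 = l i) ->
  tprod (ten6 (pow6 l)) (basist g x) =1 basist g (zcat x).
Proof.
move=> gl w; rewrite /tprod ten6_pow6 /basist.
rewrite [RHS](@big_split_ord _ _ _ 6 6) /=; congr (_ * _); apply: eq_bigr => i _.
  by rewrite !ffunE -[lshift 6 i]/(unsplit (inl i)) unsplitK gl.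
by rewrite !ffunE -[rshift 6 i]/(unsplit (inr i)) unsplitK.
Qed.

(** In a basis with first vector l, a basis tensor multiplied by l^6 becomes a word starting with
    six letters 0. The shape (6,4,2) has six columns, so a seventh 0 kills it; only words in the
    letters 1, 2 survive, and three coefficients determine theirs. *)
Lemma rank_pieri_pow6 (l : 'I_3 -> C) : (\rank (pieri_mx T0 T (pow6 l)) <= 3)%N.
Proof.
have [nl|zl] := pselect (exists i, l i != 0); last first.
  have l0 i : l i = 0 by apply/eqP/negPn/negP => h; apply: zl; exists i.
  have -> : pieri_mx T0 T (pow6 l) = 0; last by rewrite mxrank0.
  apply/matrixP => i j; rewrite !mxE.
  rewrite youngE big1 // => q _; rewrite big1 ?mulr0 // => p _.
  by rewrite /tprod ten6_pow6 big_ord_recl l0 !mul0r.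
have [g [ug gl]] := exists_first_column nl.
pose c (w x : word 6) := act (invmx g) (young T0 (ebasis R w)) x.
have altc w : alternating (c w) by apply: alternating_act.
have /choice [E EP] : forall x : word 6, exists E : 'I_3 * C, (forall i, x i != ord0) ->
    forall c, alternating c -> c x = E.2 * c (rep_word E.1).
  move=> x; have [nz|] := pselect (forall i, x i != ord0); last by exists (ord0, 0).
  by have [k [e H]] := alternating_rep nz; exists (k, e).
pose M0 : 'M[C]_(#|{: word 6}|, 3) := \matrix_(i, k) c (enum_val i) (rep_word k).
pose M1 : 'M[C]_(3, #|{: word 12}|) := \matrix_(k, j)
  \sum_(x : word 6 | [forall i, x i != ord0] && ((E x).1 == k))
     (E x).2 * young T (basist g (zcat x)) (enum_val j).
suff -> : pieri_mx T0 T (pow6 l) = M0 *m M1.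
  by apply: leq_trans (mxrankM_maxl _ _) _; apply: rank_leq_col.
have zero_young (x : word 6) (v : word 12) :
    ~~ [forall i, x i != ord0] -> young T (basist g (zcat x)) v = 0.
  rewrite negb_forall => /existsP [i0]; rewrite negbK => /eqP xi0.
  apply: (@young_basist_eq0 _ _ _ _ _ 6) => [i|].
    have [_ _ /(_ i)] := hT; case: (T i).1 => [|[|[|r]]] //= h; last by rewrite nth_nil in h.
      exact: leq_trans h _.
    exact: leq_trans h _.
  (* Seven positions of the letter 0: the six of l^6 and [i0]. *)
  pose S := [set rshift 6 i0] :|: [set lshift 6 i | i in [set: 'I_6]].
  have cS : #|S| = 7.
    rewrite cardsU1 card_imset ?cardsT ?card_ord; last exact: lshift_inj.
    rewrite (_ : _ \notin _ = true) //; apply/imsetP => -[j _] /(congr1 val) /= e.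
    by have := ltn_ord j; rewrite -e.
  apply: (@leq_trans #|S|); first by rewrite cS.
  apply: subset_leq_card; apply/subsetP => k; rewrite !inE => /orP [/eqP ->|/imsetP [j _ ->]].
    by rewrite ffunE -[rshift 6 i0]/(unsplit (inr i0)) unsplitK xi0.
  by rewrite ffunE -[lshift 6 j]/(unsplit (inl j)) unsplitK.
apply/matrixP => i j; rewrite !mxE.
transitivity (\sum_x c (enum_val i) x * young T (basist g (zcat x)) (enum_val j)).
  rewrite -young_sum; apply: eq_young => w; rewrite {1}/tprod [X in _ * X](basist_expand _ _ ug) mulr_sumr.
  apply: eq_bigr => x _; rewrite mulrCA; congr (_ * _); exact: tprod_basist.
rewrite (bigID (fun x : word 6 => [forall i, x i != ord0])) /= addrC big1 ?add0r => [|x nx].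
  rewrite (partition_big (fun x => (E x).1) predT) //=; apply: eq_bigr => k _.
  rewrite !mxE mulr_sumr; apply: eq_bigr => x /andP [/forallP nz /eqP <-].
  by rewrite (EP x nz _ (altc (enum_val i))) mulrCA mulrA.
by rewrite zero_young // mulr0.
Qed.

End Tableaux.

Lemma s6linear_powsum p q (M : S6 R -> 'M[C]_(p, q)) k (l : 'I_k -> 'I_3 -> C) :
  s6linear M -> M (powsum l) = \sum_(i < k) M (pow6 (l i)).
Proof.
move=> linM; rewrite (pencil_ofE _ linM) /pencil.
under [RHS]eq_bigr => i _ do rewrite (pencil_ofE _ linM) /pencil.
by rewrite exchange_big; apply: eq_bigr => t _; rewrite -scaler_suml.
Qed.

Lemma mxrank_sum_leq p q k r (A : 'I_k -> 'M[C]_(p, q)) :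
  (forall i, (\rank (A i) <= r)%N) -> (\rank (\sum_i A i)%R <= r * k)%N.
Proof.
move=> H; rewrite mulnC -[k in (k * r)%N]card_ord -sum_nat_const.
apply: (big_ind2 (fun B n => (\rank B <= n)%N)) => [|B n B' n' h h'|i _]; last exact: H.
  by rewrite mxrank0.
exact: leq_trans (mxrank_add _ _) (leq_add h h').
Qed.

Lemma pieri_rank_secant k (a : S6 R) : secant k a -> pieri_rank_le a (3 * k).
Proof.
move=> Sa T0 T hT0 hT; rewrite -[X in (X <= _)%N]/(\rank (pieri_mx T0 T a)).
apply: (rank_le_zclosure (@s6linear_pieri T0 T) _ Sa) => _ [l ->].
rewrite (s6linear_powsum _ (@s6linear_pieri T0 T)); apply: mxrank_sum_leq => i.
exact: rank_pieri_pow6.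
Qed.

End PieriRank.

(** * Contractions with the standard tableaux *)

Definition T0std (j : 'I_6) : nat * nat := if (j < 4)%N then (0, j : nat)%N else (1, j - 4)%N.
(** Rows are filled in reading order, so the first row consists exactly of the six tensor factors of
    [ten6 a]. *)
Definition Tstd (i : 'I_12) : nat * nat :=
  if (i < 6)%N then (0, i : nat)%N else if (i < 10)%N then (1, i - 6)%N else (2, i - 10)%N.

Lemma T0std_tableau : is_tableau [:: 4; 2]%N T0std.
Proof.
split=> // [i j|i].
  rewrite /T0std; case: ltnP => hi; case: ltnP => hj // [] e; apply: val_inj => //=.
  by rewrite -(subnK hi) e subnK.
by rewrite /T0std; case: (ltnP i 4) => hi //=; rewrite ltn_subLR.
Qed.

Lemma Tstd_tableau : is_tableau [:: 6; 4; 2]%N Tstd.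
Proof.
split=> // [i j|i].
  rewrite /Tstd; case: ltnP => h6; [|case: ltnP => h10]; (case: ltnP => h6'; [|case: ltnP => h10']) => //.
  - by case=> e; apply: val_inj.
  - by case=> e; apply: val_inj; rewrite /= -(subnK h6) e subnK.
  - by case=> e; apply: val_inj; rewrite /= -(subnK h10) e subnK.
by rewrite /Tstd; case: (ltnP i 6) => h6 //=; case: (ltnP i 10) => h10 //=; rewrite ltn_subLR.
Qed.

Section Contraction.
Variable R : realType.
Local Notation C := (R[i]).
Local Notation vec := ('I_3 -> C).

Definition dot (u v : vec) : C := \sum_k u k * v k.
Definition dec d (z : 'I_d -> vec) : tens R d := fun w => \prod_i z i (w i).

Lemma dec_wperm d (z : 'I_d -> vec) s w : dec z (wperm s w) = dec (fun i => z ((s^-1)%g i)) w.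
Proof.
rewrite /dec [RHS](reindex_inj (@perm_inj _ s)) /=.
by apply: eq_bigr => i _; rewrite permK ffunE.
Qed.

Lemma sum_dec d (y z : 'I_d -> vec) : \sum_w dec y w * dec z w = \prod_i dot (y i) (z i).
Proof.
rewrite bigA_distr_bigA; apply: eq_bigr => w _; exact/esym/big_split.
Qed.

Lemma mem_rowgrpV d (f : 'I_d -> nat * nat) (p : 'S_d) : ((p^-1)%g \in rowgrp f) = (p \in rowgrp f).
Proof.
apply/mem_rowgrp/mem_rowgrp => h i; first by rewrite -(h (p i)) permK.
by rewrite -(h ((p^-1)%g i)) permKV.
Qed.

Lemma contract_young_dec d (f : 'I_d -> nat * nat) (y z : 'I_d -> vec) :
  \sum_w dec y w * young f (dec z) w =
  \sum_(p in rowgrp f) \sum_(q in colgrp f) (-1) ^+ (odd_perm q) *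
    \prod_i dot (y (q i)) (z (p i)).
Proof.
under eq_bigr => w _ do rewrite youngE mulr_sumr.
rewrite exchange_big [RHS]exchange_big /=; apply: eq_bigr => q _.
under eq_bigr => w _ do rewrite mulrCA mulr_sumr.
rewrite -mulr_sumr exchange_big -mulr_sumr; congr (_ * _).
rewrite [RHS](reindex_inj invg_inj) /=.
apply: eq_big => [p|p _]; first by rewrite mem_rowgrpV.
under eq_bigr => w _ do rewrite dec_wperm.
rewrite sum_dec (reindex_inj (@perm_inj _ q)); apply: eq_bigr => i _ /=.
by rewrite invMg permM permK.
Qed.

(** Annihilating the entries between different columns of the tableau leaves only the column group
    in the Leibniz expansion. *)
Lemma sum_colgrp_det d (f : 'I_d -> nat * nat) (A : 'M[C]_d) :
  \sum_(q in colgrp f) (-1) ^+ (odd_perm q) * \prod_i A i (q i) =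
  \det (\matrix_(i, j) (if (f i).2 == (f j).2 then A i j else 0)).
Proof.
rewrite big_mkcond /=; apply: eq_bigr => q _; case: mem_colgrp => [h|nh].
  by congr (_ * _); apply: eq_bigr => i _; rewrite mxE h eqxx.
have [i ni] : exists i, (f (q i)).2 != (f i).2.
  apply/existsP; rewrite -negb_forall; apply/negP => /forallP h; apply: nh => i.
  exact/eqP.
by rewrite (bigD1 i) //= mxE eq_sym (negPf ni) mul0r mulr0.
Qed.

Definition det2 (f1 f2 u v : vec) : C := dot f1 u * dot f2 v - dot f1 v * dot f2 u.
Definition det3 (u v w : vec) : C :=
  u ord0 * (v (inord 1) * w (inord 2) - v (inord 2) * w (inord 1))
  - u (inord 1) * (v ord0 * w (inord 2) - v (inord 2) * w ord0)
  + u (inord 2) * (v ord0 * w (inord 1) - v (inord 1) * w ord0).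

Lemma det_mx2 (A : 'M[C]_2) : \det A = A 0 0 * A 1 1 - A 0 1 * A 1 0.
Proof.
rewrite (expand_det_row _ 0) !big_ord_recl big_ord0 addr0 /cofactor !det_mx11 !mxE /=.
rewrite expr0 expr1 mul1r mulN1r mulrN.
by congr (A _ _ * A _ _ - A _ _ * A _ _); apply: val_inj.
Qed.

Lemma det_mx3 (u : 'I_3 -> vec) :
  \det (\matrix_(i < 3, j < 3) u i j) = det3 (u ord0) (u (inord 1)) (u (inord 2)).
Proof.
pose F n m := u (inord n) (inord m).
have -> : \matrix_(i < 3, j < 3) u i j = \matrix_(i < 3, j < 3) F i j.
  by apply/matrixP => i j; rewrite !mxE /F !inord_val.
have z : ord0 = inord 0 :> 'I_3 by apply: val_inj; rewrite /= inordK.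
rewrite (expand_det_row _ 0) !big_ord_recl big_ord0 addr0 /cofactor !det_mx2 !mxE /=.
rewrite /bump /= !addn0 !add1n /det3 z -!/(F _ _); move: F => F.
by rewrite expr0 expr1 -signr_odd /= expr0; ring.
Qed.

(** Entries are functions on natural numbers so that blocks can be split off repeatedly without
    casts. *)
Lemma det_block_nat a b (F : nat -> nat -> C) :
  (forall i j, (i < a)%N -> (j < b)%N -> F i (a + j)%N = 0) ->
  \det (\matrix_(i < a + b, j < a + b) F i j) =
  \det (\matrix_(i < a, j < a) F i j) * \det (\matrix_(i < b, j < b) F (a + i)%N (a + j)%N).
Proof.
move=> F0; rewrite -[X in \det X = _]submxK (_ : ursubmx _ = 0).
  by rewrite det_lblock; congr (_ * _); congr (\det _); apply/matrixP => i j; rewrite !mxE.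
by apply/matrixP => i j; rewrite !mxE /= F0.
Qed.

(** The boxes of [Tstd] column by column; [col_index] gives their columns. *)
Definition col_order : seq nat := [:: 0; 6; 10; 1; 7; 11; 2; 8; 3; 9; 4; 5]%N.
Definition col_index : seq nat := [:: 0; 0; 0; 1; 1; 1; 2; 2; 3; 3; 4; 5]%N.

Definition unitv (k : nat) : vec := fun j => (j == inord k)%:R.

Lemma dot_unitv k v : dot (unitv k) v = v (inord k).
Proof.
rewrite /dot (bigD1 (inord k)) //= /unitv eqxx mul1r big1 ?addr0 // => j /negPf ->.
by rewrite mul0r.
Qed.

(** One covector per box of [Tstd]: the coordinate covectors in the columns of length 3, f1 over f2
    in those of length 2, e in the single boxes. *)
Definition ystd (f1 f2 e : vec) (i : 'I_12) : vec :=
  nth e [:: unitv 0; unitv 0; f1; f1; e; e; unitv 1; unitv 1; f2; f2; unitv 2; unitv 2] i.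

Lemma sum_colgrp_Tstd (f1 f2 e : vec) (z : 'I_12 -> vec) :
  let Z n := z (inord n) in
  \sum_(q in colgrp Tstd) (-1) ^+ (odd_perm q) * \prod_i dot (ystd f1 f2 e (q i)) (z i) =
  det3 (Z 0%N) (Z 6) (Z 10) * (det3 (Z 1%N) (Z 7) (Z 11) *
   (det2 f1 f2 (Z 2) (Z 8) * (det2 f1 f2 (Z 3) (Z 9) * (dot e (Z 4) * dot e (Z 5))))).
Proof.
move=> Z; pose A := \matrix_(i, j) dot (ystd f1 f2 e j) (z i).
transitivity (\sum_(q in colgrp Tstd) (-1) ^+ (odd_perm q) * \prod_i A i (q i)).
  by apply: eq_bigr => q _; congr (_ * _); apply: eq_bigr => i _; rewrite mxE.
rewrite sum_colgrp_det; set B := \matrix_(i, j) _.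
have lto n : (n < 12)%N -> (nth 0 col_order n < 12)%N.
  by move=> h; have /allP := isT : all (fun m => m < 12)%N col_order; apply; apply: mem_nth.
have injr : injective (fun i : 'I_12 => inord (nth 0%N col_order i) : 'I_12).
  move=> i j /(congr1 val); rewrite /= !inordK ?lto // => /eqP.
  by rewrite nth_uniq // => /eqP e'; apply: val_inj.
pose F n m : C := if nth 0%N col_index n == nth 0%N col_index m then
  dot (ystd f1 f2 e (inord (nth 0%N col_order m))) (z (inord (nth 0%N col_order n))) else 0.
(* Permuting rows and columns alike into column order makes the matrix block diagonal. *)
have -> : \det B = \det (\matrix_(i < 3 + (3 + (2 + (2 + (1 + 1)))), j < 3 + (3 + (2 + (2 + (1 + 1))))) F i j).
  transitivity (\det (row_perm (perm injr) (col_perm (perm injr) B))).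
    rewrite row_permE col_permE !det_mulmx !det_perm odd_permV mulrCA -signr_addb.
    by rewrite addbb expr0 mulr1.
  congr (\det _); apply/matrixP => i j; rewrite !mxE !permE /F.
  have colE (k : 'I_12) : (Tstd (inord (nth 0%N col_order k))).2 = nth 0%N col_index k.
    rewrite /Tstd inordK ?lto //.
    by case: k; do 12![case=> [//|]].
  by rewrite !colE.
have Fblock s a b : all (fun i => all (fun j => nth 0%N col_index (s + i) != nth 0%N col_index (s + (a + j)))
    (iota 0 b)) (iota 0 a) ->
    forall i j, (i < a)%N -> (j < b)%N -> F (s + i)%N (s + (a + j))%N = 0.
  move=> /allP h i j hi hj; rewrite /F.
  have hi' : i \in iota 0 a by rewrite mem_iota.
  by have /allP /(_ j) := h i hi'; rewrite mem_iota hj => /(_ isT) /negPf ->.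
rewrite det_block_nat; last exact: (Fblock 0%N).
rewrite (det_block_nat (F := fun i j => F (3 + i) (3 + j))%N); last exact: (Fblock 3%N).
rewrite (det_block_nat (F := fun i j => F (3 + (3 + i)) (3 + (3 + j)))%N); last exact: (Fblock 6%N).
rewrite (det_block_nat (F := fun i j => F (3 + (3 + (2 + i))) (3 + (3 + (2 + j))))%N);
  last exact: (Fblock 8%N).
rewrite (det_block_nat (F := fun i j => F (3 + (3 + (2 + (2 + i)))) (3 + (3 + (2 + (2 + j)))))%N);
  last exact: (Fblock 10%N).
have D3 s : (s == 0%N) || (s == 3%N) -> \det (\matrix_(i < 3, j < 3) F (s + i)%N (s + j)%N) =
   det3 (Z (nth 0%N col_order s)) (Z (nth 0%N col_order (s + 1))) (Z (nth 0%N col_order (s + 2))).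
  move=> hs; pose u (i : 'I_3) := Z (nth 0%N col_order (s + i)).
  have -> : \matrix_(i < 3, j < 3) F (s + i)%N (s + j)%N = \matrix_(i < 3, j < 3) u i j.
    apply/matrixP => i j; rewrite !mxE /F /ystd inordK; last first.
      by apply: lto; case/orP: hs => /eqP ->; case: j => [[|[|[|j]]] hj].
    rewrite -[RHS](f_equal (u i) (inord_val j)) -[u i (inord j)]dot_unitv /u.
    by case/orP: hs => /eqP ->; case: i => [[|[|[|i]]] hi] //; case: j => [[|[|[|j]]] hj].
  by rewrite det_mx3 /u !inordK // addn0.
have D2 s : (s == 6%N) || (s == 8%N) -> \det (\matrix_(i < 2, j < 2) F (s + i)%N (s + j)%N) =
   det2 f1 f2 (Z (nth 0%N col_order s)) (Z (nth 0%N col_order (s + 1))).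
  by case/orP => /eqP ->; rewrite det_mx2 !mxE /F /ystd /= !inordK //;
    congr (_ - _); apply: mulrC.
rewrite (D3 0%N) // (D3 3%N) // (D2 6%N) // (D2 8%N) // !det_mx11 !mxE /F /ystd /= !inordK //.
Qed.

End Contraction.

Lemma T0std_inj : injective T0std.
Proof. by have [] := T0std_tableau. Qed.

Lemma T0std_row (i : 'I_6) : (T0std i).1 = ~~ (i < 4)%N.
Proof. by rewrite /T0std; case: ltnP. Qed.

Lemma T0std_row1 (i : 'I_6) : ~~ (i < 4)%N -> ((T0std i).2 < 2)%N.
Proof. by rewrite /T0std; case: ltnP => //= h _; rewrite ltn_subLR. Qed.

Lemma colgrp_T0std_fixed (q : 'S_6) i : q \in colgrp T0std -> (q i < 4)%N = (i < 4)%N -> q i = i.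
Proof.
move=> /mem_colgrp hq h; apply: T0std_inj.
by rewrite [LHS]surjective_pairing [RHS]surjective_pairing hq !T0std_row h.
Qed.

Lemma colgrp_T0std_id (q : 'S_6) : q \in colgrp T0std ->
  (forall i : 'I_6, (i < 4)%N -> (q i < 4)%N) -> q = 1%g.
Proof.
move=> hq H; apply/permP => i; rewrite perm1.
have [i4|i4] := boolP (i < 4)%N; first by apply: colgrp_T0std_fixed; rewrite ?H ?i4.
apply: colgrp_T0std_fixed => //; rewrite (negPf i4); apply/negP => qi4.
have c2 : ((T0std i).2 < 2)%N := T0std_row1 i4.
pose j : 'I_6 := inord (T0std i).2.
have vj : j = (T0std i).2 :> nat by rewrite inordK //; apply: leq_trans c2 _.
have j4 : (j < 4)%N by rewrite vj; apply: leq_trans c2 _.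
have : q i = q j.
  rewrite (colgrp_T0std_fixed (i := j) hq) ?H ?j4 //; apply: T0std_inj.
  rewrite [LHS]surjective_pairing (mem_colgrp _ _ hq) !T0std_row qi4 /=.
  by rewrite /T0std j4 vj.
by move/perm_inj => e; rewrite e j4 in i4.
Qed.

(** The columns are {0,4}, {1,5}, {2}, {3}, so q is a product of some of two transpositions and its
    sign counts which of the boxes 0 and 1 leave the first row. *)
Lemma colgrp_T0std (q : 'S_6) : q \in colgrp T0std ->
  [/\ odd_perm q = ~~ (q (inord 0) < 4)%N (+) ~~ (q (inord 1) < 4)%N,
      (q (inord 2) < 4)%N & (q (inord 3) < 4)%N].
Proof.
move=> hq; pose o k : 'I_6 := inord k.
have val_o k : (k < 6)%N -> o k = k :> nat by move=> h; rewrite inordK.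
have lt6 k : (k < 2)%N -> (k + 4 < 6)%N by case: k => [|[|]].
have To k : (k < 4)%N -> T0std (o k) = (0%N, k).
  by move=> h; rewrite /T0std val_o ?h //; apply: leq_trans h _.
have To' k : (k < 2)%N -> T0std (o (k + 4)%N) = (1%N, k).
  by move=> h; rewrite /T0std val_o ?lt6 // ltnNge leq_addl /= addnK.
have big k (s : 'S_6) : s \in colgrp T0std -> (1 < k < 4)%N -> (s (o k) < 4)%N.
  move=> hs /andP [k1 k4]; apply/negPn/negP => /T0std_row1; rewrite (mem_colgrp _ _ hs) To //=.
  by rewrite ltnNge k1.
pose t k := tperm (o k) (o (k + 4)%N).
have tC k : (k < 2)%N -> t k \in colgrp T0std.
  by move=> h; apply: tperm_colgrp; rewrite To ?To' //; apply: leq_trans h _.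
have down k (s : 'S_6) : (k < 2)%N -> s \in colgrp T0std -> ~~ (s (o k) < 4)%N -> s (o k) = o (k + 4)%N.
  move=> k2 hs h; apply: T0std_inj; rewrite To' // [LHS]surjective_pairing (mem_colgrp _ _ hs).
  by rewrite T0std_row h To //; apply: leq_trans k2 _.
have other k k' (s : 'S_6) : (k < 2)%N -> (k' < 2)%N -> k != k' -> s \in colgrp T0std ->
    (s * t k)%g (o k') = s (o k').
  move=> k2 k2' nk hs; have k4 : (k < 4)%N by apply: leq_trans k2 _.
  have k4' : (k' < 4)%N by apply: leq_trans k2' _.
  rewrite permM tpermD //; apply: contra nk => /eqP e; have := mem_colgrp _ _ hs (o k');
    by rewrite -e ?To' ?To //= => ->.
have same k (s : 'S_6) : (k < 2)%N -> s \in colgrp T0std -> ~~ (s (o k) < 4)%N ->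
    (s * t k)%g (o k) = o k.
  by move=> k2 hs h; rewrite permM (down k) // tpermR.
have id (s : 'S_6) : s \in colgrp T0std -> (s (o 0%N) < 4)%N -> (s (o 1%N) < 4)%N -> s = 1%g.
  move=> hs h0 h1; apply: colgrp_T0std_id => // i i4.
  have -> : i = o i by apply: val_inj; rewrite /= val_o.
  case: (val i) i4 => [|[|k]] //= k4; apply: big => //.
have oddt k : (k < 2)%N -> odd_perm (t k).
  move=> k2; rewrite odd_tperm -val_eqE /= !val_o ?lt6 //; last by apply: leq_trans k2 _.
  by rewrite -[X in X != _]addn0 eqn_add2l.
rewrite -![inord _]/(o _) (big 2%N) ?(big 3%N) //; split=> //.
have o4 k : (k < 4)%N -> (o k < 4)%N by move=> h; rewrite val_o //; apply: leq_trans h _.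
have [h0|h0] := boolP (q (o 0%N) < 4)%N; have [h1|h1] := boolP (q (o 1%N) < 4)%N.
- by rewrite (id q) // odd_perm1.
- have e : (q * t 1%N)%g = 1%g by apply: id; [rewrite colgrpM ?tC | rewrite other | rewrite same // o4].
  have := congr1 (fun s : 'S_6 => odd_perm s) e.
  by rewrite odd_permM odd_perm1 oddt // addbT => /negbFE ->.
- have e : (q * t 0%N)%g = 1%g by apply: id; [rewrite colgrpM ?tC | rewrite same // o4 | rewrite other].
  have := congr1 (fun s : 'S_6 => odd_perm s) e.
  by rewrite odd_permM odd_perm1 oddt // addbT => /negbFE ->.
- have h1' : ~~ ((q * t 0%N)%g (o 1%N) < 4)%N by rewrite other.
  have e : (q * t 0%N * t 1%N)%g = 1%g.
    apply: id; first by rewrite !colgrpM ?tC.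
      by rewrite other ?colgrpM ?tC // same // o4.
    by rewrite same ?colgrpM ?tC // o4.
  have := congr1 (fun s : 'S_6 => odd_perm s) e.
  by rewrite !odd_permM odd_perm1 !oddt // !addbT negbK => ->.
Qed.

Lemma Tstd_row0 (i : 'I_12) : (i < 6)%N = ((Tstd i).1 == 0%N).
Proof. by rewrite /Tstd; case: (ltnP i 6) => //= _; case: (ltnP i 10). Qed.

Lemma Tstd_row1 (i : 'I_12) : (i < 10)%N = ((Tstd i).1 < 2)%N.
Proof.
rewrite /Tstd; case: (ltnP i 6) => [h|_] /=; first by rewrite (leq_trans h).
by case: (ltnP i 10).
Qed.

Section Compression.
Variable R : realType.
Local Notation C := (R[i]).
Local Notation vec := ('I_3 -> C).

(** The filling with b in the first row and d in the second; its symmetrization is, up to a factor,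
    the element b^2 (b x d)^2. *)
Definition xstd (b d : vec) (j : 'I_6) : vec := if (j < 4)%N then b else d.

Lemma young_T0std_dec (b d : vec) v :
  young T0std (dec (xstd b d)) v = #|rowgrp T0std|%:R *
    \sum_(q in colgrp T0std) (-1) ^+ (odd_perm q) * dec (fun j => xstd b d (q j)) v.
Proof.
rewrite youngE mulr_sumr [RHS](reindex_inj invg_inj) /=; apply: eq_big => [q|q _].
  apply/mem_colgrp/mem_colgrp => h i; first by rewrite -(h ((q^-1)%g i)) permKV.
  by rewrite -(h (q i)) permK.
rewrite odd_permV mulrCA; congr (_ * _).
rewrite (eq_bigr (fun=> dec (fun j => xstd b d ((q^-1)%g j)) v)) => [|p hp].
  by rewrite sumr_const mulr_natl.
rewrite dec_wperm; congr (dec _ v); apply/funext => j; rewrite invMg permM /xstd.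
have : (p^-1)%g \in rowgrp T0std by rewrite mem_rowgrpV.
move=> /mem_rowgrp /(_ ((q^-1)%g j)); rewrite !T0std_row.
by case: (_ < 4)%N; case: (_ < 4)%N.
Qed.

Lemma det3_diag (u v : vec) : det3 u v v = 0.
Proof. by rewrite /det3; ring. Qed.

Lemma det3_swap (u v w : vec) : det3 u w v = - det3 u v w.
Proof. by rewrite /det3; ring. Qed.

Definition zstd (l b d : vec) (q : 'S_6) (i : 'I_12) : vec :=
  match split (i : 'I_(6 + 6)) with inl _ => l | inr j => xstd b d (q j) end.

(* [isd q i]: the box i contains the vector d. *)
Definition isd (q : 'S_6) (i : 'I_12) : bool :=
  match split (i : 'I_(6 + 6)) with inl _ => false | inr j => ~~ (q j < 4)%N end.

Lemma zstdE l b d q i : zstd l b d q i = if (i < 6)%N then l else if isd q i then d else b.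
Proof.
rewrite /zstd /isd; case: splitP => j e; first by rewrite e ltn_ord.
by rewrite e ltnNge leq_addr /= /xstd; case: ltnP.
Qed.

(** Each column of length 3 contains l, b and d once; otherwise a vector repeats and its determinant
    vanishes. *)
Definition compatible (q : 'S_6) (p : 'S_12) : bool :=
  let B n := isd q (p (inord n)) in (B 6 != B 10) && (B 7 != B 11).

Lemma sum_isd q (p : 'S_12) :
  (isd q (p (inord 6)) + isd q (p (inord 7)) + isd q (p (inord 8)) + isd q (p (inord 9))
   + isd q (p (inord 10)) + isd q (p (inord 11)) +
   \sum_(i < 6) isd q (p (lshift 6 i)) = 2)%N.
Proof.
have e6 (j : 'I_6) : rshift 6 j = inord (6 + j) :> 'I_12.
  by apply: val_inj; rewrite /= inordK // -addnS leq_add2l.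
transitivity (\sum_i isd q (p i))%N; last first.
  have -> : (\sum_i isd q (p i) = \sum_i isd q i)%N.
    by rewrite [RHS](reindex_inj (@perm_inj _ p)).
  rewrite (@big_split_ord _ _ _ 6 6) /= big1 => [|i _]; last first.
    by rewrite /isd -[lshift 6 i]/(unsplit (inl i)) unsplitK.
  rewrite add0n (eq_bigr (fun j => (~~ (q j < 4)%N : nat))) => [|i _]; last first.
    by rewrite /isd -[rshift 6 i]/(unsplit (inr i)) unsplitK.
  have -> : (\sum_(j < 6) ~~ (q j < 4) = \sum_(j < 6) ~~ (j < 4))%N.
    by rewrite [RHS](reindex_inj (@perm_inj _ q)).
  by rewrite !big_ord_recl big_ord0.
rewrite [RHS](@big_split_ord _ _ _ 6 6) /= [RHS]addnC; congr (_ + _)%N.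
rewrite [RHS](eq_bigr (fun j : 'I_6 => (isd q (p (inord (6 + j))) : nat))) => [|j _]; last by rewrite e6.
by rewrite !big_ord_recl big_ord0 /= /bump /= !addnA addn0.
Qed.

(** There are only two vectors d, and compatibility spends them on the two long columns; the short
    columns then hold l over b and the single boxes l. A long column reading (l, d, b) changes sign,
    and the sign of q counts exactly these. *)
Lemma compatible_term (l b d f1 f2 e : vec) q (p : 'S_12) :
  q \in colgrp T0std -> p \in rowgrp Tstd ->
  let Z n := zstd l b d q (p (inord n)) in
  (-1) ^+ (odd_perm q) * (det3 (Z 0%N) (Z 6) (Z 10) * (det3 (Z 1%N) (Z 7) (Z 11) *
   (det2 f1 f2 (Z 2) (Z 8) * (det2 f1 f2 (Z 3) (Z 9) * (dot e (Z 4) * dot e (Z 5)))))) =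
  (compatible q p)%:R * (det3 l b d ^+ 2 * det2 f1 f2 l b ^+ 2 * dot e l ^+ 2).
Proof.
move=> hq hp Z; have [oddq q2 q3] := colgrp_T0std hq.
have rowT (i : 'I_12) : ((p i < 6)%N = (i < 6)%N) * (((p i < 10)%N) = (i < 10)%N).
  by rewrite !Tstd_row0 !Tstd_row1 (mem_rowgrp _ _ hp).
have Zl n : (n < 6)%N -> Z n = l.
  by move=> h; rewrite /Z zstdE rowT inordK ?h //; apply: leq_trans h _.
have Zx n : (6 <= n < 12)%N -> Z n = if isd q (p (inord n)) then d else b.
  by move=> /andP [h h']; rewrite /Z zstdE rowT inordK // ltnNge h.
(* The sign of q counts the vectors d in the second row, boxes 6 to 9, and p preserves that row. *)
have parity : odd_perm q = isd q (p (inord 6)) (+) isd q (p (inord 7)) (+)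
    isd q (p (inord 8)) (+) isd q (p (inord 9)).
  pose P (i : 'I_12) := ((6 <= i) && (i < 10))%N.
  have sumP (g : 'I_12 -> bool) : \big[addb/false]_(i | P i) g i =
      g (inord 6) (+) g (inord 7) (+) g (inord 8) (+) g (inord 9).
    pose G n := g (inord n); rewrite (eq_bigr (fun i : 'I_12 => G i)) => [|i _]; last first.
      by rewrite /G inord_val.
    rewrite big_mkcond !big_ord_recl big_ord0 /P /= /bump /= -!/(G _); move: G => G.
    by rewrite addbF -!addbA.
  rewrite -(sumP (fun i => isd q (p i))).
  have -> : \big[addb/false]_(i | P i) isd q (p i) = \big[addb/false]_(i | P i) isd q i.
    rewrite [RHS](reindex_inj (@perm_inj _ p)) /=; apply: eq_bigl => i.
    by rewrite /P leqNgt [in RHS]leqNgt !rowT.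
  rewrite sumP oddq.
  have isdE k : (k < 6)%N -> isd q (inord (6 + k)) = ~~ (q (inord k) < 4)%N.
    move=> k6; have -> : inord (6 + k) = rshift 6 (inord k : 'I_6) :> 'I_12.
      by apply: val_inj; rewrite /= !inordK // -addnS leq_add2l.
    by rewrite /isd -[rshift 6 _]/(unsplit (inr _)) unsplitK.
  by rewrite -(isdE 0%N) // -(isdE 1%N) // (isdE 2%N) // (isdE 3%N) // q2 q3 !addbF.
have := sum_isd q p.
rewrite big1 ?addn0 => [|i _]; last first.
  by rewrite /isd; case: splitP => // j e'; have := rowT (lshift 6 i); rewrite /= e' ltn_ord; case.
rewrite /compatible oddq in parity *; rewrite parity.
rewrite (Zl 0%N) // (Zl 1%N) // (Zl 2%N) // (Zl 3%N) // (Zl 4%N) // (Zl 5%N) //.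
rewrite (Zx 6%N) // (Zx 7%N) // (Zx 8%N) // (Zx 9%N) // (Zx 10%N) // (Zx 11%N) //.
have dd : det3 l d b = - det3 l b d by exact: det3_swap.
(* All placements of d in the two lower rows; those without exactly two d are excluded by
   [sum_isd]. *)
by case: (isd q (p (inord 6))); case: (isd q (p (inord 7))); case: (isd q (p (inord 8)));
  case: (isd q (p (inord 9))); case: (isd q (p (inord 10))); case: (isd q (p (inord 11))) => //= _;
  rewrite ?det3_diag ?dd ?expr0 ?expr1; ring.
Qed.

End Compression.

(** * Compression of the Pieri map to a small matrix *)

Lemma mxrank_submatrix (K : fieldType) m n p q (A : 'M[K]_(m, n)) (f : 'I_p -> 'I_m) (g : 'I_q -> 'I_n) :
  (\rank (\matrix_(i, j) A (f i) (g j)) <= \rank A)%N.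
Proof.
have rows m' n' p' (B : 'M[K]_(m', n')) (h : 'I_p' -> 'I_m') :
    (\rank (\matrix_(i < p', j < n') B (h i) j) <= \rank B)%N.
  apply: mxrankS; apply/row_subP => i.
  by rewrite (_ : row i _ = row (h i) B) ?row_sub //; apply/rowP => j; rewrite !mxE.
apply: leq_trans (rows _ _ _ A f); rewrite -mxrank_tr -[X in (_ <= X)%N]mxrank_tr.
set B := (\matrix_(i, j) A (f i) j)^T.
rewrite (_ : _^T = \matrix_(j, i) B (g j) i) ?rows //.
by apply/matrixP => i j; rewrite !mxE.
Qed.

Definition zcross (u v : seq Z) : seq Z :=
  let: (a, b, c) := (nth 0 u 0, nth 0 u 1, nth 0 u 2) in
  let: (x, y, z) := (nth 0 v 0, nth 0 v 1, nth 0 v 2) in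
  [:: b * z - c * y; c * x - a * z; a * y - b * x].

(* A triple (f1, f2, d) encodes the vectors b = f1 x f2 and d, that is, the element
   b^2 (b x d)^2 of the trace-free part of S^2 V (x) S^2 V^*. *)
Definition triple := (seq Z * seq Z * seq Z)%type.
Definition tb (t : triple) : seq Z := zcross t.1.1 t.1.2.
Definition tl (t : triple) : seq Z := zcross (tb t) t.2.

(* The cubic l |-> [l b d] [l b' d'] [l b b']. *)
Definition zcubic (t t' : triple) : seq Z :=
  zmul 2 1 (zmul 1 1 (zlin (tl t)) (zlin (tl t'))) (zlin (zcross (tb t) (tb t'))).
Definition zsextic (t t' : triple) : seq Z := let c := zcubic t t' in zmul 3 3 c c.

Section PieriReduction.
Variable R : realType.
Local Notation C := (R[i]).
Local Notation vec := ('I_3 -> C).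

(* Paired with a decomposable tensor, the Young symmetrizers give products of column
   determinants; every permutation contributes 0 or the same product with sign +1. *)
Lemma pieri_compression : exists2 kappa : nat, (0 < kappa)%N & forall l b d f1 f2 e : vec,
  \sum_i \sum_j dec (xstd b d) (enum_val i) * pieri_mx T0std Tstd (pow6 l) i j *
     dec (ystd f1 f2 e) (enum_val j) =
  kappa%:R * (det3 l b d ^+ 2 * det2 f1 f2 l b ^+ 2 * dot e l ^+ 2).
Proof.
(* The order of the row group, by which it fixes [xstd], times the number of compatible pairs; the
   pair of identities is compatible, whence positivity. *)
exists (#|rowgrp T0std| * \sum_(q in colgrp T0std) \sum_(p in rowgrp Tstd) compatible q p)%N.
  rewrite muln_gt0; apply/andP; split.
    by apply/card_gt0P; exists 1%g; apply/mem_rowgrp => i; rewrite perm1.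
  rewrite (bigD1 1%g) /=; last by apply/mem_colgrp => i; rewrite perm1.
  rewrite (bigD1 1%g) /=; last by apply/mem_rowgrp => i; rewrite perm1.
  suff -> : compatible 1 1 by [].
  have isd1 n : (n < 6)%N -> isd 1 (inord (6 + n)) = (3 < n)%N.
    move=> n6; have -> : inord (6 + n) = rshift 6 (inord n : 'I_6) :> 'I_12.
      by apply: val_inj; rewrite /= !inordK // -addnS leq_add2l.
    by rewrite /isd -[rshift 6 _]/(unsplit (inr _)) unsplitK perm1 inordK // -leqNgt.
  by rewrite /compatible !perm1 (isd1 0%N) // (isd1 4%N) // (isd1 1%N) // (isd1 5%N).
move=> l b d f1 f2 e.
transitivity (\sum_v dec (ystd f1 f2 e) v *
    young Tstd (tprod (ten6 (pow6 l)) (young T0std (dec (xstd b d)))) v).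
  rewrite exchange_big /= (reindex (enum_val : 'I_#|{: word 12}| -> word 12)) /=; last first.
    exact: onW_bij (enum_val_bij _).
  apply: eq_bigr => j _; rewrite -mulr_suml mulrC; congr (_ * _).
  transitivity (\sum_w dec (xstd b d) w * young Tstd (tprod (ten6 (pow6 l))
      (young T0std (ebasis R w))) (enum_val j)).
    rewrite [RHS](reindex (enum_val : 'I_#|{: word 6}| -> word 6)) /=; last first.
      exact: onW_bij (enum_val_bij _).
    by apply: eq_bigr => i _; rewrite mxE.
  rewrite -young_sum; apply: eq_young => w; rewrite {2}/tprod.
  under eq_bigr => k _ do rewrite mulrCA.
  rewrite -mulr_sumr; congr (_ * _); rewrite -young_sum; apply: eq_young => u.
  rewrite (bigD1 u) //= /ebasis eqxx mulr1 big1 ?addr0 // => k /negPf nk.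
  by rewrite eq_sym nk mulr0.
have tz (q : 'S_6) (v : word 12) :
    tprod (ten6 (pow6 l)) (dec (fun j => xstd b d (q j))) v = dec (zstd l b d q) v.
  rewrite /tprod ten6_pow6 /dec [RHS](@big_split_ord _ _ _ 6 6) /=.
  congr (_ * _); apply: eq_bigr => i _; rewrite ffunE /zstd.
    by rewrite -[lshift 6 i]/(unsplit (inl i)) unsplitK.
  by rewrite -[rshift 6 i]/(unsplit (inr i)) unsplitK.
have ey (v : word 12) : young Tstd (tprod (ten6 (pow6 l)) (young T0std (dec (xstd b d)))) v =
   \sum_(q in colgrp T0std) (#|rowgrp T0std|%:R * (-1) ^+ (odd_perm q)) * young Tstd (dec (zstd l b d q)) v.
  rewrite -big_enum -young_sum; apply: eq_young => w; rewrite {1}/tprod young_T0std_dec mulrCA.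
  rewrite !mulr_sumr -big_enum; apply: eq_bigr => q _.
  rewrite -tz /tprod; move: (ten6 _ _) (dec _ _) (_%:R : C) (_ ^+ _ : C) => x1 x2 x3 x4.
  by ring.
transitivity (\sum_(v : word 12) \sum_(q in colgrp T0std) dec (ystd f1 f2 e) v *
    ((#|rowgrp T0std|%:R * (-1) ^+ (odd_perm q)) * young Tstd (dec (zstd l b d q)) v)).
  by apply: eq_bigr => v _; rewrite -mulr_sumr; congr (_ * _); apply: ey.
rewrite exchange_big natrM natr_sum -mulrA mulr_suml mulr_sumr; apply: eq_bigr => q hq.
under eq_bigr => v _ do rewrite mulrCA.
rewrite -mulr_sumr contract_young_dec -(mulrA (#|rowgrp T0std|%:R : C)); congr (_ * _).
rewrite natr_sum mulr_suml mulr_sumr; apply: eq_bigr => p hp.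
by rewrite (sum_colgrp_Tstd f1 f2 e (fun i => zstd l b d q (p i))) compatible_term.
Qed.

Lemma pvec_zcross u v (l : vec) : \sum_j pvec C (zcross u v) j * l j = det3 l (pvec C u) (pvec C v).
Proof.
rewrite !big_ord_recl big_ord0 lift_ord3_1 lift_ord3_2 /det3 /pvec /zcross !inordK //=.
rewrite !rmorphB !rmorphM /=; ring.
Qed.

Lemma det2_zcross f1 f2 (l b : vec) :
  det2 (pvec C f1) (pvec C f2) l b = det3 l b (pvec C (zcross f1 f2)).
Proof.
rewrite /det2 /dot !big_ord_recl !big_ord0 lift_ord3_1 lift_ord3_2 /det3 /pvec /zcross !inordK //=.
rewrite !rmorphB !rmorphM /=; ring.
Qed.

Lemma eval_zcubic t t' (l : vec) : dsum 3 (zcubic t t') (tmon 3 l) =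
  det3 l (pvec C (tb t)) (pvec C t.2) * det3 l (pvec C (tb t')) (pvec C t'.2) *
  det3 l (pvec C (tb t)) (pvec C (tb t')).
Proof. by rewrite /zcubic (eval_zmul 2 1) (eval_zmul 1 1) !eval_zlin !pvec_zcross. Qed.

Definition redmx (ts : seq triple) (a : S6 R) : 'M[C]_(size ts) :=
  \matrix_(i, j) pairing (zsextic (tnth (in_tuple ts) i) (tnth (in_tuple ts) j)) a.

Lemma s6linear_redmx ts : s6linear (redmx ts).
Proof.
move=> c b; apply/matrixP => i j; rewrite summxE !mxE s6linear_pairing.
by apply: eq_bigr => k _; rewrite !mxE.
Qed.

(** Contracting the Pieri matrix on both sides with the tensors of the triples gives a nonzero
    multiple of [redmx]. Both are linear in [a], so sixth powers suffice, where [pieri_compression]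
    applies. *)
Lemma rank_redmx ts a r : pieri_rank_le a r -> (\rank (redmx ts a) <= r)%N.
Proof.
have [kappa k0 Hk] := pieri_compression.
move=> /(_ _ _ T0std_tableau Tstd_tableau); rewrite -[X in (X <= _)%N -> _]/(\rank (pieri_mx T0std Tstd a)).
pose t (i : 'I_(size ts)) := tnth (in_tuple ts) i.
pose X : 'M[C]_(size ts, #|{: word 6}|) :=
  \matrix_(i, w) dec (xstd (pvec C (tb (t i))) (pvec C (t i).2)) (enum_val w).
pose Y : 'M[C]_(#|{: word 12}|, size ts) :=
  \matrix_(w, j) dec (ystd (pvec C (t j).1.1) (pvec C (t j).1.2) (pvec C (tl (t j)))) (enum_val w).
have e : X *m pieri_mx T0std Tstd a *m Y = kappa%:R *: redmx ts a.
  apply/matrixP => i j; rewrite [LHS]mxE.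
  transitivity (\sum_w \sum_v X i w * pieri_mx T0std Tstd a w v * Y v j).
    rewrite exchange_big; apply: eq_bigr => v _; rewrite mxE mulr_suml.
    by [].
  rewrite !mxE -/(t i) -/(t j).
  apply: (s6linear_ext (f := fun a => \sum_w \sum_v X i w * pieri_mx T0std Tstd a w v * Y v j)
    (g := fun a => kappa%:R * pairing (zsextic (t i) (t j)) a)) a.
  - move=> c b; under [RHS]eq_bigr => k _ do rewrite /GRing.scale /= mulr_sumr.
    rewrite [RHS]exchange_big; apply: eq_bigr => w _.
    under [RHS]eq_bigr => k _ do rewrite mulr_sumr.
    rewrite [RHS]exchange_big; apply: eq_bigr => v _.
    rewrite (s6linear_pieri T0std Tstd) summxE mulr_sumr mulr_suml; apply: eq_bigr => k _.
    rewrite [X in _ * X * _](_ : _ = c k * pieri_mx T0std Tstd (b k) w v); last by rewrite mxE.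
    by rewrite /GRing.scale /= mulrCA !mulrA.
  - move=> c b; rewrite s6linear_pairing mulr_sumr; apply: eq_bigr => k _.
    by rewrite /GRing.scale /= mulrCA.
  - move=> l; rewrite pairing_pow6 /zsextic (eval_zmul 3 3) eval_zcubic.
    transitivity (kappa%:R * (det3 l (pvec C (tb (t i))) (pvec C (t i).2) ^+ 2 *
       det2 (pvec C (t j).1.1) (pvec C (t j).1.2) l (pvec C (tb (t i))) ^+ 2 *
       dot (pvec C (tl (t j))) l ^+ 2)).
      rewrite -Hk; apply: eq_bigr => w _; apply: eq_bigr => v _; by rewrite [X i w]mxE [Y v j]mxE.
    by rewrite /dot pvec_zcross det2_zcross -/(tb _); ring.
move=> le_r; apply: leq_trans le_r.
have -> : \rank (redmx ts a) = \rank (kappa%:R *: redmx ts a).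
  by apply/esym/eqmx_rank/eqmxP/eqmx_scale; rewrite pnatr_eq0 -lt0n.
rewrite -e; exact: leq_trans (mxrankM_maxl _ _) (mxrankM_maxr _ _).
Qed.

End PieriReduction.

(** * The components for k = 7 and k = 8 *)

Definition zcomb (s : seq (Z * seq Z)) : seq Z :=
  foldr (fun t q => [seq t.1 * x.1 + x.2 | x <- zip t.2 q]) (nseq (size (monl 6)) 0) s.

Definition catmx (ls : seq (seq Z)) (sel : seq (nat * nat)) : seq (seq Z) :=
  [seq [seq lsum (fun l => zmon 3 l e * zmon 3 l f) ls | f <- sel] | e <- sel].

Definition kernel_cubic (ls : seq (seq Z)) (N : seq Z) : bool :=
  all (fun l => zsum 3 N (zmon 3 l) == 0) ls.

Definition sum_squares (ls : seq (seq Z)) (c : seq Z) : Z := lsum (fun l => zsum 3 c (zmon 3 l) ^+ 2) ls.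

Definition zredmx (ls : seq (seq Z)) (ts : seq triple) : seq (seq Z) :=
  [seq [seq sum_squares ls (zcubic t t') | t' <- ts] | t <- ts].

Definition cat_check k ls sel : bool :=
  [&& size ls == k, size sel == k, all (fun e => e.1 + e.2 <= 3)%N sel & zunit_check k (catmx ls sel)].

Definition kernel_vector (A : seq (seq Z)) (u : seq Z) n : bool :=
  all (fun j => lsum (fun i => nth 0 u i * zent A i j) (iota 0 n) == 0) (iota 0 n) &&
  all (fun i => lsum (fun j => zent A i j * nth 0 u j) (iota 0 n) == 0) (iota 0 n).

(** The value of the quadratic form [redmx] at u, as a sextic: the differential of the bordered
    minor when u is both a left and a right kernel vector. *)
Definition zquad (ts : seq triple) (u : seq Z) : seq Z :=
  zcomb [seq (nth 0 u i * nth 0 u j, zsextic (nth ([::], [::], [::]) ts i) (nth ([::], [::], [::]) ts j))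
        | i <- iota 0 (size ts), j <- iota 0 (size ts)].

Definition pieri_check k ls ts u : bool :=
  let A := zredmx ls ts in
  [&& (3 * k <= size ts)%N, zunit_check (3 * k) A & kernel_vector A u (size ts)].

Section Certificates.
Variable R : realType.
Local Notation C := (R[i]).

Lemma zcombP s (a : S6 R) : all (fun t => size t.2 == size (monl 6)) s ->
  size (zcomb s) = size (monl 6) /\ pairing (zcomb s) a = \sum_(t <- s) zr t.1 * pairing t.2 a.
Proof.
elim: s => [|t s IH].
  move=> _; rewrite -[zcomb [::]]/(nseq (size (monl 6)) 0); split; first by rewrite size_nseq.
  rewrite (pairing_nth (n := size (monl 6))) ?size_nseq // big_nil big1 // => i _.
  by rewrite nth_nseq ltn_ord rmorph0 mul0r.
rewrite -[zcomb (t :: s)]/([seq t.1 * x.1 + x.2 | x <- zip t.2 (zcomb s)]).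
rewrite [all _ _]/= => /andP [/eqP st /IH [ss ps]].
have sz : size [seq t.1 * x.1 + x.2 | x <- zip t.2 (zcomb s)] = size (monl 6).
  by rewrite size_map size_zip st ss minnn.
split=> //; rewrite big_cons -ps !(pairing_nth (n := size (monl 6))) // mulr_sumr -big_split.
apply: eq_bigr => i _; rewrite (nth_map (0, 0)) ?size_zip ?st ?ss ?minnn //.
by rewrite nth_zip ?st ?ss //= rmorphD rmorphM mulrDl mulrA.
Qed.

Lemma pencil_of_conormal m n (M : S6 R -> 'M[C]_(m, n)) (a : S6 R) r (u : 'rV_m) (v : 'cV_n) :
  s6linear M -> (r <= \rank (M a))%N -> u *m M a = 0 -> M a *m v = 0 ->
  exists (E : 'M[C]_(r + 1, m)) (F : 'M[C]_(n, r + 1)), forall w, exists y,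
    mmap (@polyC C) (fun i => (coords a i)%:P + 'X * (w i)%:P) (pencil_minor (pencil_of M) E F) = 'X * y /\
    y.[0] = (u *m M (fun m => w (enum_rank m)) *m v) 0 0.
Proof.
move=> linM; rewrite (pencil_ofE a linM) => rk uM Mv.
have [E [F EF]] := pencil_minor_conormal rk uM Mv.
exists E, F => w; have [y [e y0]] := EF w; exists y; split; first exact: e.
rewrite y0 (pencil_ofE _ linM); congr ((u *m pencil _ _ *m v) 0 0).
by apply/funext => i; rewrite /coords enum_valK.
Qed.

Section Points.
Variables (k : nat) (ls : seq (seq Z)).
Hypothesis size_ls : size ls = k.
Let l (i : 'I_k) : 'I_3 -> C := pvec C (nth [::] ls i).

Lemma powsum_list (V : nmodType) (F : ('I_3 -> C) -> V) : \sum_i F (l i) = \sum_(x <- ls) F (pvec C x).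
Proof. by rewrite (big_nth [::]) size_ls big_mkord. Qed.

Lemma rank_cat_check sel : cat_check k ls sel -> (k <= \rank (cat33 (powsum l)))%N.
Proof.
case/and4P => _ /eqP ssel /allP msel chk.
pose f (i : 'I_k) : 'I_#|{: mon 3}| := enum_rank (mk3 (nth (0, 0)%N sel i)).
apply: leq_trans (mxrank_submatrix (cat33 (powsum l)) f f).
rewrite (_ : (\matrix_(i, j) _) = zmx k k (catmx ls sel)) ?mxrank_unit ?zmx_unit //.
apply/matrixP => i j; rewrite !mxE !enum_rankK /zent.
have [mi mj] : nth (0, 0)%N sel i \in monl 3 /\ nth (0, 0)%N sel j \in monl 3.
  by rewrite !mem_monl; split; apply: msel; rewrite mem_nth ?ssel.
rewrite (nth_map (0, 0)%N) ?ssel // (nth_map (0, 0)%N) ?ssel // lsumE rmorph_sum.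
rewrite /powsum madd_mk3 //.
rewrite (powsum_list (fun x => pow6 x (mk6 (eadd (nth (0, 0)%N sel i) (nth (0, 0)%N sel j))))).
apply: eq_bigr => x _; rewrite -madd_mk3 // pow6_madd !tmon_mono3 // -!zr_zmon; exact: (esym (rmorphM _ _ _)).
Qed.

End Points.

Definition cubic_row (N : seq Z) : 'rV[C]_#|{: mon 3}| := \row_i coefv R N (enum_val i).

Lemma cubic_row_mul N n (A : 'M_(#|{: mon 3}|, n)) (F : mon 3 -> C) j :
  (forall i, A i j = F (enum_val i)) -> (cubic_row N *m A) 0 j = dsum 3 N (fun e => F (mk3 e)).
Proof.
move=> AF; rewrite mxE -[RHS](sum_coefv N F) -sum_enum_mon.
by apply: eq_bigr => i _; rewrite !mxE AF.
Qed.

Lemma cubic_row_cat33 N (a : S6 R) N' :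
  (cubic_row N *m cat33 a *m (cubic_row N')^T) 0 0 = pairing (zmul 3 3 N N') a.
Proof.
rewrite pairing_zmul33 -mulmxA.
rewrite (cubic_row_mul N (F := fun u => dsum 3 N' (fun f => a (madd u (mk3 f))))) // => i.
have -> : (cat33 a *m (cubic_row N')^T) i 0 = (cubic_row N' *m (cat33 a)^T) 0 i.
  by rewrite !mxE; apply: eq_bigr => j _; rewrite !mxE mulrC.
by apply: (cubic_row_mul N' (F := fun v => a (madd (enum_val i) v))) => j; rewrite !mxE.
Qed.

Lemma cat33_sym (a : S6 R) : (cat33 a)^T = cat33 a.
Proof. by apply/matrixP => i j; rewrite !mxE /madd addnC [X in mk_mon _ _ X]addnC. Qed.

Section PowerSums.
Variables (k : nat) (ls : seq (seq Z)).
Hypothesis size_ls : size ls = k.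
Let l (i : 'I_k) : 'I_3 -> C := pvec C (nth [::] ls i).

Lemma kernel_cubicP N : kernel_cubic ls N -> cubic_row N *m cat33 (powsum l) = 0.
Proof.
move=> /allP kerN; apply/rowP => j; rewrite [RHS]mxE.
rewrite (cubic_row_mul N (F := fun u => powsum l (madd u (enum_val j)))); last by move=> i; rewrite mxE.
rewrite /powsum dsum_sum big1 // => i _.
transitivity (mono3 (l i) (enum_val j) * dsum 3 N (tmon 3 (l i))).
  by rewrite -dsumZ; apply: eq_dsum => e eM; rewrite pow6_madd tmon_mono3 // mulrC.
have e : zsum 3 N (zmon 3 (nth [::] ls i)) = 0 by apply/eqP/kerN; rewrite mem_nth ?size_ls.
have <- : zr (zsum 3 N (zmon 3 (nth [::] ls i))) = dsum 3 N (tmon 3 (l i)).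
  by rewrite zr_zsum; apply: eq_dsum => f _; rewrite zr_zmon.
by rewrite e rmorph0 mulr0.
Qed.

Lemma cat33_conormal sel N N' : cat_check k ls sel -> kernel_cubic ls N -> kernel_cubic ls N' ->
  exists E F, forall w, exists y,
    mmap (@polyC C) (fun i => (coords (powsum l) i)%:P + 'X * (w i)%:P)
      (pencil_minor (pencil_of (@cat33 R)) (E : 'M_(k + 1, _)) F) = 'X * y /\
    y.[0] = pairing (zmul 3 3 N N') (fun m => w (enum_rank m)).
Proof.
move=> chk kN kN'.
have [||E [F EF]] := pencil_of_conormal (u := cubic_row N) (v := (cubic_row N')^T)
  (@s6linear_cat33 R) (rank_cat_check size_ls chk).
- exact: kernel_cubicP.
- by rewrite -[X in X *m _]cat33_sym -trmx_mul kernel_cubicP // trmx0.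
exists E, F => w; have [y [e y0]] := EF w; exists y; split; first exact: e.
by rewrite y0 cubic_row_cat33.
Qed.

Lemma redmx_powsum ts : redmx ts (powsum l) = zmx (size ts) (size ts) (zredmx ls ts) :> 'M[C]_(size ts).
Proof.
apply/matrixP => i j; rewrite !mxE /zent.
rewrite (nth_map ([::], [::], [::])) // (nth_map ([::], [::], [::])) // /sum_squares lsumE.
rewrite !(tnth_nth ([::], [::], [::])) /=.
set t := nth _ ts i; set t' := nth _ ts j.
rewrite [LHS]dsum_sum rmorph_sum.
transitivity (\sum_(x <- ls) pairing (zsextic t t') (pow6 (pvec C x))).
  exact: (powsum_list size_ls (fun x => pairing (zsextic t t') (pow6 x))).
apply: eq_bigr => x _; rewrite pairing_pow6 (eval_zmul 3 3) -expr2.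
rewrite -[RHS]/(zr (_ ^+ 2)) rmorphXn /= zr_zsum; congr (_ ^+ 2).
by apply: eq_dsum => f _; rewrite zr_zmon.
Qed.

Lemma pieri_conormal ts u : pieri_check k ls ts u ->
  exists E F, forall w, exists y,
    mmap (@polyC C) (fun i => (coords (powsum l) i)%:P + 'X * (w i)%:P)
      (pencil_minor (pencil_of (redmx (R := R) ts)) (E : 'M_(3 * k + 1, _)) F) = 'X * y /\
    y.[0] = pairing (zquad ts u) (fun m => w (enum_rank m)).
Proof.
case/and3P => k_n chk /andP [/allP ul /allP ur].
pose v : 'rV[C]_(size ts) := \row_i zr (nth 0 u i).
have in_iota (i : 'I_(size ts)) : (i : nat) \in iota 0 (size ts) by rewrite mem_iota /=.
have rk : (3 * k <= \rank (redmx ts (powsum l)))%N.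
  apply: leq_trans (mxrank_submatrix (redmx ts (powsum l)) (widen_ord k_n) (widen_ord k_n)).
  rewrite (_ : (\matrix_(i, j) _) = zmx (3 * k) (3 * k) (zredmx ls ts)) ?mxrank_unit ?zmx_unit //.
  by apply/matrixP => i j; rewrite redmx_powsum !mxE.
have vM : v *m redmx ts (powsum l) = 0.
  apply/rowP => j; rewrite redmx_powsum !mxE.
  rewrite -[RHS](rmorph0 (@zr C)) -(eqP (ul _ (in_iota j))) lsumE rmorph_sum.
  rewrite -/(index_iota 0 (size ts)) -[X in iota 0 X]subn0 big_mkord.
  by apply: eq_bigr => i _; rewrite !mxE rmorphM.
have Mv : redmx ts (powsum l) *m v^T = 0.
  apply/colP => j; rewrite redmx_powsum !mxE.
  rewrite -[RHS](rmorph0 (@zr C)) -(eqP (ur _ (in_iota j))) lsumE rmorph_sum.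
  rewrite -/(index_iota 0 (size ts)) -[X in iota 0 X]subn0 big_mkord.
  by apply: eq_bigr => i _; rewrite !mxE rmorphM.
have [E [F EF]] := pencil_of_conormal (@s6linear_redmx R ts) rk vM Mv.
exists E, F => w; have [y [e y0]] := EF w; exists y; split; first exact: e.
rewrite y0 /zquad; set b := fun m => w (enum_rank m).
set s := (X in zcomb X).
have [|_ ->] := @zcombP s b.
  by apply/allP => _ /allpairsPdep [i [j [_ _ ->]]]; apply/eqP; exact: (size_zmul 3 3).
rewrite big_allpairs_dep mxE.
rewrite -/(index_iota 0 (size ts)) -[X in iota 0 X]subn0 big_mkord.
under [RHS]eq_bigr => i _ do rewrite big_mkord.
rewrite exchange_big; apply: eq_bigr => j _; rewrite mxE mulr_suml; apply: eq_bigr => i _.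
by rewrite !mxE !(tnth_nth ([::], [::], [::])) /= rmorphM -!mulrA; congr (_ * _); rewrite mulrC.
Qed.

End PowerSums.
End Certificates.

(** The Pieri direction comes first, hence the count [(size prs).+1]: 6 + 1 for k = 7 and 3 + 1 for
    k = 8. *)
Definition conormal_forms (cubs : seq (seq Z)) (prs : seq (nat * nat)) ts u : seq (seq Z) :=
  zquad ts u :: [seq zmul 3 3 (nth [::] cubs p.1) (nth [::] cubs p.2) | p <- prs].

Definition component_check k ls sel cubs prs ts u : bool :=
  [&& cat_check k ls sel, all (kernel_cubic ls) cubs,
      all (fun p => (p.1 < size cubs) && (p.2 < size cubs))%N prs, pieri_check k ls ts u,
      ((k + (k + k)) + (size prs).+1 == size (monl 6))%N &
      conormal_check k (size prs).+1 ls (conormal_forms cubs prs ts u)].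

Section Components.
Variable R : realType.
Local Notation C := (R[i]).

Theorem secant_component k ls sel cubs prs ts u : component_check k ls sel cubs prs ts u ->
  irr_component (@secant R k) (fun a => (\rank (cat33 a) <= k)%N /\ pieri_rank_le a (3 * k)).
Proof.
case/and5P => catc /allP kerc /allP prsc pieric /andP [/eqP dim conc].
have size_ls : size ls = k by case/and4P: catc => /eqP.
pose l (i : 'I_k) : 'I_3 -> C := pvec C (nth [::] ls i).
set Qs := conormal_forms cubs prs ts u in conc *.
set X := fun a => _.
have inX : subS (@secant R k) X.
  by move=> a Sa; split; [apply: rank_cat33_secant | apply: pieri_rank_secant].
have size_Qs : size Qs = (size prs).+1 by rewrite /= size_map.
have /choice [g gP] : forall j : 'I_(size prs).+1, exists g : {mpoly C[N6]},
    vanish g X /\ forall w, exists y,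
     mmap (@polyC C) (fun i => (coords (powsum l) i)%:P + 'X * (w i)%:P) g = 'X * y /\
     y.[0] = pairing (nth [::] Qs j) (fun m => w (enum_rank m)).
  move=> j; have : nth [::] Qs j \in Qs by rewrite mem_nth // size_Qs.
  rewrite {1}/Qs /conormal_forms inE => /orP [/eqP ->|/mapP [p pP ->]].
    have [E [F EF]] := pieri_conormal R size_ls pieric.
    exists (pencil_minor (pencil_of (redmx (R := R) ts)) E F); split; last exact: EF.
    move=> a [_ /rank_redmx ra]; apply: pencil_minor_eq0; rewrite addn1 ltnS.
    by rewrite -(pencil_ofE _ (s6linear_redmx ts)).
  have /andP [p1 p2] := prsc _ pP.
  have [E [F EF]] := cat33_conormal R size_ls catc (kerc _ (mem_nth [::] p1)) (kerc _ (mem_nth [::] p2)).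
  exists (pencil_minor (pencil_of (@cat33 R)) E F); split; last exact: EF.
  move=> a [ra _]; apply: pencil_minor_eq0; rewrite addn1 ltnS.
  by rewrite -(pencil_ofE _ (@s6linear_cat33 R)).
apply: (@irr_component_local R (@powsums R k) X (powsum l)) => //.
- exact: irreducible_secant.
- by apply: sub_zclosure; exists l.
move=> P vP.
have vg j : vanish (g j) (@powsums R k).
  by move=> a Sa; apply: (gP j).1; apply: inX; apply: sub_zclosure.
have [s [h [sp e]]] := secant_conormal_certificate dim conc (fun j => (gP j).2) vg vP.
exists s; split=> // a Xa; rewrite e meval_sum big1 // => j _.
by rewrite mevalM (gP j).1 // mulr0.
Qed.

End Components.
Local Open Scope Z_scope.
(* [cubics] spans the cubics through the points, [minor] indexes an invertible block of
   phi_{3,3}, and [kernel] spans the kernel of the compression of phi_{42,42} to [triples]. *)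
Definition points7 : seq (seq Z) :=
  [:: [:: 1; 0; 0]; [:: 0; 1; 0]; [:: 0; 0; 1]; [:: 1; 1; 1]; [:: 2; -1; 1]; [:: 1; -1; 2];
      [:: 1; -1; 0]].
Definition minor7 : seq (nat * nat) :=
  [:: (0, 0); (0, 1); (0, 2); (0, 3); (1, 0); (1, 2); (3, 0)]%N.
Definition cubics7 : seq (seq Z) :=
  [:: [:: 0; 1; -7; 0; 5; 1; 0; 0; 0; 0]; [:: 0; -3; 11; 0; -9; 0; 0; 1; 0; 0];
      [:: 0; 2; -12; 0; 8; 0; 1; 0; 1; 0]].
Definition products7 : seq (nat * nat) := [:: (0, 0); (0, 1); (0, 2); (1, 1); (1, 2); (2, 2)]%N.
(** There are 22 = 3 * 7 + 1 triples, ordered so that the first 21 index an invertible block. *)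
Definition triples7 : seq triple :=
  [:: ([:: 0; 1; 1], [:: -1; 0; 1], [:: 1; 0; 0]);
   ([:: 0; 0; 1], [:: 0; -1; 0], [:: 1; 0; -1]);
   ([:: 0; 0; 1], [:: 1; 0; 0], [:: 0; 0; 1]);
   ([:: 0; 1; 0], [:: -1; 0; 1], [:: 1; -1; 1]);
   ([:: 0; 0; 1], [:: 1; -1; 0], [:: 0; 1; 0]);
   ([:: 0; 0; 1], [:: 0; -1; 0], [:: 1; -1; 0]);
   ([:: 0; 1; -1], [:: 1; 0; 1], [:: 1; 0; 1]);
   ([:: 0; 0; 1], [:: 1; -1; 0], [:: 0; 1; 1]);
   ([:: 0; 1; -1], [:: -1; 0; 0], [:: 1; 0; 0]);
   ([:: 0; 1; 0], [:: -1; 0; 1], [:: 1; 1; -1]);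
   ([:: 0; 0; 1], [:: 1; 0; 0], [:: 1; 0; 1]);
   ([:: 0; 1; 0], [:: -1; 0; 0], [:: 1; 1; 1]);
   ([:: 0; 1; 1], [:: -1; 0; 1], [:: 1; -1; 0]);
   ([:: 0; 1; 1], [:: 1; 0; 1], [:: 1; 0; -1]);
   ([:: 0; 1; 0], [:: -1; 0; 0], [:: 1; 0; -1]);
   ([:: 0; 1; 0], [:: 1; 0; 1], [:: 1; 1; 0]);
   ([:: 0; 1; 0], [:: -1; 0; 0], [:: 0; 1; -1]);
   ([:: 0; 1; -1], [:: 1; 0; 1], [:: 1; 1; -1]);
   ([:: 0; 1; 0], [:: 1; 0; 1], [:: 1; 0; 0]);
   ([:: 0; 1; 1], [:: -1; 0; 1], [:: 1; 0; -1]);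
   ([:: 0; 0; 1], [:: -1; -1; 0], [:: 1; 1; 0]);
   ([:: 0; 1; 1], [:: 1; 0; 0], [:: 1; 0; -1])].
Definition kernel7 : seq Z :=
  [:: 3848; 15280; -2000; 7648; 1420; -9056; 288; 544; -2064; -1664; -2080; 3936; 3024; -560;
     12616; 264; -13720; 370; -9328; -2032; -545; 1336].
Definition points8 : seq (seq Z) :=
  [:: [:: 1; 0; 0]; [:: 0; 1; 0]; [:: 0; 0; 1]; [:: 1; 1; 1]; [:: 0; 2; 2]; [:: 2; 1; 0];
      [:: 2; 0; 1]; [:: 2; 1; -1]].
Definition minor8 : seq (nat * nat) :=
  [:: (0, 0); (0, 1); (0, 2); (0, 3); (1, 0); (1, 1); (1, 2); (3, 0)]%N.
Definition cubics8 : seq (seq Z) :=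
  [:: [:: 0; 5; -5; 0; -2; 1; 0; 1; 0; 0]; [:: 0; 1; -1; 0; 0; 1; -2; 0; 1; 0]].
Definition products8 : seq (nat * nat) := [:: (0, 0); (0, 1); (1, 1)]%N.
(** There are 25 = 3 * 8 + 1 triples, with an invertible block on the first 24. *)
Definition triples8 : seq triple :=
  [:: ([:: 0; 1; -1], [:: 1; 0; 1], [:: 0; 1; -1]);
   ([:: 0; 1; 1], [:: 1; 0; 1], [:: 1; 0; -1]);
   ([:: 0; 1; -1], [:: -1; 0; 0], [:: 1; -1; 0]);
   ([:: 0; 1; 0], [:: 1; 0; 1], [:: 0; 0; 1]);
   ([:: 0; 1; 1], [:: -1; 0; 1], [:: 0; 0; 1]);
   ([:: 0; 1; -1], [:: -1; 0; 0], [:: 1; 0; 0]);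
   ([:: 0; 1; -1], [:: -1; 0; 1], [:: 1; 0; 0]);
   ([:: 0; 1; -1], [:: 1; 0; 1], [:: 0; 1; 1]);
   ([:: 0; 1; -1], [:: 1; 0; 1], [:: 0; 0; 1]);
   ([:: 0; 1; 0], [:: -1; 0; 1], [:: 1; 0; 0]);
   ([:: 0; 0; 1], [:: 1; -1; 0], [:: 0; 0; 1]);
   ([:: 0; 1; 1], [:: -1; 0; 1], [:: 1; 1; 0]);
   ([:: 0; 0; 1], [:: 1; 0; 0], [:: 1; -1; 0]);
   ([:: 0; 1; 1], [:: 1; 0; 0], [:: 1; -1; 1]);
   ([:: 0; 1; 1], [:: -1; 0; 1], [:: 0; 1; 1]);
   ([:: 0; 1; 1], [:: 1; 0; 1], [:: 0; 0; 1]);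
   ([:: 0; 1; -1], [:: -1; 0; 1], [:: 0; 1; 0]);
   ([:: 0; 0; 1], [:: 0; -1; 0], [:: 0; 1; -1]);
   ([:: 0; 1; 0], [:: -1; 0; 1], [:: 0; 1; -1]);
   ([:: 0; 1; -1], [:: -1; 0; 0], [:: 1; -1; 1]);
   ([:: 0; 0; 1], [:: 1; -1; 0], [:: 1; -1; -1]);
   ([:: 0; 0; 1], [:: 0; -1; 0], [:: 1; 0; 1]);
   ([:: 0; 0; 1], [:: -1; -1; 0], [:: 0; 1; 1]);
   ([:: 0; 1; 0], [:: 1; 0; 1], [:: 1; 1; 0]);
   ([:: 0; 0; 1], [:: -1; -1; 0], [:: 1; 0; 0])].
Definition kernel8 : seq Z :=
  [:: 12; -60; 240; 1008; 102; 330; 582; -1086; -372; -1080; 159; 34; -516; -96; -28; -132; -684;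
     -228; 78; 150; 27; 516; 150; 258; 762].
Local Close Scope Z_scope.

Lemma component_check7 : component_check 7 points7 minor7 cubics7 products7 triples7 kernel7.
Proof. by vm_compute. Qed.

Lemma component_check8 : component_check 8 points8 minor8 cubics8 products8 triples8 kernel8.
Proof. by vm_compute. Qed.

(** * Primality of the catalecticant determinant *)

Section LinearPrime.
Variables (K : numFieldType) (n : nat).
Implicit Types (D N P Q f : {mpoly K[n]}) (i : 'I_n).

Definition mdivides f P := exists Q, P = Q * f.
Definition mprime f := forall P Q, mdivides f (P * Q) -> mdivides f P \/ mdivides f Q.
(** Expressed by values rather than supports: stable under ring operations by rewriting, and ready
    for specialising X_i. *)
Definition free_of i P := forall v w : 'I_n -> K, (forall j, j != i -> v j = w j) -> P.@[v] = P.@[w].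

(** Modulo f = X_i D + N, the product D X_i is -N, free of X_i; the property passes to sums and
    products, the exponents of D adding up. *)
Lemma pseudo_division i D N P : free_of i D -> free_of i N ->
  exists e Q R, D ^+ e * P = Q * ('X_i * D + N) + R /\ free_of i R.
Proof.
move=> fD fN; set f := _ + N.
have closedD P1 P2 : (exists e Q R, D ^+ e * P1 = Q * f + R /\ free_of i R) ->
    (exists e Q R, D ^+ e * P2 = Q * f + R /\ free_of i R) ->
    exists e Q R, D ^+ e * (P1 + P2) = Q * f + R /\ free_of i R.
  move=> [e1 [Q1 [R1 [h1 f1]]]] [e2 [Q2 [R2 [h2 f2]]]].
  exists (e1 + e2)%N, (D ^+ e2 * Q1 + D ^+ e1 * Q2), (D ^+ e2 * R1 + D ^+ e1 * R2); split.
    rewrite exprD mulrDr -{1}mulrA mulrCA h1 -mulrA h2; ring.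
  by move=> v w vw; rewrite !(mevalD, mevalM, rmorphXn) /= (fD v w) // (f1 v w) // (f2 v w).
have closedM P1 P2 : (exists e Q R, D ^+ e * P1 = Q * f + R /\ free_of i R) ->
    (exists e Q R, D ^+ e * P2 = Q * f + R /\ free_of i R) ->
    exists e Q R, D ^+ e * (P1 * P2) = Q * f + R /\ free_of i R.
  move=> [e1 [Q1 [R1 [h1 f1]]]] [e2 [Q2 [R2 [h2 f2]]]].
  exists (e1 + e2)%N, (Q1 * Q2 * f + Q1 * R2 + Q2 * R1), (R1 * R2); split.
    rewrite exprD mulrACA h1 h2; ring.
  by move=> v w vw; rewrite !mevalM (f1 v w) // (f2 v w).
have closedC c : exists e Q R, D ^+ e * c%:MP = Q * f + R /\ free_of i R.
  by exists 0%N, 0, c%:MP; split=> [|v w _]; rewrite ?mevalC // mul0r add0r expr0 mul1r.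
rewrite (mpolyE P); elim/big_ind: _ => [||m _]; first by rewrite -mpolyC0.
  exact: (closedD).
rewrite -mul_mpolyC; apply: (closedM) => //; rewrite mpolyXE_id.
elim/big_ind: _ => [||j _]; first by rewrite -mpolyC1.
  exact: (closedM).
elim: (m j) => [|e IH]; first by rewrite expr0 -mpolyC1.
rewrite exprS; apply: (closedM) => //.
have [->|ji] := eqVneq j i.
  exists 1%N, 1, (- N); split=> [|v w vw]; last by rewrite !mevalN (fN v w).
  by rewrite /f mul1r addrK mulrC.
exists 0%N, 0, 'X_j; split=> [|v w vw]; last by rewrite !mevalXU vw.
by rewrite mul0r add0r expr0 mul1r.
Qed.

(** Where D(v) is nonzero, moving the i-th coordinate to -N(v)/D(v) kills the divisor, hence R,
    without changing R(v). So R D vanishes everywhere. *)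
Lemma free_multiple_eq0 i D N R : D != 0 -> free_of i D -> free_of i N -> free_of i R ->
  mdivides ('X_i * D + N) R -> R = 0.
Proof.
move=> D0 fD fN fR [Q e]; suff /eqP : R * D = 0 by rewrite mulf_eq0 (negPf D0) orbF => /eqP.
apply: mpoly_eq0_meval => v; rewrite mevalM.
have [->|Dv] := eqVneq D.@[v] 0; first by rewrite mulr0.
pose w j := if j == i then - N.@[v] / D.@[v] else v j.
have vw j : j != i -> v j = w j by rewrite /w => /negPf ->.
rewrite (fR v w vw) e mevalM mevalD mevalM mevalXU -(fD v w vw) -(fN v w vw).
by rewrite /w eqxx divfK // addNr mulr0 mul0r.
Qed.

(* Modulo f, a power of D makes every polynomial free of X_i, and f divides no
   nonzero polynomial free of X_i. *)
Lemma mprime_linear i D N : D != 0 -> free_of i D -> free_of i N ->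
  (forall P, mdivides ('X_i * D + N) (D * P) -> mdivides ('X_i * D + N) P) ->
  mprime ('X_i * D + N).
Proof.
move=> D0 fD fN; set f := _ + N => cancelD.
have cancelDe e P : mdivides f (D ^+ e * P) -> mdivides f P.
  by elim: e => [|e IH]; rewrite ?expr0 ?mul1r // exprS -mulrA => /cancelD.
move=> P Q [T eT].
have [e1 [Q1 [R1 [h1 f1]]]] := pseudo_division P fD fN.
have [e2 [Q2 [R2 [h2 f2]]]] := pseudo_division Q fD fN.
rewrite -/f in h1 h2.
have /eqP : R1 * R2 = 0.
  apply: (@free_multiple_eq0 i D N) => //.
    by move=> v w vw; rewrite !mevalM (f1 v w) // (f2 v w).
  exists (D ^+ e1 * D ^+ e2 * T - Q1 * Q2 * f - Q1 * R2 - Q2 * R1); rewrite -/f.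
  transitivity ((D ^+ e1 * P - Q1 * f) * (D ^+ e2 * Q - Q2 * f)); first by rewrite h1 h2; ring.
  transitivity (D ^+ e1 * D ^+ e2 * (P * Q) - Q1 * f * (D ^+ e2 * Q) - D ^+ e1 * P * (Q2 * f)
     + Q1 * Q2 * f * f); first by ring.
  rewrite eT h1 h2; ring.
rewrite mulf_eq0 => /orP [] /eqP r0; [left; apply: (cancelDe e1) | right; apply: (cancelDe e2)].
  by exists Q1; rewrite h1 r0 addr0.
by exists Q2; rewrite h2 r0 addr0.
Qed.

(** Only the cancellation of D is left: if D P = Q f, then D divides Q and can be cancelled, or D
    divides f and therefore N. *)
Lemma mprime_extend i D N : D != 0 -> free_of i D -> free_of i N -> mprime D -> ~ mdivides D N ->
  mprime ('X_i * D + N).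
Proof.
move=> D0 fD fN primeD DN; apply: mprime_linear => // P [Q e].
have [|[Q' eQ]|[Q' eQ]] := primeD Q ('X_i * D + N).
- by exists P; rewrite -e mulrC.
- by exists Q'; apply: (mulfI D0); rewrite e eQ; ring.
- by case: DN; exists (Q' - 'X_i); rewrite mulrBl -eQ addrC addKr.
Qed.

Lemma mprime_var i : mprime ('X_i : {mpoly K[n]}).
Proof.
have fC c : free_of i c%:MP by move=> v w _; rewrite !mevalC.
have := @mprime_linear i 1 0 (oner_neq0 _) (fC 1) (fC 0).
by rewrite mulr1 addr0; apply=> P; rewrite mul1r.
Qed.

End LinearPrime.

Lemma det_last_entry (S : comNzRingType) k (A B : 'M[S]_k.+1) :
  (forall i j, (i != ord_max) || (j != ord_max) -> A i j = B i j) -> B ord_max ord_max = 0 ->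
  \det A = A ord_max ord_max * \det (\matrix_(i, j) A (lift ord_max i) (lift ord_max j)) + \det B.
Proof.
move=> AB B0; rewrite (expand_det_row A ord_max) (expand_det_row B ord_max).
rewrite (bigD1 ord_max) //= [in RHS](bigD1 ord_max) //= B0 mul0r add0r; congr (_ * _ + _).
  rewrite /cofactor addnn -signr_odd odd_double expr0 mul1r; congr (\det _).
  by apply/matrixP => i j; rewrite !mxE.
apply: eq_bigr => j nj; rewrite AB ?nj ?orbT //; congr (_ * _).
rewrite /cofactor; congr (_ * \det _); apply/matrixP => a b; rewrite !mxE AB //.
by rewrite eq_sym neq_lift.
Qed.

Lemma det_reindex (S : comNzRingType) m n (f : 'I_m -> 'I_n) (A : 'M[S]_n) : bijective f ->
  \det (\matrix_(i, j) A (f i) (f j)) = \det A.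
Proof.
move=> bijf; have mn : m = n by have := bij_eq_card bijf; rewrite !card_ord.
case: n / mn f A bijf => f A bijf; pose s := perm (bij_inj bijf).
have -> : \matrix_(i, j) A (f i) (f j) = row_perm s (col_perm s A).
  by apply/matrixP => i j; rewrite !mxE !permE.
by rewrite row_permE col_permE !det_mulmx !det_perm odd_permV mulrCA -signr_addb addbb mulr1.
Qed.

(** The diagonal variable 2 m_k recurs in its leading block only if m_k is the midpoint of two
    earlier exponents. The order runs from the centre of the triangle of exponents to its vertices,
    so midpoints come before at least one end. *)
Definition cubic_order : seq (nat * nat) :=
  [:: (1, 1); (2, 1); (2, 0); (1, 2); (0, 2); (1, 0); (0, 1); (3, 0); (0, 3); (0, 0)]%N.
Definition zcat_entry (i j : nat) : nat * nat :=
  eadd (nth (0, 0)%N cubic_order i) (nth (0, 0)%N cubic_order j).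

(* A 0/1 point, given by its support, at which row z of the k-th leading block vanishes
   while the (k+1)-st minor with its last entry cleared does not. *)
Definition leading_check k (supp : seq (nat * nat)) (z : nat) : bool :=
  [&& (z < k)%N, all (fun j => zcat_entry z j \notin supp) (iota 0 k),
      all (fun i => all (fun j => (i == k) && (j == k) || (zcat_entry i j != zcat_entry k k))
        (iota 0 k.+1)) (iota 0 k.+1) &
      zunit_check k.+1 [seq [seq if (i == k) && (j == k) then 0 else (zcat_entry i j \in supp)%:R
        | j <- iota 0 k.+1] | i <- iota 0 k.+1]].

(** Entry k - 1 serves the passage from k to k + 1: the support of the point, then the vanishing
    row. *)
Definition leading_points : seq (seq (nat * nat) * nat) :=
  [:: ([:: (3, 2)], 0); ([:: (2, 2); (4, 1)], 1); ([:: (3, 2)], 2); ([:: (2, 3); (4, 0)], 1);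
      ([:: (1, 2); (3, 2)], 4); ([:: (1, 2); (2, 2); (3, 0)], 1); ([:: (1, 1); (1, 4); (4, 1)], 0);
      ([:: (0, 2); (1, 1); (2, 3); (6, 0)], 2); ([:: (0, 3); (2, 1); (3, 2); (4, 2)], 8)]%N.

Lemma leading_checks :
  all (fun k => let t := nth ([::], 0%N) leading_points k.-1 in leading_check k t.1 t.2) (iota 1 9).
Proof. by vm_compute. Qed.

Section CatalecticantDeterminant.
Variable R : realType.
Local Notation C := (R[i]).
Local Notation poly6 := {mpoly C[N6]}.

Definition catvar (i j : nat) : 'I_N6 := enum_rank (mk6 (zcat_entry i j)).
Definition leading k : 'M[poly6]_k := \matrix_(i, j) 'X_(catvar i j).
Definition leading0 k : 'M[poly6]_k.+1 :=
  \matrix_(i, j) if (i == k :> nat) && (j == k :> nat) then 0 else 'X_(catvar i j).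

Lemma det_leadingS k : \det (leading k.+1) = 'X_(catvar k k) * \det (leading k) + \det (leading0 k).
Proof.
have max_eq (i : 'I_k.+1) : (i == ord_max) = (i == k :> nat) by [].
rewrite (det_last_entry (B := leading0 k)) => [|i j nm|]; last by rewrite mxE eqxx.
  rewrite [leading k.+1 _ _]mxE.
  rewrite (_ : \matrix_(i, j) _ = leading k) //; apply/matrixP => i j.
  by rewrite [LHS]mxE [RHS]mxE [LHS]mxE (lift_max i) (lift_max j).
by rewrite !mxE -!max_eq -if_neg negb_and nm.
Qed.

Lemma meval_det n (M : 'M[poly6]_n) v : (\det M).@[v] = \det (map_mx (meval v) M).
Proof. by rewrite -det_map_mx. Qed.

Lemma cubic_order_le3 k : (k < 10)%N -> nth (0, 0)%N cubic_order k \in monl 3.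
Proof. by move=> lt_k; rewrite mem_monl; move: k lt_k; do 10!case=> //. Qed.

Lemma catvar_le6 i j : (i < 10)%N -> (j < 10)%N -> zcat_entry i j \in monl 6.
Proof.
move=> /cubic_order_le3 + /cubic_order_le3; rewrite !mem_monl /zcat_entry /=; lia.
Qed.

Lemma zcat_entry_inj i j i' j' : (i < 10)%N -> (j < 10)%N -> (i' < 10)%N -> (j' < 10)%N ->
  (catvar i j == catvar i' j') = (zcat_entry i j == zcat_entry i' j').
Proof.
move=> hi hj hi' hj'; apply/eqP/eqP => [/enum_rank_inj|e]; last by rewrite /catvar e.
by apply: mk_mon_inj; apply: catvar_le6.
Qed.

Definition supp_point (supp : seq (nat * nat)) (i : 'I_N6) : C :=
  (((val (enum_val i)).1 : nat, (val (enum_val i)).2 : nat) \in supp)%:R.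

Lemma supp_pointE supp i j : (i < 10)%N -> (j < 10)%N ->
  supp_point supp (catvar i j) = (zcat_entry i j \in supp)%:R.
Proof.
move=> hi hj; have := catvar_le6 hi hj; rewrite mem_monl => h.
rewrite /supp_point /catvar enum_rankK !(val_mk_mon h); by case: (zcat_entry i j).
Qed.

Lemma mprime_leading k supp z : (0 < k < 10)%N -> leading_check k supp z ->
  \det (leading k) != 0 -> mprime (\det (leading k)) ->
  \det (leading k.+1) != 0 /\ mprime (\det (leading k.+1)).
Proof.
case/andP => k0 k10 /and4P [zk /allP zrow /allP fresh chk] D0 Dp.
have DN : ~ mdivides (\det (leading k)) (\det (leading0 k)).
  move=> [Q /(congr1 (meval (supp_point supp)))]; rewrite mevalM !meval_det.
  set Dk := map_mx _ (leading k).
  have -> : \det Dk = 0.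
    rewrite (expand_det_row _ (Ordinal zk)) big1 // => j _; rewrite !mxE mevalXU supp_pointE.
    - by rewrite (negPf (zrow _ _)) ?mul0r // mem_iota ltn_ord.
    - exact: ltn_trans zk k10.
    - exact: ltn_trans (ltn_ord j) k10.
  rewrite mulr0 => e; suff : \det (map_mx (meval (supp_point supp)) (leading0 k)) != 0.
    by rewrite e eqxx.
  rewrite -unitfE -unitmxE.
  move: chk; set A0 := (X in zunit_check _ X) => chk.
  rewrite (_ : map_mx _ _ = zmx k.+1 k.+1 A0) ?zmx_unit //.
  apply/matrixP => i j; rewrite !mxE /zent /A0.
  rewrite (nth_map 0%N) ?size_iota // (nth_map 0%N) ?size_iota // !nth_iota // !add0n.
  case: ifP => _; first by rewrite meval0 rmorph0.
  by rewrite mevalXU supp_pointE ?rmorph_nat // (leq_trans (ltn_ord _)).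
have free_var i j : (i <= k)%N -> (j <= k)%N -> ~~ ((i == k) && (j == k)) ->
    free_of (catvar k k) ('X_(catvar i j) : poly6).
  move=> ik jk nk v w vw; rewrite !mevalXU vw //.
  have lt10 m : (m <= k)%N -> (m < 10)%N by move/leq_ltn_trans; apply.
  rewrite zcat_entry_inj ?lt10 //.
  have := fresh i; rewrite mem_iota add0n ltnS ik => /(_ isT) /allP /(_ j).
  by rewrite mem_iota add0n ltnS jk (negPf nk) => /(_ isT).
have freeD : free_of (catvar k k) (\det (leading k)).
  move=> v w vw; rewrite !meval_det; congr (\det _); apply/matrixP => i j; rewrite !mxE.
  by apply: free_var => //; rewrite ?(ltnW (ltn_ord _)) // ltn_eqF.
have freeN : free_of (catvar k k) (\det (leading0 k)).
  move=> v w vw; rewrite !meval_det; congr (\det _); apply/matrixP => i j; rewrite !mxE.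
  case: ifP => [_|/negbT nk]; first by rewrite !meval0.
  by apply: free_var => //; rewrite -ltnS.
rewrite det_leadingS; split; last exact: mprime_extend.
(* If the new minor X D + N were zero, D would divide N. *)
apply/eqP => e; apply: DN; exists (- 'X_(catvar k k)).
by apply/eqP; rewrite mulNr -addr_eq0 addrC e.
Qed.

Lemma mprime_leading10 : \det (leading 10) != 0 /\ mprime (\det (leading 10)).
Proof.
have step k : (0 < k <= 10)%N -> \det (leading k) != 0 /\ mprime (\det (leading k)).
  elim: k => // -[_ _|k IH /andP [_ k10]].
    rewrite det_leadingS det_mx00 mulr1.
    rewrite (_ : \det (leading0 0) = 0) ?addr0; last by rewrite det_mx11 mxE.
    split; last exact: mprime_var.
    apply/eqP => /(congr1 (meval (fun=> 1))); rewrite mevalXU meval0 => /eqP.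
    by rewrite oner_eq0.
  have [|D0 Dp] := IH; first by apply/andP; split; last exact: ltnW.
  have /allP /(_ k.+1) := leading_checks; rewrite mem_iota ltnS k10 => /(_ isT) chk.
  exact: (mprime_leading _ chk).
exact: step.
Qed.

Lemma card_mon3 : #|{: mon 3}| = 10%N.
Proof. by rewrite -sum1_card (sum_mon (fun _ => 1%N)) sum1_card card_ord. Qed.

Lemma catdet_leading : catdet R = \det (leading 10).
Proof.
pose f (i : 'I_10) : 'I_#|{: mon 3}| := enum_rank (mk3 (nth (0, 0)%N cubic_order i)).
have le3 (i : 'I_10) : nth (0, 0)%N cubic_order i \in monl 3 by apply: cubic_order_le3.
have injf : injective f.
  move=> i j /enum_rank_inj /(mk_mon_inj (le3 i) (le3 j)) /eqP.
  by rewrite nth_uniq // => /eqP /val_inj.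
have bijf : bijective f by apply: inj_card_bij; rewrite // !card_ord card_mon3.
rewrite /catdet -(det_reindex _ bijf); congr (\det _); apply/matrixP => i j; rewrite !mxE.
by rewrite !enum_rankK madd_mk3.
Qed.

Lemma dhomog_prod_vars n (h : 'I_n -> 'I_N6) : \prod_i ('X_(h i) : poly6) \is n.-homog.
Proof.
elim: n h => [|n IH] h; first by rewrite big_ord0 dhomog1.
rewrite big_ord_recl -[n.+1]/(1 + n)%N; apply: dhomogM => //.
by rewrite dhomogX /= mdeg1.
Qed.

(** [msize] is the degree plus one. *)
Lemma msize_catdet : msize (catdet R) = 11%N.
Proof.
have [nz _] := mprime_leading10; rewrite catdet_leading.
have hom : \det (leading 10) \is 10.-homog.
  apply: rpred_sum => s _; rewrite mulr_sign; case: ifP => _; rewrite ?rpredN.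
    under eq_bigr => i _ do rewrite mxE; exact: dhomog_prod_vars.
  under eq_bigr => i _ do rewrite mxE; exact: dhomog_prod_vars.
by rewrite -mlead_deg // (dhomog_mf hom) // mlead_supp.
Qed.

End CatalecticantDeterminant.

(** * The hypersurface for k = 9 *)

Local Open Scope Z_scope.
Definition points9 : seq (seq Z) :=
  [:: [:: 1; 0; 0]; [:: 0; 1; 0]; [:: 0; 0; 1]; [:: 1; 1; 1]; [:: 2; -2; -1]; [:: 2; -1; -1];
      [:: 1; -1; -2]; [:: 1; 1; -1]; [:: 0; 1; -1]].
Definition cubic9 : seq Z := [:: 0; -1; -1; 0; -5; 5; 1; -4; 5; 0].
Local Close Scope Z_scope.
Definition minor9 : seq (nat * nat) :=
  [:: (0, 0); (0, 1); (0, 2); (0, 3); (1, 0); (1, 1); (1, 2); (2, 0); (3, 0)]%N.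

(** Here 28 - 27 = 1: the square of the cubic through the nine points spans the conormal line. *)
Lemma hypersurface_check9 : [&& cat_check 9 points9 minor9, kernel_cubic points9 cubic9 &
  conormal_check 9 1 points9 [:: zmul 3 3 cubic9 cubic9]].
Proof. by vm_compute. Qed.

(** The size equation is a hypothesis because the number of cubic monomials equals 10 only
    propositionally. *)
Lemma pencil_minor_square (K : numFieldType) n a r (M : 'I_n -> 'M[K]_a)
    (E : 'M_(r, a)) (F : 'M_(a, r)) :
  a = r -> exists c, pencil_minor M E F = c * \det (pencil_mpoly M).
Proof.
move=> ar; case: r / ar E F => E F.
exists (\det (map_mx (@mpolyC n K) E) * \det (map_mx (@mpolyC n K) F)).
by rewrite /pencil_minor !det_mulmx mulrAC.
Qed.

Section Hypersurface.
Variable R : realType.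
Local Notation C := (R[i]).

Lemma sum_delta_var (x : mon 6) :
  \sum_i 'X_i * (x == enum_val i)%:R%:MP = 'X_(enum_rank x) :> {mpoly C[N6]}.
Proof.
rewrite -[x in LHS]enum_rankK; move: (enum_rank x) => k; rewrite (bigD1 k) // eqxx mpolyC1 mulr1.
rewrite big1 => [|m /negPf nm]; first exact: addr0.
by rewrite (inj_eq enum_val_inj) eq_sym nm mpolyC0 mulr0.
Qed.

Lemma catdet_pencil : \det (pencil_mpoly (pencil_of (@cat33 R))) = catdet R.
Proof.
congr (\det _); apply/matrixP => i j; rewrite [RHS]mxE /pencil_mpoly summxE -sum_delta_var.
by apply: eq_bigr => m _; rewrite 2!mxE /pencil_of [cat33 _ _ _]mxE.
Qed.

Lemma meval_catdet (a : S6 R) : (catdet R).@[coords a] = \det (cat33 a).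
Proof.
rewrite /catdet meval_det; congr (\det _); apply/matrixP => i j; rewrite !mxE mevalXU.
by rewrite /coords enum_rankK.
Qed.

Lemma vanish_catdet : vanish (catdet R) (@secant R 9).
Proof.
move=> a /rank_cat33_secant rk; rewrite meval_catdet; apply/eqP; apply: contraTT rk => nz.
by rewrite -ltnNge mxrank_unit ?card_mon3 // unitmxE unitfE.
Qed.

Lemma vanish_secant9 P : vanish P (@secant R 9) -> mdivides (catdet R) P.
Proof.
move=> vP; have /and3P [catc kerc conc] := hypersurface_check9.
have [E [F EF]] := cat33_conormal R (erefl 9%N : size points9 = 9%N) catc kerc kerc.
have [c gE] := pencil_minor_square (pencil_of (@cat33 R)) E F card_mon3.
rewrite catdet_pencil in gE.
have dg (j : 'I_1) w : exists y,
     mmap (@polyC C)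
       (fun i => (coords (powsum (fun i : 'I_9 => pvec C (nth [::] points9 i))) i)%:P + 'X * (w i)%:P)
       (pencil_minor (pencil_of (@cat33 R)) E F) = 'X * y /\
     y.[0] = pairing (nth [::] [:: zmul 3 3 cubic9 cubic9] j) (fun m => w (enum_rank m)).
  by rewrite [j]ord1; exact: EF.
have vg (j : 'I_1) : vanish (pencil_minor (pencil_of (@cat33 R)) E F) (@powsums R 9).
  by move=> a Sa; rewrite gE mevalM (vanish_catdet (sub_zclosure Sa)); exact: mulr0.
have vP' : vanish P (@powsums R 9) by apply/vanish_zclosure.
have [s [h [sp e]]] := secant_conormal_certificate (erefl _ : (9 + (9 + 9) + 1)%N = size (monl 6)) conc dg vg vP'.
have [_ prime_cat] := mprime_leading10 R; rewrite -catdet_leading in prime_cat.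
have [||//] := prime_cat s P.
  by exists (h ord0 * c); rewrite e big_ord1 gE mulrA.
(* The determinant cannot divide s: it vanishes at p and s does not. *)
move=> [t st]; case/eqP: sp; rewrite st mevalM.
rewrite (vanish_catdet (sub_zclosure (ex_intro _ _ erefl))); exact: mulr0.
Qed.

End Hypersurface.

Theorem theorem4p12 (R : realType) :
  [/\ irr_component (@secant R 7)
        (fun a => (\rank (cat33 a) <= 7)%N /\ pieri_rank_le a 21),
      irr_component (@secant R 8)
        (fun a => (\rank (cat33 a) <= 8)%N /\ pieri_rank_le a 24),
      (forall a, @secant R 9 a <-> (@catdet R).@[@coords R a] = 0),
      (forall P : {mpoly R[i][N6]},
          vanish P (@secant R 9) <-> exists Q, P = Q * @catdet R) &
      msize (@catdet R) = 11%N].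
Proof.
split.
- exact: (secant_component R component_check7).
- exact: (secant_component R component_check8).
- move=> a; split=> [Sa|e P vP]; first exact: vanish_catdet.
  have [Q ->] : mdivides (catdet R) P by apply/vanish_secant9/vanish_zclosure.
  by rewrite mevalM e mulr0.
- move=> P; split=> [/vanish_secant9 //|[Q ->] a Sa].
  by rewrite mevalM vanish_catdet // mulr0.
- exact: msize_catdet.
Qed.
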